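(* Let $X$ be a connected smooth complex projective curve, $D\subset X$ a non-empty finite set of points, $U=X\setminus D$, $(V,\nabla)$ a locally free $\mathcal O_U$-module of finite rank with connection, and $\varpi:\widetilde X\to X$ the oriented real blow-up of $X$ at each point of $D$, $\widetilde D=\varpi^{-1}(D)$. Let $\sigma\in H_1^{\mathrm{mod}}(\widetilde X,\widetilde{\mathcal V})$ be represented by a finite sum $\sum_\ell c_\ell\otimes v_\ell$ (a twisted cycle), where each $c_\ell:[0,1]\to\widetilde X$ is a piecewise smooth simplex with $c_\ell((0,1))\subset U$ and $v_\ell$ is a horizontal section of $\mathcal A^{\mathrm{mod}}_{\widetilde X}\otimes\widetilde{\mathcal V}$ on a neighbourhood of the support of $c_\ell$. Let $(\widehat m,\omega)\in\mathcal V^\vee_{\widehat D}\oplus\Gamma(U,\Omega^1_U\otimes V^\vee)$ be a representative of a class $[(\widehat m,\omega)]\in H^1_{\mathrm{dR},\mathrm c}(U,V^\vee)$. For $o\in\{0,1\}$, if $c_\ell(o)\in\widetilde D$, let $\widetilde m_{\ell,o}$ be a germ in $\widetilde{\mathcal V}^\vee_{c_\ell(o)}$ having as asymptotic expansion at $c_\ell(o)$ the component $\widehat m_{\ell,o}$ of $\widehat m$ at $\varpi(c_\ell(o))\in D$; otherwise let $\widetilde m_{\ell,o}=0$. Then $$\mathsf P^{\mathrm{mod},\mathrm{rd}}_1(\sigma,[(\widehat m,\omega)])=\sum_\ell\lim_{\varepsilon\to0}\Bigl[\int_\varepsilon^{1-\varepsilon}c_\ell^*\bigl((v_\ell\mid\omega)\bigr)+(v_\ell\mid\widetilde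 m_{\ell,0})(c_\ell(\varepsilon))-(v_\ell\mid\widetilde m_{\ell,1})(c_\ell(1-\varepsilon))\Bigr].$$
   Context: Put $\mathcal V=j_*V$, $\mathcal V^\vee=j_*V^\vee$ for $j:U\hookrightarrow X$ and $V^\vee$ the dual bundle with connection. $\mathcal V^\vee_{\widehat D}=\mathcal O_{\widehat D}\otimes\mathcal V^\vee$, $\mathcal O_{\widehat D}=\bigoplus_{x\in D}\widehat{\mathcal O}_{X,x}$, with connection $\widehat\nabla$; $\iota_{\widehat D}$ is the formal expansion map at $D$. $H^1_{\mathrm{dR},\mathrm c}(U,V^\vee)$ (de Rham cohomology with compact support) is the space of pairs $(\widehat m,\omega)\in\mathcal V^\vee_{\widehat D}\oplus\Gamma(U,\Omega^1_U\otimes V^\vee)$ with $\widehat\nabla\widehat m=\iota_{\widehat D}\omega$, modulo pairs $(\iota_{\widehat D}u,\nabla u)$, $u\in\Gamma(U,V^\vee)$. $(\cdot\mid\cdot)$ is the tautological pairing $V\otimes V^\vee\to\mathcal O_U$. On $\widetilde X$ (a manifold with boundary $\widetilde D$, with polar coordinates $(r,e^{i\theta})$, $z=re^{i\theta}$, near $\widetilde D$), $\mathcal A_{\widetilde X}$ is the sheaf of $C^\infty$ functions on $\widetilde X$ that are annihilated by the Cauchy–Riemann operator (they are holomorphic on $U$ and have asymptotic expansions in $\mathbf C[[z]]$ at points of $\widetilde D$); $\mathcal A^{\mathrm{mod}}_{\widetilde X}$ (resp. $\mathcal A^{\mathrm{rd}}_{\widetilde X}$) is the sheaf of holomorphic functions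 on $U$ with moderate growth (resp. rapid decay) along $\widetilde D$; $\widetilde{\mathcal V}=\mathcal A_{\widetilde X}\otimes_{\varpi^{-1}\mathcal O_X}\varpi^{-1}\mathcal V$, similarly $\widetilde{\mathcal V}^\vee$. $\widetilde{\mathcal V}^{\mathrm{mod}}$ is the sheaf of horizontal sections of $\mathcal A^{\mathrm{mod}}_{\widetilde X}\otimes\widetilde{\mathcal V}$, and $H_1^{\mathrm{mod}}(\widetilde X,\widetilde{\mathcal V})$ is the first homology of piecewise smooth singular chains of $\widetilde X$ relative to $\widetilde D$ with coefficients in the sheaf $\widetilde{\mathcal V}^{\mathrm{mod}}$. $H^1_{\mathrm{dR},\mathrm c}(U,V^\vee)\simeq H^1_{\mathrm{dR},\mathrm{rd}}(\widetilde X,\widetilde{\mathcal V}^\vee)$, the cohomology of $C^\infty$ forms with rapid decay along $\widetilde D$ with values in $\mathcal V^\vee$ and differential $\nabla+\bar\partial$, sends $(\widehat m,\omega)$ to the class of $\eta_\infty=\omega-(\nabla+\bar\partial)m_\infty$, where $m_\infty\in\Gamma(X,\mathcal C_X^\infty\otimes_{\mathcal O_X}\mathcal V^\vee)$ has Taylor series $\widehat m$ at $D$. The period pairing $\mathsf P_1^{\mathrm{mod},\mathrm{rd}}:H_1^{\mathrm{mod}}(\widetilde X,\widetilde{\mathcal V})\otimes H^1_{\mathrm{dR},\mathrm{rd}}(\widetilde X,\widetilde{\mathcal V}^\vee)\to\mathbf C$ is $(\sum_\ell c_\ell\otimes v_\ell,\eta_\infty)\mapsto\sum_\ell\int_0^1c_\ell^*((v_\ell\mid\eta_\infty))$.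 *)

(* Defs.v *)
From HB Require Import structures.
From Stdlib Require List.
From mathcomp Require Import all_boot all_order all_algebra.
From mathcomp Require Import complex.
From mathcomp Require Import all_classical all_reals all_analysis.
From mathcomp Require mpoly.

Set Implicit Arguments.
Unset Strict Implicit.
Unset Printing Implicit Defensive.
Import Order.TTheory GRing.Theory Num.Theory numFieldNormedType.Exports.
Local Open Scope classical_set_scope.
Local Open Scope complex_scope.
Local Open Scope ring_scope.

(* Complex numbers are R[i] for R : realType; cmod is the modulus with values
   in R. *)
Definition cmod (R : realType) (w : R[i]) : R := Normc.normc w.

Definition cis (R : realType) (t : R) : R[i] := cos t +i* sin t.

Section Smooth.
Variables (R : realType) (V : normedModType R).

Definition smooth_on (A : set V) (f : V -> R) : Prop :=
  forall (vs : seq V) (a : V), A a ->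
    differentiable (foldr (fun v g => 'D_v g) f vs) a.

Definition csmooth_on (A : set V) (F : V -> R[i]) : Prop :=
  smooth_on A (fun a => complex.Re (F a)) /\
  smooth_on A (fun a => complex.Im (F a)).

Definition cderive (v : V) (F : V -> R[i]) (a : V) : R[i] :=
  'D_v (fun b => complex.Re (F b)) a +i* 'D_v (fun b => complex.Im (F b)) a.

Definition hull (vs : seq V) : set V :=
  [set a | exists k : 'I_(size vs) -> R,
     [/\ forall i, 0 <= k i, \sum_i k i = 1 & a = \sum_i k i *: vs`_i]].

End Smooth.

Section Plane.
Variable R : realType.
Local Notation C := R[i].

Definition disc (e : R) : set (R * R) := [set a | cmod (a.1 +i* a.2) < e].

Definition plane (F : C -> C) : R * R -> C := fun a => F (a.1 +i* a.2).

(* the Wirtinger operators d/dw and d/dwbar *)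
Definition dw (F : C -> C) (w : C) : C :=
  let a := (complex.Re w, complex.Im w) in
  (@cderive R (R * R)%type (1, 0) (plane F) a - 'i * @cderive R (R * R)%type (0, 1) (plane F) a) / 2%:R.

Definition dwbar (F : C -> C) (w : C) : C :=
  let a := (complex.Re w, complex.Im w) in
  (@cderive R (R * R)%type (1, 0) (plane F) a + 'i * @cderive R (R * R)%type (0, 1) (plane F) a) / 2%:R.

Definition holo_disc (e : R) (F : C -> C) : Prop :=
  csmooth_on (disc e) (plane F) /\ forall w, cmod w < e -> dwbar F w = 0.

Definition cint (a b : R) (F : R -> C) : C :=
  Rintegral lebesgue_measure `[a, b] (fun t => complex.Re (F t)) +i*
  Rintegral lebesgue_measure `[a, b] (fun t => complex.Im (F t)).

End Plane.

(* Projective space P^n over R[i]: a point is its unique vector of homogeneous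
   coordinates whose first nonzero entry is 1. *)
Section ProjectiveSpace.
Variables (R : realType) (n : nat).
Local Notation C := R[i].

Definition normalized (v : 'rV[C]_n.+1) : bool :=
  [exists i : 'I_n.+1, (v 0 i == 1) && [forall j : 'I_n.+1, (j < i)%N ==> (v 0 j == 0)]].

Definition Pn := {v : 'rV[C]_n.+1 | normalized v}.

Definition hcoord (x : Pn) (j : 'I_n.+1) : C := val x 0 j.

Local Notation poly := (mpoly.mpoly n.+1 C).

Definition homog (d : nat) (p : poly) : Prop :=
  forall m, mpoly.mcoeff m p != 0 -> mpoly.mdeg m = d.

Definition peval (p : poly) (x : Pn) : C := mpoly.meval (hcoord x) p.

Definition Zclosed (A : set Pn) : Prop :=
  exists S : set poly, (forall p, S p -> exists d, homog d p) /\
    A = [set x | forall p, S p -> peval p x = 0].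

Definition Zconnected (X : set Pn) : Prop :=
  X !=set0 /\ forall A B, Zclosed A -> Zclosed B ->
    X `<=` A `|` B -> X `&` A `&` B = set0 -> X `<=` A \/ X `<=` B.

(* Jacobian criterion: at each point, the linear tangent space of the affine
   cone over X, cut out by the differentials of the homogeneous equations of X,
   has dimension 2; equivalently the Jacobian matrix has rank n - 1. *)
Definition smooth_dim1 (X : set Pn) : Prop :=
  forall x, X x -> exists B : 'M[C]_(2, n.+1), row_free B /\
    forall v : 'rV[C]_n.+1,
      (v <= B)%MS <->
      (forall d p, homog d p -> (forall y, X y -> peval p y = 0) ->
        \sum_j peval (mpoly.mderiv j p) x * v 0 j = 0).

(* P holds on a Zariski neighbourhood of x in X *)
Definition znear (X : set Pn) (x : Pn) (P : Pn -> Prop) : Prop :=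
  exists d q, [/\ homog d q, peval q x != 0 &
    forall y, X y -> peval q y != 0 -> P y].

Definition regular_at (X : set Pn) (f : Pn -> C) (x : Pn) : Prop :=
  exists d p q, [/\ homog d p, homog d q, peval q x != 0 &
    forall y, X y -> peval q y != 0 -> f y = peval p y / peval q y].

(* z is a local coordinate of X at p, with local inverse phi: z is a regular
   function near p, and phi maps a disc holomorphically and bijectively onto a
   neighbourhood of p in X for the classical topology. *)
Definition local_coordinate (X : set Pn) (p : Pn) (z : Pn -> C) (phi : C -> Pn)
    : Prop :=
  regular_at X z p /\ phi 0 = p /\
  exists (j : 'I_n.+1) (e : R), [/\ hcoord p j != 0, 0 < e,
    forall w, cmod w < e ->
      [/\ X (phi w), z (phi w) = w & hcoord (phi w) j != 0],
    forall k, holo_disc e (fun w => hcoord (phi w) k / hcoord (phi w) j) &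
    exists2 d : R, 0 < d & forall y, X y -> hcoord y j != 0 ->
      (forall k, cmod (hcoord y k / hcoord y j - hcoord p k / hcoord p j) < d)
      -> exists2 w, cmod w < e & phi w = y].

End ProjectiveSpace.

(* A projective curve X with a finite set D of marked points and a choice, at
   each p in X, of a local coordinate and of its local inverse. *)
Record marked_curve (R : realType) := MarkedCurve {
  amb : nat;
  pts : set (Pn R amb);
  marked : set (Pn R amb);
  coord : Pn R amb -> Pn R amb -> R[i];
  param : Pn R amb -> R[i] -> Pn R amb }.
Arguments amb {R} m.
Arguments pts {R} m.
Arguments marked {R} m.
Arguments coord {R} m.
Arguments param {R} m.

Definition smooth_projective_curve (R : realType) (G : marked_curve R) : Prop :=
  [/\ Zclosed (pts G), Zconnected (pts G) & smooth_dim1 (pts G)].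

Definition is_marking (R : realType) (G : marked_curve R) : Prop :=
  [/\ marked G `<=` pts G, finite_set (marked G) & marked G !=set0].

Definition has_coordinates (R : realType) (G : marked_curve R) : Prop :=
  forall p, pts G p -> local_coordinate (pts G) p (coord G p) (param G p).

(* A locally free O_U-module of finite rank with connection, in a trivializing
   cover: a section has components s_i on opn i with s_i = trans i j *m s_j,
   and nabla s has components d s_i + cmx i *m s_i.  Here and below, the value
   at q of a 1-form is given by its coefficients on the basis dz, dzbar for
   the coordinate z chosen at q itself. *)
Record bundle (R : realType) (n : nat) := Bundle {
  rank : nat;
  idx : finType;
  opn : idx -> set (Pn R n);
  trans : idx -> idx -> Pn R n -> 'M[R[i]]_rank;
  cmx : idx -> Pn R n -> 'M[R[i]]_rank }.
Arguments rank {R n} b.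
Arguments idx {R n} b.
Arguments opn {R n} b.
Arguments trans {R n} b.
Arguments cmx {R n} b.

Definition dual (R : realType) (n : nat) (E : bundle R n) : bundle R n :=
  Bundle (opn E) (fun i j q => (trans E j i q)^T)
    (fun i q => - (cmx E i q)^T).

Section Curve.
Variables (R : realType) (G : marked_curve R).
Local Notation C := R[i].
Local Notation X := (pts G).
Local Notation D := (marked G).
Local Notation z := (coord G).
Local Notation phi := (param G).
Local Notation pt := (Pn R (amb G)).

Definition open_part : set pt := X `\` D.
Local Notation U := open_part.

Definition del (f : pt -> C) (q : pt) : C := dw (fun w => f (phi q w)) 0.
Definition delbar (f : pt -> C) (q : pt) : C := dwbar (fun w => f (phi q w)) 0.

Definition entrywise m k (op : (pt -> C) -> pt -> C) (F : pt -> 'M[C]_(m, k))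
    (q : pt) : 'M[C]_(m, k) := \matrix_(a, b) op (fun y => F y a b) q.

(* coefficients on dz_p, resp. on its conjugate, of the forms f and g of type
   (1,0), resp. (0,1) *)
Definition coef10 (p : pt) (f : pt -> C) : pt -> C :=
  fun q => f q / del (z p) q.
Definition coef01 (p : pt) (g : pt -> C) : pt -> C :=
  fun q => g q / (del (z p) q)^*%C.

Definition regular_form_at (f : pt -> C) (p : pt) : Prop :=
  exists h, regular_at X h p /\ znear X p (fun q => f q = h q * del (z p) q).

Definition smooth_at (f : pt -> C) (p : pt) : Prop :=
  exists2 e : R, 0 < e & csmooth_on (disc e) (plane (fun w => f (phi p w))).

Definition holo_at (f : pt -> C) (p : pt) : Prop :=
  exists2 e : R, 0 < e & holo_disc e (fun w => f (phi p w)).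

(* rapid decay at x in D, together with all derivatives *)
Definition rapid_at (f : pt -> C) (x : pt) : Prop :=
  forall k l N : nat, exists K e : R, 0 < e /\ forall w, 0 < cmod w < e ->
    cmod (iter k (@dw R) (iter l (@dwbar R) (fun w' => f (phi x w'))) w)
      <= K * cmod w ^+ N.

(* Non-empty Zariski open subsets of the (irreducible) curve X are exactly the
   complements of finite sets. *)
Definition is_bundle (E : bundle R (amb G)) : Prop :=
  [/\ forall i, opn E i `<=` U /\ finite_set (X `\` opn E i),
      forall q, U q -> exists i, opn E i q,
      forall i j q, opn E i q -> opn E j q ->
        forall a b, regular_at X (fun y => trans E i j y a b) q,
      (forall i q, opn E i q -> trans E i i q = 1%:M) /\
      (forall i j k q, opn E i q -> opn E j q -> opn E k q ->
        trans E i j q *m trans E j k q = trans E i k q) &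
      (forall i q, opn E i q ->
        forall a b, regular_form_at (fun y => cmx E i y a b) q) /\
      (forall i j q, opn E i q -> opn E j q ->
        entrywise del (trans E i j) q + cmx E i q *m trans E i j q
        = trans E i j q *m cmx E j q)].

Section Sections.
Variable E : bundle R (amb G).

Definition sect := idx E -> pt -> 'cV[C]_(rank E).

(* a form a dz + b dzbar with coefficients in E *)
Definition form := (sect * sect)%type.

Definition glued (W : set pt) (s : sect) : Prop :=
  forall i j q, W q -> opn E i q -> opn E j q -> s i q = trans E i j q *m s j q.

Definition nabla (s : sect) : sect :=
  fun i q => entrywise del (s i) q + cmx E i q *m s i q.
Definition dbar (s : sect) : sect := fun i q => entrywise delbar (s i) q.

Definition regular_section (s : sect) : Prop :=
  glued U s /\
  forall i q, opn E i q -> forall a, regular_at X (fun y => s i y a 0) q.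

Definition regular_form (s : sect) : Prop :=
  glued U s /\
  forall i q, opn E i q -> forall a, regular_form_at (fun y => s i y a 0) q.

(* Formal expansions at x in D in powers of the coordinate z at x.  A Laurent
   series is a function of the exponent k : int that vanishes for k << 0. *)
Definition is_expansion (x : pt) (f : pt -> C) (a : int -> C) : Prop :=
  exists N : nat, (forall k : int, k < - N%:Z -> a k = 0) /\
    forall M : nat, exists u, regular_at X u x /\
      znear X x (fun y => y <> x -> z x y ^+ N * f y =
        \sum_(k < M) a (k%:Z - N%:Z) * z x y ^+ k + z x y ^+ M * u y).

Definition iota (x : pt) (f : pt -> C) : int -> C :=
  xget (fun=> 0) [set a | is_expansion x f a].

Definition iotamx m k (x : pt) (F : pt -> 'M[C]_(m, k)) (l : int)
    : 'M[C]_(m, k) := \matrix_(a, b) iota x (fun y => F y a b) l.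

Definition lmul m k l (A : int -> 'M[C]_(m, k)) (B : int -> 'M[C]_(k, l))
    : int -> 'M[C]_(m, l) :=
  fun h => \sum_(g \in [set: int]) (A g *m B (h - g)).

(* an element of the sum over x in D of the formal completions of j_*E at x:
   at each x, its Laurent series in each of the frames *)
Definition formal := pt -> idx E -> int -> 'cV[C]_(rank E).

Definition formal_section (m : formal) : Prop :=
  forall x, D x ->
    (forall i, exists N : nat, forall k : int, k < - N%:Z -> m x i k = 0) /\
    (forall i j k, m x i k = lmul (iotamx x (trans E i j)) (m x j) k).

(* the coefficient of dz in the formal connection *)
Definition nablahat (m : formal) : formal := fun x i k =>
  (k + 1)%:~R *: m x i (k + 1)
  + lmul (iotamx x (entrywise (coef10 x) (cmx E i))) (m x i) k.

Definition c_cocycle (mo : formal * sect) : Prop :=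
  [/\ formal_section mo.1, regular_form mo.2 &
    forall x, D x -> forall i k, nablahat mo.1 x i k =
      iotamx x (entrywise (coef10 x) (mo.2 i)) k].

Definition c_cohomologous (mo mo' : formal * sect) : Prop :=
  exists u, [/\ regular_section u,
    forall x, D x -> forall i k, mo.1 x i k - mo'.1 x i k = iotamx x (u i) k &
    forall i q, opn E i q -> mo.2 i q - mo'.2 i q = nabla u i q].

Definition H1c := {kappa : set (formal * sect) | exists2 mo, c_cocycle mo &
  kappa = [set mo' | c_cocycle mo' /\ c_cohomologous mo mo']}.

Definition rd_section (u : sect) : Prop :=
  [/\ glued U u,
    forall i q, opn E i q -> forall a, smooth_at (fun y => u i y a 0) q &
    forall i x, D x -> forall a, rapid_at (fun y => u i y a 0) x].

Definition rd_form (eta : form) : Prop :=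
  [/\ glued U eta.1, glued U eta.2,
    forall i q, opn E i q -> forall a,
      smooth_at (coef10 q (fun y => eta.1 i y a 0)) q /\
      smooth_at (coef01 q (fun y => eta.2 i y a 0)) q &
    forall i x, D x -> forall a,
      rapid_at (coef10 x (fun y => eta.1 i y a 0)) x /\
      rapid_at (coef01 x (fun y => eta.2 i y a 0)) x].

(* (nabla + dbar) (a dz + b dzbar)
   = (d_z b + A b - d_zbar a) dz /\ dzbar, where A dz is the connection form *)
Definition closed_form (eta : form) : Prop :=
  forall i q, opn E i q ->
    entrywise del (entrywise (coef01 q) (eta.2 i)) q + cmx E i q *m eta.2 i q
    - entrywise delbar (entrywise (coef10 q) (eta.1 i)) q = 0.

Definition rd_cocycle (eta : form) : Prop := rd_form eta /\ closed_form eta.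

Definition rd_cohomologous (eta eta' : form) : Prop :=
  exists u, rd_section u /\ forall i q, opn E i q ->
    eta.1 i q - eta'.1 i q = nabla u i q /\
    eta.2 i q - eta'.2 i q = dbar u i q.

Definition H1rd := {kappa : set form | exists2 eta, rd_cocycle eta &
  kappa = [set eta' | rd_cocycle eta' /\ rd_cohomologous eta eta']}.

(* s is a section over X of C^oo (x) j_*E whose Taylor series at D is m: at
   x in D, for each frame, z^N s_i extends to a smooth F near x, with Taylor
   series z^N m_i in z, zbar. *)
Definition smooth_with_taylor (s : sect) (m : formal) : Prop :=
  [/\ glued U s,
    forall i q, opn E i q -> forall a, smooth_at (fun y => s i y a 0) q &
    forall i x, D x -> forall a, exists (N : nat) (e : R) (F : C -> C),
      [/\ 0 < e, csmooth_on (disc e) (plane F),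
        forall w, 0 < cmod w < e -> w ^+ N * s i (phi x w) a 0 = F w,
        forall k : int, k < - N%:Z -> m x i k a 0 = 0 &
        forall k l : nat, iter k (@dw R) (iter l (@dwbar R) F) 0 =
          if l == 0%N then (k`!)%:R * m x i (k%:Z - N%:Z) a 0 else 0]].

Definition eta_infty (omega s : sect) : form :=
  (fun i q => omega i q - nabla s i q, fun i q => - dbar s i q).

End Sections.

(* The oriented real blow-up of X at D, in the polar coordinates given by the
   coordinate at each x in D: its points are the q in U and, for x in D, the
   pairs (x, u) with |u| = 1. *)
Inductive bpoint := In of pt | Bd of pt & C.

Definition blowup : set bpoint :=
  [set xi | match xi with In q => U q | Bd x u => D x /\ cmod u = 1 end].

Definition is_bd (xi : bpoint) : Prop := if xi is Bd _ _ then True else False.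

Definition bnear (xi : bpoint) (P : bpoint -> Prop) : Prop :=
  match xi with
  | In p => exists2 e : R, 0 < e & forall w, cmod w < e -> P (In (phi p w))
  | Bd x u => exists2 e : R, 0 < e &
      (forall w, 0 < cmod w < e -> cmod (w / (cmod w)%:C - u) < e ->
        P (In (phi x w))) /\
      (forall u', cmod u' = 1 -> cmod (u' - u) < e -> P (Bd x u'))
  end.

(* a property of the points of U, on a neighbourhood of xi in the blow-up *)
Definition bnearU (xi : bpoint) (P : pt -> Prop) : Prop :=
  bnear xi (fun zeta => if zeta is In q then P q else True).

Definition bopen (W : set bpoint) : Prop :=
  W `<=` blowup /\ forall xi, W xi -> bnear xi W.

Section Simplices.
Variable V : normedModType R.

Definition smooth_map_at (T : set V) (c : V -> bpoint) (t : V) : Prop :=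
  match c t with
  | In p => exists (e : R) (g : V -> C), [/\ 0 < e, csmooth_on (ball t e) g,
      g t = 0 & forall s, T s -> ball t e s -> c s = In (phi p (g s))]
  | Bd x u => exists (e : R) (r th : V -> R), [/\ 0 < e,
      smooth_on (ball t e) r, smooth_on (ball t e) th,
      r t = 0 /\ cis (th t) = u &
      forall s, T s -> ball t e s -> 0 <= r s /\
        c s = if r s == 0 then Bd x (cis (th s))
              else In (phi x ((r s)%:C * cis (th s)))]
  end.

(* K is a finite union of compact convex polytopes on each of which c is
   smooth *)
Definition piecewise_smooth (K : set V) (c : V -> bpoint) : Prop :=
  exists Ts : seq (seq V), K = [set t | exists2 T, T \in Ts & hull T t] /\
    forall T, T \in Ts -> forall t, hull T t -> smooth_map_at (hull T) c t.

End Simplices.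

Definition simplex1 : set R := `[0, 1].
Definition simplex2 : set (R * R) :=
  [set a | [/\ 0 <= a.1, 0 <= a.2 & a.1 + a.2 <= 1]].

Section Homology.
Variable E : bundle R (amb G).

Definition germ_eq (xi : bpoint) (s s' : sect E) : Prop :=
  bnearU xi (fun q => forall i, opn E i q -> s i q = s' i q).

(* horizontal sections on W of A^mod (x) j_*E *)
Definition horizontal_mod (W : set bpoint) (s : sect E) : Prop :=
  [/\ glued [set q | W (In q)] s,
    forall i q, W (In q) -> opn E i q ->
      (forall a, holo_at (fun y => s i y a 0) q) /\ nabla s i q = 0 &
    forall x u, W (Bd x u) -> forall i, exists (N : nat) (K : R),
      bnearU (Bd x u)
        (fun q => forall a, cmod (s i q a 0) <= K * cmod (z x q) ^- N)].

(* A singular chain with coefficients in this sheaf F is a list of pairs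
   (c, v): c is a simplex with domain K, and v a section of c^-1 F, i.e. a
   family of germs v t of F at the points c t. *)
Section Chains.
Variables (V : normedModType R) (K : set V).

Definition chain := seq ((V -> bpoint) * (V -> sect E)).

Definition section_along (c : V -> bpoint) (v : V -> sect E) : Prop :=
  forall t, K t -> exists W s, [/\ bopen W, horizontal_mod W s, W (c t) &
    exists2 e : R, 0 < e & forall t', K t' -> ball t e t' ->
      W (c t') /\ germ_eq (c t') (v t') s].

Definition is_chain (Z : chain) : Prop :=
  List.Forall (fun cv => [/\ forall t, K t -> blowup (cv.1 t),
    piecewise_smooth K cv.1 & section_along cv.1 cv.2]) Z.

Definition oppc (Z : chain) : chain :=
  [seq (cv.1, fun t i q => - cv.2 t i q) | cv <- Z].

(* Z is zero as a chain relative to the boundary: the total coefficient of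
   each simplex not contained in the boundary vanishes. *)
Definition null_chain (Z : chain) : Prop :=
  forall c0 : V -> bpoint, ~ (forall t, K t -> is_bd (c0 t)) ->
    forall t, K t -> germ_eq (c0 t)
      (fun i q => \sum_(cv <- Z | `[< forall t', K t' -> cv.1 t' = c0 t' >])
         cv.2 t i q)
      (fun _ _ => 0).

End Chains.

Definition is_cycle (Z : chain R) : Prop :=
  is_chain simplex1 Z /\ forall p, U p -> germ_eq (In p)
    (fun i q => \sum_(cv <- Z | `[< cv.1 1 = In p >]) cv.2 1 i q
              - \sum_(cv <- Z | `[< cv.1 0 = In p >]) cv.2 0 i q)
    (fun _ _ => 0).

Definition precomp (f : R -> R * R) (B : chain (R * R)%type) : chain R :=
  [seq (cv.1 \o f, cv.2 \o f) | cv <- B].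

(* the vertices of simplex2 are (0, 0), (1, 0), (0, 1) in this order *)
Definition boundary2 (B : chain (R * R)%type) : chain R :=
  precomp (fun t => (1 - t, t)) B ++ oppc (precomp (fun t => (0, t)) B)
  ++ precomp (fun t => (t, 0)) B.

Definition homologous (Z Z' : chain R) : Prop :=
  exists B : chain (R * R)%type, is_chain simplex2 B /\
    null_chain simplex1 (Z ++ oppc Z' ++ oppc (boundary2 B)).

Definition H1mod := {sigma : set (chain R) | exists2 Z, is_cycle Z &
  sigma = [set Z' | is_cycle Z' /\ homologous Z Z']}.

(* the tautological pairing, in any frame at q *)
Definition pairing (v : sect E) (w : sect (dual E)) (q : pt) : C :=
  if [pick i | `[< opn E i q >]] is Some i
  then \sum_a v i q a 0 * w i q a 0 else 0.

Definition bpairing (v : sect E) (w : sect (dual E)) (xi : bpoint) : C :=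
  if xi is In q then pairing v w q else 0.

Definition bcoord (q : pt) (xi : bpoint) : C :=
  if xi is In y then z q y else 0.

(* the pull-back c^*(v | eta), as a function on [0, 1]; (v | eta) is extended
   by zero to the boundary of the blow-up *)
Definition pullback (c : R -> bpoint) (v : R -> sect E) (eta : form (dual E))
    (t : R) : C :=
  if c t is In q then
    let g' := @cderive R R 1 (fun s => bcoord q (c s)) t in
    pairing (v t) eta.1 q * g' + pairing (v t) eta.2 q * (g')^*%C
  else 0.

(* The period pairing: the map on classes given on representatives by
   (sum_l c_l (x) v_l, eta) |-> sum_l int_0^1 c_l^* (v_l | eta). *)
Definition is_period_pairing (P : H1mod -> H1rd (dual E) -> C) : Prop :=
  forall (sigma : H1mod) (kappa : H1rd (dual E)) Z eta,
    sval sigma Z -> sval kappa eta ->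
    P sigma kappa = \sum_(cv <- Z) cint 0 1 (pullback cv.1 cv.2 eta).

End Homology.

(* The comparison isomorphism: it sends the class of (m, omega) to the class
   of omega - (nabla + dbar) s, where s is smooth with Taylor series m. *)
Definition is_comparison (E : bundle R (amb G)) (Phi : H1c E -> H1rd E)
    : Prop :=
  forall (kappa : H1c E) m omega, sval kappa (m, omega) ->
    exists s, smooth_with_taylor s m /\ sval (Phi kappa) (eta_infty omega s).

(* s is a germ at the boundary point (x, u) of A (x) j_*E, with asymptotic
   expansion m at this point.  For each frame, z^N s_i = G extends smoothly in
   (r, theta) across r = 0. *)
Definition germ_with_expansion (E : bundle R (amb G)) (x : pt) (u : C)
    (s : sect E) (m : idx E -> int -> 'cV[C]_(rank E)) : Prop :=
  (exists W, [/\ bopen W, W (Bd x u), glued [set q | W (In q)] s &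
    forall i q, W (In q) -> opn E i q ->
      forall a, holo_at (fun y => s i y a 0) q]) /\
  forall i a, exists N : nat,
    [/\ exists (th0 e : R) (F : R * R -> C), [/\ 0 < e, cis th0 = u,
          csmooth_on [set b | `|b.1| < e /\ `|b.2 - th0| < e] F &
          forall r th, 0 < r < e -> `|th - th0| < e ->
            let w := r%:C * cis th in w ^+ N * s i (phi x w) a 0 = F (r, th)],
        forall k : int, k < - N%:Z -> m i k a 0 = 0 &
        forall M : nat, exists K : R, bnearU (Bd x u) (fun q =>
          cmod (z x q ^+ N * s i q a 0
                - \sum_(k < M) m i (k%:Z - N%:Z) a 0 * z x q ^+ k)
          <= K * cmod (z x q) ^+ M)].

End Curve.

(* Main.v *)
(* Let s be a smooth section with Taylor series m at D, so that the class of
   (m, omega) is sent to eta = omega - (nabla + dbar) s, and put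
   H_l(t) = (v_l | s)(c_l(t)).  Since v_l is horizontal, the derivative of H_l is
   the pull-back of (v_l | (nabla + dbar) s), outside the finitely many
   break-points of c_l.  The expression under the limit is therefore

     int_e^{1-e} c_l^*(v_l | eta)
       + ((v_l | mt_{l,0}) - H_l)(e) - ((v_l | mt_{l,1}) - H_l)(1 - e).

   At an end of c_l in the boundary, mt and s have the same expansion, so their
   difference decays faster than any power of |z| and beats the moderate growth
   of v_l; at an end in U, mt = 0 and H_l is continuous.  As the pull-back of
   (v_l | eta) is bounded, by rapid decay of eta, the limit is
   int_0^1 c_l^*(v_l | eta) + H_l(1) - H_l(0), where H_l vanishes at the ends on
   the boundary.  The sum over l of H_l(1) - H_l(0) is zero because the chain is
   a relative cycle. *)

Require Import Defs.
From mathcomp Require Import all_boot all_order all_algebra.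
From mathcomp Require Import complex.
From mathcomp Require Import all_classical all_reals all_analysis.
From mathcomp Require Import measurable_realfun zify ring lra.
From mathcomp Require Import (canonicals, coercions) mpoly.
Import Order.TTheory GRing.Theory Num.Theory numFieldNormedType.Exports.
Set Implicit Arguments.
Unset Strict Implicit.
Unset Printing Implicit Defensive.
Local Open Scope classical_set_scope.
Local Open Scope complex_scope.
Local Open Scope ring_scope.

(** * Integration off a finite set *)

(** The value of a 1-form at q is its coefficient in the coordinate chosen at q, and the coordinates
    chosen at neighbouring points are unrelated. The integrand is therefore not visibly continuous
    or bounded, even where the path is smooth. Each such claim is proved in one fixed chart, at a
    point of U or at a point of D, and transported by the derivative of the change of charts.

    The chart description of a path is two-sided only away from the vertices of its smooth pieces,
    so all integration is done for functions that are continuous off a finite set and locally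
    bounded.

    Near a boundary end the pull-backs of omega and of (nabla + dbar) s may both be unbounded; only
    their difference is controlled. This is why the fundamental theorem is applied on [e, 1 - e] and
    the limit taken afterwards.

    The expansion of s at D is prescribed by iterated Wirtinger derivatives, that of the germs by
    asymptotic estimates. A Taylor formula in the Wirtinger operators, which rests on the symmetry
    of second derivatives, makes the two comparable. *)

Section FundamentalTheorem.
Variable R : realType.
Implicit Types (f K : R -> R) (B : seq R) (a b : R).
Local Notation mu := (@lebesgue_measure R).

(** Cutting at an exceptional point t inside the interval leaves fewer exceptional points on each
    side, and the two halves share the value K t. Once no such point is left, the mean value theorem
    applies with derivative 0. *)
Lemma constant_off_finite B K a b : a <= b ->
  {within `[a, b], continuous K} ->
  (forall t, a < t < b -> t \notin B -> is_derive t 1 K 0) -> K b = K a.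
Proof.
have [n] := ubnP (size B); elim: n B a b => // n IH B a b ltn ab cK dK.
have [/hasP[t tB tab]|/hasPn noB] := boolP (has (fun t => a < t < b) B).
  have /andP[at_ tb] := tab.
  have szB : (size [seq u <- B | u != t] < n)%N.
    rewrite size_filter -ltnS (leq_trans _ ltn)// ltnS -(count_predC (predC1 t) B).
    rewrite -[X in (X < _)%N]addn0 ltn_add2l -has_count; apply/hasP.
    by exists t => //=; rewrite eqxx.
  rewrite -[RHS](IH [seq u <- B | u != t] a t)//; first last.
  - move=> u /andP[au ut] uB; apply: dK; first by rewrite au (lt_trans ut).
    by apply: contra uB; rewrite mem_filter (lt_eqF ut) => ->.
  - by apply: continuous_subspaceW cK; apply: subset_itvl; rewrite bnd_simp ltW.
  - exact: ltW.
  apply: (IH [seq u <- B | u != t] t b) => //; first exact: ltW.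
  - by apply: continuous_subspaceW cK; apply: subset_itvr; rewrite bnd_simp ltW.
  - move=> u /andP[tu ub] uB; apply: dK; first by rewrite ub (lt_trans at_).
    by apply: contra uB; rewrite mem_filter (gt_eqF tu) => ->.
have [|c _] := @MVT_segment _ K (cst 0) a b ab _ cK.
  move=> t; rewrite in_itv/= => tab; apply: dK => //.
  by apply/negP => /noB; rewrite tab.
by rewrite mul0r => /eqP; rewrite subr_eq0 => /eqP.
Qed.

(** Stated locally, around the ends and the points of [B] as well, because bounds come from charts,
    one parameter at a time. *)
Definition bounded_off B f a b : Prop :=
  forall x, a <= x <= b -> exists M,
    \forall y \near x, a <= y <= b -> y \notin B -> `|f y| <= M.

Definition continuous_off B f a b : Prop :=
  forall x, a < x < b -> x \notin B -> {for x, continuous f}.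

Lemma bounded_off_bounded B f a b : bounded_off B f a b ->
  exists M, forall x, a <= x <= b -> `|f x| <= M.
Proof.
move=> bf.
have /near_covering_withinP/(_ R +oo
    (fun M x => x \notin B -> `|f x| <= M)) : near_covering `[a, b].
  by apply/compact_near_coveringP; exact: segment_compact.
case=> [x|M0 [_ M0P]].
  rewrite /= in_itv/= => /bf[M Mf].
  exists ([set y | a <= y <= b -> y \notin B -> `|f y| <= M], [set N | M <= N]).
    by split => //=; apply: nbhs_pinfty_ge; exact: num_real.
  by move=> [y N] [/= yM MN]; rewrite /= in_itv/= => /yM /[apply] /le_trans; exact.
(* The compactness argument says nothing about the values on [B], so they enter the constant;
   [|M0| + 1] lies beyond the threshold [M0]. *)
exists (`|M0| + 1 + \sum_(y <- B) `|f y|) => x xab.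
have [xB|xB] := boolP (x \in B).
  by rewrite (big_rem x)//= addrCA lerDl !addr_ge0// sumr_ge0.
rewrite -[leLHS]addr0 lerD ?sumr_ge0//.
by apply: (M0P (`|M0| + 1)) => //; rewrite ?in_itv//= (le_lt_trans (ler_norm _))// ltrDl.
Qed.

Lemma measurable_fun_seq f B : measurable [set` B] /\ measurable_fun [set` B] f.
Proof.
elim: B => [|x B [mB mf]].
  have -> : [set` [::]] = set0 :> set R by apply/seteqP; split.
  by split => //; exact: measurable_fun_set0.
have -> : [set` x :: B] = [set x] `|` [set` B].
  apply/seteqP; split=> y /=; rewrite inE; first by case/orP => [/eqP|]; [left|right].
  by case=> [->|->]; rewrite ?eqxx ?orbT.
split; first exact: measurableU.
by apply/measurable_funU => //; split => //; exact: measurable_fun_set1.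
Qed.

(** The interval is covered by an open set on which f is continuous and by a finite set, on which
    every function is measurable. The ends join [B] because continuity is known only inside. *)
Lemma continuous_off_measurable B f a b : continuous_off B f a b ->
  measurable_fun `[a, b] f.
Proof.
move=> cf; pose B' := [:: a, b & B].
have clB : closed [set` B'].
  apply: (accessible_finite_set_closed.1 (hausdorff_accessible (@Rhausdorff R))).
  exact: finite_seq.
have oD : open (`]a, b[ `\` [set` B']).
  by rewrite setDE; apply: openI; [exact: itv_open|exact: closed_openC].
have subD : `[a, b] `<=` (`]a, b[ `\` [set` B']) `|` [set` B'].
  move=> x; rewrite /= !in_itv/= => /andP[ax xb].
  have [xB|/negP xB] := boolP (x \in B'); [by right|left; split => //].
  move: xB => /=; rewrite !inE !lt_neqAle ax xb !andbT => /negP.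
  by rewrite !negb_or eq_sym => /and3P[-> -> _].
have [mB mfB] := measurable_fun_seq f B'.
apply: measurable_funS subD _.
  by apply: measurableU => //; exact: open_measurable.
apply/measurable_funU => //; first exact: open_measurable.
split => //; apply: open_continuous_measurable_fun => // x.
rewrite inE => -[/= xab /negP xB]; apply: cf; first by move: xab; rewrite in_itv.
by apply: contra xB; rewrite !inE => ->; rewrite !orbT.
Qed.

Lemma integrable_off B f a b : bounded_off B f a b -> continuous_off B f a b ->
  mu.-integrable `[a, b] (EFin \o f).
Proof.
move=> /bounded_off_bounded[M Mf] /continuous_off_measurable mf.
apply: measurable_bounded_integrable => //.
  by rewrite /= lebesgue_measure_itv/=; case: ifP => // _; rewrite -EFinB ltry.
exists `|M|; split; first exact: num_real.
move=> N MN x /=; rewrite in_itv/= => /Mf /le_trans; apply.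
by rewrite (le_trans (ler_norm _))// ltW.
Qed.

(** Since f may jump on [B], H is compared with the indefinite integral F of f: H - F is continuous
    and has derivative zero off [B], hence is constant. *)
Lemma integral_derivative_off B f H a b : a < b ->
  bounded_off B f a b -> continuous_off B f a b ->
  {within `[a, b], continuous H} ->
  (forall t, a < t < b -> t \notin B -> is_derive t 1 H (f t)) ->
  Rintegral mu `[a, b] f = H b - H a.
Proof.
move=> ab bf cf cH dH; have intf := integrable_off bf cf.
pose F t := parameterized_integral mu a t f.
have cF := parameterized_integral_continuous (ltW ab) intf.
have Fa : F a = 0 by rewrite /F /parameterized_integral set_itv1 Rintegral_set1.
suff : H b - F b = H a - F a by rewrite Fa subr0 => <-; rewrite opprB addrC subrK.
apply: (@constant_off_finite B (H \- F)) (ltW ab) _ _.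
  by move=> x; apply: cvgB; [exact: cH|exact: cF].
move=> t tab tB; have /andP[at_ tb] := tab.
have [dF F'] := continuous_FTC1_closed tb intf at_ (cf _ tab tB).
have HF : is_derive t 1 F (f t) by split; [exact: dF|rewrite -derive1E; exact: F'].
have := is_deriveB (dH _ tab tB) HF; by rewrite subrr.
Qed.

(** The integral over [e, 1 - e] is F(1 - e) - F(e) for the indefinite integral F, which is
    continuous up to 0 and 1. *)
Lemma integral_exhaustion B f :
  bounded_off B f 0 1 -> continuous_off B f 0 1 ->
  Rintegral mu `[e, 1 - e] f @[e --> 0^'+] --> Rintegral mu `[0, 1] f.
Proof.
move=> bf cf; have intf := integrable_off bf cf.
pose F t := parameterized_integral mu 0 t f.
have /(continuous_within_itvP F ltr01)[_ F0 F1] :=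
  parameterized_integral_continuous ler01 intf.
have -> : Rintegral mu `[0, 1] f = F 1 - F 0.
  by rewrite /F /parameterized_integral set_itv1 Rintegral_set1 subr0.
have lim1 : F (1 - e) @[e --> 0^'+] --> F 1.
  apply: (cvg_comp (fun e : R => 1 - e) F _ F1).
  move=> A [e /= e0 eA]; exists e => // x /=; rewrite sub0r normrN => xe x0.
  by apply: eA => /=; [rewrite opprB addrC subrK|rewrite ltrBlDr ltrDl].
apply: cvg_trans (cvgB lim1 F0); apply: near_eq_cvg; near=> e.
have [e0 e1] : 0 < e /\ e < 2^-1.
  by split; near: e; [exact: nbhs_right_gt|apply: nbhs_right_lt; rewrite invr_gt0].
have intf' : mu.-integrable `[0, 1 - e] (EFin \o f).
  by apply: integrableS intf => //; apply: subset_itvl; rewrite bnd_simp; lra.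
rewrite /F /parameterized_integral /= fctE Rintegral_itvB// ?bnd_simp; [|lra..].
rewrite Rintegral_itv_obnd_cbnd//.
by apply: integrableS intf' => //; apply: subset_itvr; rewrite bnd_simp; lra.
Unshelve. all: by end_near. Qed.

End FundamentalTheorem.

(** * Real differentials of complex-valued functions *)

Section ComplexDifferential.
Variable R : realType.
Local Notation C := R[i].
Implicit Types (x y w : C).

Lemma ReM x y :
  complex.Re (x * y) = complex.Re x * complex.Re y - complex.Im x * complex.Im y.
Proof. by case: x; case: y. Qed.

Lemma ImM x y :
  complex.Im (x * y) = complex.Re x * complex.Im y + complex.Im x * complex.Re y.
Proof. by case: x => a b; case: y => c d /=; rewrite addrC. Qed.

Lemma ReD x y : complex.Re (x + y) = complex.Re x + complex.Re y.
Proof. by case: x; case: y. Qed.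

Lemma ImD x y : complex.Im (x + y) = complex.Im x + complex.Im y.
Proof. by case: x; case: y. Qed.

Lemma ReN x : complex.Re (- x) = - complex.Re x. Proof. by case: x. Qed.

Lemma ImN x : complex.Im (- x) = - complex.Im x. Proof. by case: x. Qed.

Lemma ReV x : complex.Re x^-1 =
  complex.Re x * (complex.Re x * complex.Re x + complex.Im x * complex.Im x)^-1.
Proof. by case: x => a b /=; rewrite !expr2. Qed.

Lemma ImV x : complex.Im x^-1 =
  - complex.Im x * (complex.Re x * complex.Re x + complex.Im x * complex.Im x)^-1.
Proof. by case: x => a b /=; rewrite !expr2 mulNr. Qed.

Lemma Re_conj x : complex.Re x^*%C = complex.Re x. Proof. by case: x. Qed.

Lemma Im_conj x : complex.Im x^*%C = - complex.Im x. Proof. by case: x. Qed.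

Lemma complexP x y : complex.Re x = complex.Re y -> complex.Im x = complex.Im y ->
  x = y.
Proof. by case: x => a b; case: y => c d /= -> ->. Qed.

Definition toC (a : R * R) : C := a.1 +i* a.2.
Definition ofC w : R * R := (complex.Re w, complex.Im w).

Lemma toCK : cancel toC ofC. Proof. by case. Qed.
Lemma ofCK : cancel ofC toC. Proof. by case. Qed.

Definition ReImE := (ReM, ImM, ReD, ImD, ReN, ImN, Re_conj, Im_conj).

Section Space.
Variable V : normedModType R.
Implicit Types (F G dF dG : V -> C) (a : V).

(* F has real differential dF at a; dF is only R-linear, so that Wirtinger
   derivatives and derivatives along curves are instances. *)
Definition cdiff F a dF : Prop :=
  is_diff a (fun b => complex.Re (F b)) (fun h => complex.Re (dF h)) /\
  is_diff a (fun b => complex.Im (F b)) (fun h => complex.Im (dF h)).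

Lemma cdiff_eq F a dF dG : cdiff F a dF -> dF =1 dG -> cdiff F a dG.
Proof. by move=> dFa /funext <-. Qed.

Lemma cdiff_cst x a : cdiff (fun=> x) a (fun=> 0).
Proof. by split; [exact: (is_diff_cst (complex.Re x))|exact: (is_diff_cst (complex.Im x))]. Qed.

Lemma cdiffD F G a dF dG : cdiff F a dF -> cdiff G a dG ->
  cdiff (fun b => F b + G b) a (fun h => dF h + dG h).
Proof.
move=> [F1 F2] [G1 G2]; split.
  rewrite (_ : (fun b => _) = (fun b => complex.Re (F b)) + (fun b => complex.Re (G b))).
    apply: is_diff_eq. by apply/funext => h; rewrite !fctE ReImE.
  by apply/funext => h; rewrite !fctE ReImE.
rewrite (_ : (fun b => _) = (fun b => complex.Im (F b)) + (fun b => complex.Im (G b))).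
  apply: is_diff_eq. by apply/funext => h; rewrite !fctE ReImE.
by apply/funext => h; rewrite !fctE ReImE.
Qed.

Lemma cdiffM F G a dF dG : cdiff F a dF -> cdiff G a dG ->
  cdiff (fun b => F b * G b) a (fun h => dF h * G a + F a * dG h).
Proof.
move=> [F1 F2] [G1 G2]; split.
  rewrite (_ : (fun b => _) = (fun b => complex.Re (F b)) * (fun b => complex.Re (G b))
      - (fun b => complex.Im (F b)) * (fun b => complex.Im (G b))).
    apply: is_diff_eq; apply/funext => h; rewrite !fctE !ReImE /GRing.scale/=; ring.
  by apply/funext => h; rewrite !fctE ReImE.
rewrite (_ : (fun b => _) = (fun b => complex.Re (F b)) * (fun b => complex.Im (G b))
      + (fun b => complex.Im (F b)) * (fun b => complex.Re (G b))).
  apply: is_diff_eq; apply/funext => h; rewrite !fctE !ReImE /GRing.scale/=; ring.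
by apply/funext => h; rewrite !fctE ReImE.
Qed.

Lemma cdiff_sum (I : Type) (r : seq I) (F dF : I -> V -> C) a :
  (forall i, cdiff (F i) a (dF i)) ->
  cdiff (fun b => \sum_(i <- r) F i b) a (fun h => \sum_(i <- r) dF i h).
Proof.
move=> FP; elim: r => [|i r IH].
  have := cdiff_cst 0 a; congr cdiff; apply/funext => b; by rewrite big_nil.
have := cdiffD (FP i) IH; congr cdiff; apply/funext => b; by rewrite big_cons.
Qed.

Lemma cdiff_continuous F a dF : cdiff F a dF ->
  {for a, continuous (fun b => complex.Re (F b))} /\
  {for a, continuous (fun b => complex.Im (F b))}.
Proof.
by move=> [[F1 _] [F2 _]]; split; apply: differentiable_continuous.
Qed.

Lemma is_diff_near_eq (f g df : V -> R) a : (\near a, f a = g a) ->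
  is_diff a f df -> is_diff a g df.
Proof.
move=> fg [Df df_].
have dgo : g \o shift a = cst (g a) + 'd f a +o_ 0 id.
  apply/eqaddoP => e e0.
  have /eqaddoP/(_ e e0) := diff_locally Df.
  apply: filterS2; last first.
    by move: fg; rewrite (near_shift 0 a) subr0; exact.
  by move=> h /=; rewrite !fctE /= (nbhs_singleton fg) => ->.
have dgE : 'd g a = 'd f a :> (V -> R) 
  by apply: diff_unique => //; exact: diff_continuous.
split; last by rewrite dgE.
by apply/diff_locallyP; rewrite dgE; split => //; exact: diff_continuous.
Qed.

Lemma cdiff_near_eq F G a dF : (\near a, F a = G a) ->
  cdiff F a dF -> cdiff G a dF.
Proof.
by move=> FG [F1 F2]; split; [apply: is_diff_near_eq F1|apply: is_diff_near_eq F2];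
  apply: filterS FG => b ->.
Qed.

Lemma cdiff_unique F a dF dG : cdiff F a dF -> cdiff F a dG -> dF =1 dG.
Proof.
move=> [[_ F1] [_ F2]] [[_ G1] [_ G2]] h; apply: complexP.
  by rewrite F1 in G1; exact: (congr1 (@^~ h) G1).
by rewrite F2 in G2; exact: (congr1 (@^~ h) G2).
Qed.

Lemma normC2_neq0 x : x != 0 ->
  complex.Re x * complex.Re x + complex.Im x * complex.Im x != 0.
Proof.
apply: contra; rewrite paddr_eq0 -?expr2 ?sqr_ge0// !sqrf_eq0.
by move=> /andP[/eqP F10 /eqP F20]; apply/eqP/complexP.
Qed.

Lemma cdiff_near_neq0 F a dF : F a != 0 -> cdiff F a dF -> \near a, F a != 0.
Proof.
move=> /normC2_neq0 Fa /cdiff_continuous[F1 F2].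
have : {for a, continuous (fun b => complex.Re (F b) * complex.Re (F b) +
    complex.Im (F b) * complex.Im (F b))}.
  by apply: cvgD; apply: cvgM.
move=> /cvgr_neq0 -/(_ Fa); apply: filterS => b; apply: contra => /eqP ->.
by rewrite /= !mulr0 addr0.
Qed.

(* Differentiability of the real components of F^-1 suffices: the formula then
   follows from the product rule applied to F * F^-1 = 1. *)
Lemma cdiffV F a dF : F a != 0 -> cdiff F a dF ->
  cdiff (fun b => (F b)^-1) a (fun h => - (F a)^-2 * dF h).
Proof.
move=> Fa dFa; have [F1 F2] := dFa.
pose n b := complex.Re (F b) * complex.Re (F b) + complex.Im (F b) * complex.Im (F b).
have dn : differentiable (fun b => (n b)^-1) a.
  apply: differentiableV; last exact: normC2_neq0.
  by apply: differentiableD; apply: differentiableM; exact: ex_diff.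
have [dG dGa] : exists dG, cdiff (fun b => (F b)^-1) a dG.
  have D1 : differentiable (fun b => complex.Re (F b)^-1) a.
    under eq_fun do rewrite ReV.
    by apply: differentiableM => //; exact: ex_diff.
  have D2 : differentiable (fun b => complex.Im (F b)^-1) a.
    under eq_fun do rewrite ImV.
    by apply: differentiableM => //; apply: differentiableN; exact: ex_diff.
  exists (fun h => 'd (fun b => complex.Re (F b)^-1) a h +i*
                   'd (fun b => complex.Im (F b)^-1) a h).
  by split; apply: differentiableP.
apply: cdiff_eq (dGa) _ => h.
have F1V : \near a, F a / F a = 1.
  have := cdiff_near_neq0 Fa dFa; apply: filterS => b; exact: divff.
have e := cdiff_unique (cdiff_near_eq F1V (cdiffM dFa dGa)) (cdiff_cst 1 a) h.
have {}e : F a * dG h = - (dF h / F a).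
  by apply/eqP; rewrite -addr_eq0 addrC e.
by rewrite -[LHS](mulKf Fa) e; field.
Qed.

End Space.

Lemma cdiff_comp (V : normedModType R) (g : V -> C) (F : C -> C) a dg dF :
  cdiff g a dg -> cdiff (plane F) (ofC (g a)) dF ->
  cdiff (F \o g) a (fun h => dF (ofC (dg h))).
Proof.
move=> [g1 g2] [F1 F2].
have gp := is_diff_pair g1 g2.
split.
  have := @is_diff_comp _ _ _ _ _ _ _ _ _ gp F1.
  by congr is_diff_def; apply/funext => b; rewrite /= /plane /=; case: (g b).
have := @is_diff_comp _ _ _ _ _ _ _ _ _ gp F2.
by congr is_diff_def; apply/funext => b; rewrite /= /plane /=; case: (g b).
Qed.

(** [al] and [be] are the two Wirtinger derivatives of F at w; [be = 0] is the Cauchy-Riemann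
    equation. *)
Definition wdiff (F : C -> C) w (al be : C) : Prop :=
  cdiff (plane F) (ofC w) (fun h => al * toC h + be * (toC h)^*%C).

Definition tdiff (g : R -> C) (t : R) (d : C) : Prop :=
  cdiff g t (fun h => h%:C * d).

Lemma wdiff_eq F w al be al' be' : wdiff F w al be -> al = al' -> be = be' ->
  wdiff F w al' be'.
Proof. by move=> + <- <-. Qed.

Lemma tdiff_eq g t d d' : tdiff g t d -> d = d' -> tdiff g t d'.
Proof. by move=> + <-. Qed.

Lemma wdiff_unique F w al be al' be' : wdiff F w al be -> wdiff F w al' be' ->
  al = al' /\ be = be'.
Proof.
move=> /cdiff_unique + F'; move=> /(_ _ F') e.
have e1 := e (1, 0); have e2 := e (0, 1).
move: e1 e2; rewrite /toC /= => e1 e2.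
case: al be al' be' e1 e2 {e F'} => [a1 a2] [b1 b2] [c1 c2] [d1 d2] /=.
move=> [e1 e2] [e3 e4]; split; apply: complexP => /=; lra.
Qed.

Lemma tdiff_unique g t d d' : tdiff g t d -> tdiff g t d' -> d = d'.
Proof.
move=> /cdiff_unique + F'; move=> /(_ _ F' 1).
by rewrite !mul1r.
Qed.

Lemma tdiff_derive g t d : tdiff g t d <->
  is_derive t 1 (fun s => complex.Re (g s)) (complex.Re d) /\
  is_derive t 1 (fun s => complex.Im (g s)) (complex.Im d).
Proof.
have H (f : R -> R) e : is_diff t f (fun h => h * e) <-> is_derive t 1 f e.
  split=> [[Df df]|[Df df]].
    split; first exact/derivable1_diffP.
    by rewrite deriveE// df mul1r.
  have /derivable1_diffP Df' := Df.
  by split => //; rewrite diff1E// derive1E df.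
rewrite /tdiff /cdiff -!H.
by split=> -[h1 h2]; split; [move: h1|move: h2|move: h1|move: h2];
  congr is_diff_def; apply/funext => h; rewrite !ReImE /= !(mul0r, subr0, addr0).
Qed.

Lemma cderiveE g t d : tdiff g t d -> @cderive R R 1 g t = d.
Proof.
by move=> /tdiff_derive[h1 h2]; rewrite /cderive !derive_val; case: d {h1 h2}.
Qed.

Lemma wdiff_comp_tdiff F g t al be d :
  wdiff F (g t) al be -> tdiff g t d -> tdiff (F \o g) t (al * d + be * d^*%C).
Proof.
move=> FP gP; apply: (cdiff_eq (cdiff_comp gP FP)) => h.
by rewrite ofCK rmorphM /= /toC; apply: complexP; rewrite !ReImE /=; ring.
Qed.

Lemma wdiff_comp F G w al be ga de :
  wdiff F (G w) al be -> wdiff G w ga de ->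
  wdiff (F \o G) w (al * ga + be * de^*%C) (al * de + be * ga^*%C).
Proof.
move=> FP GP.
case: w FP GP => a b FP GP; apply: (cdiff_eq (cdiff_comp GP FP)) => h.
by rewrite ofCK /toC; apply: complexP; rewrite !ReImE /=; ring.
Qed.

(** [dw] and [dwbar] only record two directional derivatives; under differentiability these
    determine the whole real differential. *)
Lemma wdiff_dw F w :
  differentiable (fun a => complex.Re (plane F a)) (ofC w) ->
  differentiable (fun a => complex.Im (plane F a)) (ofC w) ->
  wdiff F w (dw F w) (dwbar F w).
Proof.
move=> F1 F2.
have lin (f : R * R -> R) : differentiable f (ofC w) -> is_diff (ofC w) f
    (fun h => h.1 * 'D_(1, 0) f (ofC w) + h.2 * 'D_(0, 1) f (ofC w)).
  move=> Df; split => //; apply/funext => -[h1 h2] /=.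
  rewrite !deriveE//.
  have -> : (h1, h2) = h1 *: (1, 0) + h2 *: (0, 1) :> R * R.
    by apply/pair_eqP; rewrite /pair_eq /= /GRing.scale /= !(mulr1, mulr0, addr0, add0r) !eqxx.
  by rewrite linearD !linearZ.
have := conj (lin _ F1) (lin _ F2); rewrite /wdiff /cdiff => -[h1 h2].
have half : (2%:R : C)^-1 = (2^-1)%:C by rewrite fmorphV /= rmorph_nat.
split; [move: h1|move: h2]; congr is_diff_def; apply/funext => h;
  rewrite /dw /dwbar /cderive -/(ofC w) /toC half !ReImE /=; by field.
Qed.

Section Algebra.
Variables (F G : C -> C) (w al be ga de : C).
Hypotheses (dF : wdiff F w al be) (dG : wdiff G w ga de).

Lemma wdiffD : wdiff (fun w => F w + G w) w (al + ga) (be + de).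
Proof. by apply: (cdiff_eq (cdiffD dF dG)) => h; ring. Qed.

Lemma wdiffM : wdiff (fun w => F w * G w) w (al * G w + F w * ga) (be * G w + F w * de).
Proof.
case: w dF dG => a b HF HG.
by apply: (cdiff_eq (cdiffM HF HG)) => h; rewrite /plane /ofC/=; ring.
Qed.

End Algebra.

Lemma wdiff_cst x w : wdiff (fun=> x) w 0 0.
Proof. by apply: (cdiff_eq (cdiff_cst x _)) => h; rewrite !mul0r addr0. Qed.

Lemma wdiff_id w : wdiff id w 1 0.
Proof.
have proj (f : {linear (R * R)%type -> R}) : continuous f -> is_diff (ofC w) f f.
  by move=> cf; split; [exact: linear_differentiable|exact: diff_lin].
split.
  apply: (@is_diff_eq _ _ _ _ _ _ _ (proj fst (fun p => cvg_fst))).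
  by apply/funext => h; rewrite mul1r mul0r addr0.
apply: (@is_diff_eq _ _ _ _ _ _ _ (proj snd (fun p => cvg_snd))).
by apply/funext => h; rewrite mul1r mul0r addr0.
Qed.

Lemma wdiffX F w al n : wdiff F w al 0 -> exists d, wdiff (fun w => F w ^+ n) w d 0.
Proof.
move=> dF; elim: n => [|n [d dn]]; first by exists 0; exact: wdiff_cst.
eexists; under eq_fun do rewrite exprS.
by apply: wdiff_eq (wdiffM dF dn) erefl _; rewrite mul0r mulr0 addr0.
Qed.

Lemma wdiffV (F : C -> C) w al : F w != 0 -> wdiff F w al 0 ->
  wdiff (fun w => (F w)^-1) w (- (F w)^-2 * al) 0.
Proof.
case: w => a b Fw HF; have HV := @cdiffV _ (plane F) (a, b) _ Fw HF.
by apply: (cdiff_eq HV) => h; rewrite !mul0r !addr0 mulrA.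
Qed.

End ComplexDifferential.

(** * Modulus and pointwise holomorphy *)

Section Modulus.
Variable R : realType.
Local Notation C := R[i].
Implicit Types (x y w : C).

Lemma cmod0 : cmod (0 : C) = 0. Proof. exact: Normc.normc0. Qed.
Lemma cmod_ge0 x : 0 <= cmod x. Proof. by case: x => a b; exact: sqrtr_ge0. Qed.
Lemma cmod_eq0 x : (cmod x == 0) = (x == 0).
Proof. by apply/eqP/eqP => [/Normc.eq0_normc//|->]; exact: cmod0. Qed.
Lemma cmod_gt0 x : (0 < cmod x) = (x != 0).
Proof. by rewrite lt_def cmod_ge0 cmod_eq0 andbT. Qed.
Lemma cmodM x y : cmod (x * y) = cmod x * cmod y. Proof. exact: Normc.normcM. Qed.
Lemma cmodD x y : cmod (x + y) <= cmod x + cmod y. Proof. exact: le_normcD. Qed.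
Lemma cmodN x : cmod (- x) = cmod x. Proof. exact: normcN. Qed.
Lemma cmodX x n : cmod (x ^+ n) = cmod x ^+ n.
Proof. by elim: n => [|n IH]; rewrite ?expr0 ?exprS ?cmodM ?IH//; exact: Normc.normc1. Qed.
Lemma cmod_conj x : cmod x^*%C = cmod x.
Proof. by case: x => a b; rewrite /cmod /= sqrrN. Qed.
Lemma cmod_real (r : R) : cmod r%:C = `|r|.
Proof. by rewrite /cmod /= expr0n addr0 sqrtr_sqr. Qed.
Lemma cmod_sum (I : Type) (r : seq I) (F : I -> C) :
  cmod (\sum_(i <- r) F i) <= \sum_(i <- r) cmod (F i).
Proof.
elim: r => [|i r IH]; first by rewrite !big_nil cmod0.
by rewrite !big_cons (le_trans (cmodD _ _))// lerD2l.
Qed.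

Lemma cmod_ge_Re x : `|complex.Re x| <= cmod x.
Proof. by case: x => a b; rewrite -sqrtr_sqr ler_wsqrtr//= lerDl sqr_ge0. Qed.
Lemma cmod_ge_Im x : `|complex.Im x| <= cmod x.
Proof. by case: x => a b; rewrite -sqrtr_sqr ler_wsqrtr//= lerDr sqr_ge0. Qed.
Lemma cmod_le_ReIm x : cmod x <= `|complex.Re x| + `|complex.Im x|.
Proof.
rewrite -[X in _ <= X]ger0_norm ?addr_ge0// -sqrtr_sqr; case: x => a b /=.
rewrite ler_wsqrtr// sqrrD !real_normK ?num_real//.
have := mulr_ge0 (normr_ge0 a) (normr_ge0 b); lra.
Qed.
Lemma cmod_cis (t : R) : cmod (cis t) = 1.
Proof. by rewrite /cmod /= cos2Dsin2 sqrtr1. Qed.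

(** Discs for the modulus are compared with the balls of R * R, which are squares; hence the radius
    d / 2 in one direction. *)
Lemma wnearP w (P : C -> Prop) :
  (exists2 d : R, 0 < d & forall w', cmod (w' - w) < d -> P w') <->
  \forall b \near ofC w, P (toC b).
Proof.
split=> [[d d0 dP]|/nbhs_ballP[d /= d0 dP]].
  apply/nbhs_ballP; exists (d / 2) => /=; first by rewrite divr_gt0.
  move=> [b1 b2] [/=]; rewrite /ball/= => h1 h2; apply: dP.
  rewrite (le_lt_trans (cmod_le_ReIm _))// !ReImE /= [ltRHS]splitr.
  by rewrite ltrD// distrC.
exists d => // w' w'd; rewrite -(ofCK w'); apply: dP.
by split=> /=; rewrite /ball/= distrC; apply: le_lt_trans w'd;
  [have := cmod_ge_Re (w' - w)|have := cmod_ge_Im (w' - w)]; rewrite !ReImE.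
Qed.

Lemma near_cmod (T : topologicalType) (F : T -> C) (a : T) (e : R) :
  {for a, continuous (fun b => complex.Re (F b))} ->
  {for a, continuous (fun b => complex.Im (F b))} ->
  0 < e -> \forall b \near a, cmod (F b - F a) < e.
Proof.
move=> /cvgrPdist_lt F1 /cvgrPdist_lt F2 e0.
have e2 : 0 < e / 2 by rewrite divr_gt0.
apply: filterS2 (F1 _ e2) (F2 _ e2) => b h1 h2.
rewrite (le_lt_trans (cmod_le_ReIm _))// !ReImE [ltRHS]splitr.
by rewrite ltrD// distrC.
Qed.

Lemma wdiff_near_eq (F G : C -> C) w al be :
  (exists2 d : R, 0 < d & forall w', cmod (w' - w) < d -> F w' = G w') ->
  wdiff F w al be -> wdiff G w al be.
Proof. by move=> /wnearP FG; exact: cdiff_near_eq. Qed.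

Lemma wdiff_near_cmod (F : C -> C) w al be (e : R) : wdiff F w al be -> 0 < e ->
  exists2 d : R, 0 < d & forall w', cmod (w' - w) < d -> cmod (F w' - F w) < e.
Proof.
case: w => a b /cdiff_continuous[F1 F2] e0; apply/wnearP; exact: near_cmod F1 F2 e0.
Qed.

Definition hol (F : C -> C) w := exists d, wdiff F w d 0.

Lemma hol_cst x w : hol (fun=> x) w. Proof. by exists 0; exact: wdiff_cst. Qed.
Lemma holD F G w : hol F w -> hol G w -> hol (fun w => F w + G w) w.
Proof. by move=> [d dF] [d' dG]; eexists; apply: wdiff_eq (wdiffD dF dG) erefl _; rewrite addr0. Qed.
Lemma holM F G w : hol F w -> hol G w -> hol (fun w => F w * G w) w.
Proof. by move=> [d dF] [d' dG]; eexists; apply: wdiff_eq (wdiffM dF dG) erefl _; rewrite mul0r mulr0 addr0. Qed.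
Lemma holX F w n : hol F w -> hol (fun w => F w ^+ n) w.
Proof. by move=> [d dF]; exact: wdiffX dF. Qed.
Lemma holV (F : C -> C) w : F w != 0 -> hol F w -> hol (fun w => (F w)^-1) w.
Proof. by move=> Fw [d dF]; eexists; exact: wdiffV dF. Qed.
Lemma hol_sum (I : Type) (r : seq I) (F : I -> C -> C) w :
  (forall i, hol (F i) w) -> hol (fun w => \sum_(i <- r) F i w) w.
Proof.
move=> FP; elim: r => [|i r IH].
  by under eq_fun do rewrite big_nil; exact: hol_cst.
by under eq_fun do rewrite big_cons; exact: holD.
Qed.
Lemma hol_prod (I : Type) (r : seq I) (F : I -> C -> C) w :
  (forall i, hol (F i) w) -> hol (fun w => \prod_(i <- r) F i w) w.
Proof.
move=> FP; elim: r => [|i r IH].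
  by under eq_fun do rewrite big_nil; exact: hol_cst.
by under eq_fun do rewrite big_cons; exact: holM.
Qed.
Lemma hol_near_eq (F G : C -> C) w :
  (exists2 d : R, 0 < d & forall w', cmod (w' - w) < d -> F w' = G w') ->
  hol F w -> hol G w.
Proof. by move=> FG [d dF]; exists d; exact: wdiff_near_eq dF. Qed.
Lemma hol_near_neq0 (F : C -> C) w : F w != 0 -> hol F w ->
  exists2 d : R, 0 < d & forall w', cmod (w' - w) < d -> F w' != 0.
Proof.
by case: w => a b Fw [d dF]; apply/wnearP; exact: (@cdiff_near_neq0 _ _ (plane F) (a, b) _ Fw dF).
Qed.

Lemma csmooth_wdiff (F : C -> C) (e : R) w : csmooth_on (disc e) (plane F) ->
  cmod w < e -> wdiff F w (dw F w) (dwbar F w).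
Proof.
move=> [F1 F2] we; have we' : disc e (ofC w) by case: w we.
by apply: wdiff_dw; [exact: (F1 [::])|exact: (F2 [::])].
Qed.

Lemma holo_disc_wdiff (F : C -> C) (e : R) w : holo_disc e F -> cmod w < e ->
  wdiff F w (dw F w) 0.
Proof. by move=> [F1 F2] we; rewrite -(F2 _ we); exact: csmooth_wdiff we. Qed.

End Modulus.

(** * Regular functions in the charts of the curve *)

Section HomogeneousEvaluation.
Variables (R : realType) (n : nat).
Local Notation C := R[i].
Local Notation poly := (mpoly.mpoly n.+1 C).

Lemma meval_homog d (P : poly) (c : C) (h : 'I_n.+1 -> C) : homog d P ->
  mpoly.meval (fun k => c * h k) P = c ^+ d * mpoly.meval h P.
Proof.
move=> hP; rewrite !mpoly.mevalE big_distrr /= !big_seq; apply: eq_bigr => m mP.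
have md : mpoly.mdeg m = d.
  by apply: hP; rewrite -mpoly.mcoeff_msupp.
rewrite (eq_bigr (fun i => c ^+ m i * h i ^+ m i)); last by move=> i _; rewrite exprMn.
by rewrite big_split /= prodrXr -mpoly.mdegE md mulrCA.
Qed.

Lemma hol_meval (P : poly) (h : 'I_n.+1 -> C -> C) w : (forall k, hol (h k) w) ->
  hol (fun w => mpoly.meval (h^~ w) P) w.
Proof.
move=> hh; under eq_fun do rewrite mpoly.mevalE.
apply: hol_sum => m; apply: holM; first exact: hol_cst.
by apply: hol_prod => k; exact: holX.
Qed.

Lemma homog_mpolyX (k : 'I_n.+1) : @homog R n 1 (mpoly.mpolyX C (mpoly.mnm1 k)).
Proof.
move=> m; rewrite mpoly.mcoeffX; case: (_ =P m) => [<- _|_]; first exact: mpoly.mdeg1.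
by rewrite eqxx.
Qed.

Lemma peval_mpolyX (k : 'I_n.+1) (x : Pn R n) :
  peval (mpoly.mpolyX C (mpoly.mnm1 k)) x = hcoord x k.
Proof. exact: mpoly.mevalXU. Qed.

End HomogeneousEvaluation.

Section Charts.
Variables (R : realType) (G : marked_curve R).
Hypothesis hz : has_coordinates G.
Local Notation C := R[i].
Local Notation X := (pts G).
Local Notation z := (Defs.coord G).
Local Notation phi := (param G).
Local Notation pt := (Pn R (amb G)).
Local Notation poly := (mpoly.mpoly (amb G).+1 C).

(** A regular function is a quotient of two forms of the same degree. Evaluated on the ratios [h k]
    of homogeneous coordinates, which are holomorphic in the chart, both forms lose the same power
    of the j-th coordinate, so the quotient is unchanged. *)
Lemma chart p : X p -> exists2 e : R, 0 < e & forall w0, cmod w0 < e ->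
  [/\ X (phi p w0), z p (phi p w0) = w0 &
    forall f, regular_at X f (phi p w0) -> hol (fun w => f (phi p w)) w0].
Proof.
move=> /hz[_ [_ [j [e [pj e0 eP eh _]]]]]; exists e => // w0 w0e.
have [Xw0 zw0 w0j] := eP _ w0e; split => // f [d [P [Q [hP hQ Qw0 fE]]]].
pose h k w := hcoord (phi p w) k / hcoord (phi p w) j.
have hh k : hol (h k) w0 by exists (dw (h k) w0); exact: holo_disc_wdiff (eh k) w0e.
have hE (S : poly) w : homog d S -> cmod w < e ->
    peval S (phi p w) = hcoord (phi p w) j ^+ d * mpoly.meval (h^~ w) S.
  move=> hS /eP[_ _ wj]; rewrite -meval_homog// /peval; apply: mpoly.meval_eq => k.
  by rewrite /h mulrCA divff ?mulr1.
have Qw0' : mpoly.meval (h^~ w0) Q != 0.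
  by apply: contra Qw0; rewrite hE// => /eqP ->; rewrite mulr0.
have [d1 d10 Qd1] := hol_near_neq0 Qw0' (hol_meval Q hh).
apply: hol_near_eq (holM (hol_meval P hh) (holV Qw0' (hol_meval Q hh))).
exists (Order.min d1 (e - cmod w0)) => [|w]; first by rewrite lt_min d10 subr_gt0.
rewrite lt_min => /andP[wd1 we].
have {}we : cmod w < e.
  by rewrite -(subrK w0 w) (le_lt_trans (cmodD _ _))// -ltrBrDr.
have [Xw _ wj] := eP _ we; have Qw := Qd1 _ wd1.
rewrite fE// hE// ?hE//; last by rewrite mulf_neq0// expf_neq0.
by rewrite invfM mulrACA divff ?mul1r// expf_neq0.
Qed.

(** Rescaling the homogeneous coordinates does not affect non-vanishing, which is therefore an open
    condition on the holomorphic ratios [h k]. This puts a coordinate disc inside every Zariski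
    neighbourhood. *)
Lemma homog_near p d (Q : poly) : X p -> homog d Q -> peval Q p != 0 ->
  exists2 e : R, 0 < e & forall w, cmod w < e -> peval Q (phi p w) != 0.
Proof.
move=> Xp hQ Qp; have [_ [p0 [j [e [pj e0 eP eh _]]]]] := hz Xp.
pose h k w := hcoord (phi p w) k / hcoord (phi p w) j.
have hE w : cmod w < e ->
    peval Q (phi p w) = hcoord (phi p w) j ^+ d * mpoly.meval (h^~ w) Q.
  move=> /eP[_ _ wj]; rewrite -meval_homog// /peval; apply: mpoly.meval_eq => k.
  by rewrite /h mulrCA divff ?mulr1.
have hh k : hol (h k) 0 by exists (dw (h k) 0); apply: holo_disc_wdiff (eh k) _; rewrite cmod0.
have Q0 : mpoly.meval (h^~ 0) Q != 0.
  by apply: contra Qp; rewrite -p0 hE ?cmod0// => /eqP ->; rewrite mulr0.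
have [d1 d10 Qd1] := hol_near_neq0 Q0 (hol_meval Q hh).
exists (Order.min d1 e) => [|w]; first by rewrite lt_min d10.
rewrite lt_min => /andP[wd1 we]; have [_ _ wj] := eP _ we.
by rewrite hE// mulf_neq0 ?expf_neq0// Qd1// subr0.
Qed.

Lemma regular_near p f : X p -> regular_at X f p ->
  exists2 e : R, 0 < e & forall w, cmod w < e -> regular_at X f (phi p w).
Proof.
move=> Xp [d [P [Q [hP hQ Qp fE]]]]; have [e e0 eQ] := homog_near Xp hQ Qp.
by exists e => // w /eQ Qw; exists d, P, Q.
Qed.

Lemma znear_near p (P : pt -> Prop) : X p -> znear X p P ->
  exists2 e : R, 0 < e & forall w, cmod w < e -> P (phi p w).
Proof.
move=> Xp [d [Q [hQ Qp QP]]]; have [e1 e10 eQ] := homog_near Xp hQ Qp.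
have [e2 e20 eX] := chart Xp; exists (Order.min e1 e2) => [|w]; first by rewrite lt_min e10.
by rewrite lt_min => /andP[we1 we2]; have [Xw _ _] := eX _ we2; exact/QP/eQ.
Qed.

Lemma hcoord_ratio_regular (x : pt) (k j : 'I_(amb G).+1) : hcoord x j != 0 ->
  regular_at X (fun y => hcoord y k / hcoord y j) x.
Proof.
move=> xj; exists 1%N, (mpoly.mpolyX C (mpoly.mnm1 k)), (mpoly.mpolyX C (mpoly.mnm1 j)).
by split; rewrite ?peval_mpolyX//; [exact: homog_mpolyX..|move=> y _ _; rewrite !peval_mpolyX].
Qed.

Lemma min_gt0 (n : nat) (P : 'I_n -> R -> Prop) :
  (forall k d d', d' <= d -> P k d -> P k d') ->
  (forall k, exists2 d : R, 0 < d & P k d) ->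
  exists2 d : R, 0 < d & forall k, P k d.
Proof.
move=> mono /(_ _)/cid2-/all_sig2[d d0 dP].
exists (\big[Order.min/1]_k d k) => [|k].
  by elim/big_ind: _ => // x y x0 y0; rewrite lt_min x0.
by apply: mono (dP k); apply: bigmin_le_cond.
Qed.

Lemma phi0 p : X p -> phi p 0 = p. Proof. by move=> /hz[_ []]. Qed.

(** This gives phi_p(z_p(y)) = y for all y near q = phi_p(w0), seen in the chart at q. The chart at
    p reaches every point whose affine coordinates are within d of those of p; q is strictly within
    d, so the points near q are too. *)
Lemma chart_surjective p : X p -> exists2 e : R, 0 < e & forall w0, cmod w0 < e ->
  exists2 e' : R, 0 < e' & forall w, cmod w < e' ->
    exists2 w1, phi p w1 = phi (phi p w0) w & z p (phi (phi p w0) w) = w1.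
Proof.
move=> Xp; have [_ [p0 [j [e [pj e0 eP eh [d d0 dP]]]]]] := hz Xp.
have hh k : hol (fun w => hcoord (phi p w) k / hcoord (phi p w) j) 0.
  by exists (dw (fun w => hcoord (phi p w) k / hcoord (phi p w) j) 0); apply: holo_disc_wdiff (eh k) _; rewrite cmod0.
have [e1 e10 e1P] : exists2 e1 : R, 0 < e1 & forall k w, cmod w < e1 ->
    cmod (hcoord (phi p w) k / hcoord (phi p w) j - hcoord p k / hcoord p j) < d.
  apply: (min_gt0 (P := fun k e1 => forall w, cmod w < e1 -> _)) => [k x y yx xP w wy|k].
    by apply: xP; exact: lt_le_trans yx.
  have [a dh] := hh k; have [e1 e10 e1P] := wdiff_near_cmod dh d0.
  by exists e1 => // w we1; have := e1P w; rewrite subr0 p0; exact.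
exists (Order.min e1 e) => [|w0]; first by rewrite lt_min e10.
rewrite lt_min => /andP[w01 w0e]; have [Xq _ qj] := eP _ w0e.
set q := phi p w0 in Xq qj *.
have [e2 e20 e2P] : exists2 e2 : R, 0 < e2 & forall k w, cmod w < e2 ->
    cmod (hcoord (phi q w) k / hcoord (phi q w) j - hcoord p k / hcoord p j) < d.
  apply: (min_gt0 (P := fun k e1 => forall w, cmod w < e1 -> _)) => [k x y yx xP w wy|k].
    by apply: xP; exact: lt_le_trans yx.
  have [e3 e30 /(_ 0)] := chart Xq; rewrite cmod0 phi0// => /(_ e30)[_ _].
  move=> /(_ _ (hcoord_ratio_regular k qj))[a dh].
  have slack : 0 < d - cmod (hcoord q k / hcoord q j - hcoord p k / hcoord p j).
    by rewrite subr_gt0; exact: e1P.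
  have [e4 e40 e4P] := wdiff_near_cmod dh slack.
  exists e4 => // w we4; have := e4P w; rewrite subr0 phi0// => /(_ we4).
  rewrite ltrBrDr; apply: le_lt_trans.
  by rewrite (le_trans _ (cmodD _ _))// addrA subrK.
have qX : peval (mpoly.mpolyX C (mpoly.mnm1 j)) q != 0 by rewrite peval_mpolyX.
have [e5 e50 e5P] := homog_near Xq (@homog_mpolyX R _ j) qX.
have [e6 e60 e6P] := chart Xq.
exists (Order.min e2 (Order.min e5 e6)) => [|w]; first by rewrite !lt_min e20 e50.
rewrite !lt_min => /and3P[w2 w5 w6]; have [Xw _ _] := e6P _ w6.
have wj : hcoord (phi q w) j != 0 by rewrite -peval_mpolyX; exact: e5P.
have [w1 w1e w1E] := dP _ Xw wj (fun k => e2P k _ w2).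
by exists w1; rewrite -?w1E//; have [_ ->] := eP _ w1e.
Qed.

(* z_p o phi_q has the local inverse z_q o phi_p, hence a nonzero derivative d. *)
Lemma chart_change p : X p -> exists2 e : R, 0 < e & forall w0, cmod w0 < e ->
  exists2 d : C, d != 0 & wdiff (fun w => z p (phi (phi p w0) w)) 0 d 0.
Proof.
move=> Xp; have [zreg _] := hz Xp.
have [e1 e10 e1P] := chart Xp; have [e2 e20 e2P] := chart_surjective Xp.
have [e3 e30 e3P] := regular_near Xp zreg.
exists (Order.min e1 (Order.min e2 e3)) => [|w0]; first by rewrite !lt_min e10 e20.
rewrite !lt_min => /and3P[w1 w2 w3]; have [Xq zq holp] := e1P _ w1.
have [e4 e40 e4P] := e2P _ w2; have reg := e3P _ w3.
set q := phi p w0 in Xq zq holp e4P reg *.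
have [e5 e50 e5P] := chart Xq.
have := e5P 0; rewrite cmod0 => /(_ e50)[_ _ holq].
have [d dz] : hol (fun w => z p (phi q w)) 0 by apply: holq; rewrite phi0.
exists d => //; have [d' dzq] : hol (fun w => z q (phi p w)) w0.
  by apply: holp; have [] := hz Xq.
have dzq' : wdiff (fun w => z q (phi p w)) (z p (phi q 0)) d' 0 by rewrite phi0// zq.
have dchi := wdiff_comp dzq' dz.
have : wdiff id 0 (d' * d + 0 * 0^*%C) (d' * 0 + 0 * d^*%C).
  apply: wdiff_near_eq dchi.
  exists (Order.min e4 e5) => [|w]; first by rewrite lt_min e40.
  rewrite subr0 lt_min => /andP[w4 w5]; have [w6 w6E w6z] := e4P _ w4.
  by rewrite /= w6z w6E; have [_ ->] := e5P _ w5.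
move=> /wdiff_unique/(_ (wdiff_id _))[]; rewrite mul0r addr0 => dd _.
by apply/eqP => d0; move: dd; rewrite d0 mulr0 => /esym/eqP; rewrite oner_eq0.
Qed.

(** In the chart a point is determined by its coordinate, so it suffices to stay below the moduli of
    the finitely many nonzero coordinates of excluded points; coordinate 0 is p itself, which lies
    in [A]. *)
Lemma cofinite_near p (A : set pt) : X p -> A p -> finite_set (X `\` A) ->
  exists2 e : R, 0 < e & forall w, cmod w < e -> A (phi p w).
Proof.
move=> Xp Ap; have [e e0 eP] := chart Xp.
move=> /(finite_image (z p)) /finite_seqP[s sE].
have [d d0 dP] : exists2 d : R, 0 < d & forall w, w \in s -> w != 0 -> d <= cmod w.
  elim: s {sE} => [|x s [d d0 dP]]; first by exists 1.
  have [->|x0] := eqVneq x 0.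
    by exists d => // w; rewrite inE => /orP[/eqP->|/dP//]; rewrite eqxx.
  exists (Order.min d (cmod x)) => [|w]; first by rewrite lt_min d0 cmod_gt0.
  rewrite inE ge_min => /orP[/eqP -> _|ws w0]; first by rewrite lexx orbT.
  by rewrite dP.
exists (Order.min d e) => [|w]; first by rewrite lt_min d0.
rewrite lt_min => /andP[wd we]; have [Xw zw _] := eP _ we.
have [//|nA] := pselect (A (phi p w)).
have [w0|w0] := eqVneq w 0; first by rewrite w0 phi0.
have : w \in s.
  have : [set` s] w by rewrite -sE; exists (phi p w).
  by [].
by move=> /dP/(_ w0); rewrite leNgt wd.
Qed.

End Charts.

(** * Taylor expansion in the Wirtinger operators *)

Section SmoothFunctions.
Variables (R : realType) (V : normedModType R).
Implicit Types (A : set V) (f g : V -> R) (u v a : V).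

Lemma derive_line f u b (x : R) : derivable f (x *: u + b) u ->
  is_derive x 1 (fun y : R => f (y *: u + b)) ('D_u f (x *: u + b)).
Proof.
have E (h : R) : (h *: 1 + x) *: u + b = h *: u + (x *: u + b).
  by rewrite [h *: 1]mulr1 scalerDl addrA.
move=> Df; split; rewrite /derivable /derive /=.
  by under eq_fun do rewrite E.
by under eq_fun do rewrite E.
Qed.

Lemma smooth_on_derive A f u : smooth_on A f -> smooth_on A ('D_u f).
Proof. by move=> sf vs a Aa; have := sf (rcons vs u) a Aa; rewrite foldr_rcons. Qed.

(** Smoothness is expressed by iterated directional derivatives, so linearity at one stage must hold
    on a neighbourhood before the next derivative is taken; hence the openness of [A]. *)
Lemma smooth_on_lin A f g (x y : R) : open A -> smooth_on A f -> smooth_on A g ->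
  smooth_on A (fun a => x * f a + y * g a).
Proof.
move=> oA sf sg vs.
pose D f := foldr (fun v g => 'D_v g) f vs.
have lin (F G : V -> R) a : differentiable F a -> differentiable G a ->
    is_diff a (fun b => x * F b + y * G b) (x *: ('d F a : V -> R) + y *: ('d G a : V -> R)).
  by move=> /differentiableP DF /differentiableP DG; exact: (is_diffD (is_diffZ x DF) (is_diffZ y DG)).
have nearA a (P : V -> Prop) : A a -> (forall b, A b -> P b) -> \near a, P a.
  by move=> Aa AP; apply: filterS (AP) _; exact: open_nbhs_nbhs.
have Ef a : A a -> D (fun a => x * f a + y * g a) a = x * D f a + y * D g a.
  rewrite {}/D; elim: vs a => [//|v vs IH] a Aa /=.
  set F := foldr _ f vs; set G := foldr _ g vs.
  have [DF DG] : differentiable F a /\ differentiable G a by split; [exact: sf|exact: sg].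
  rewrite (@near_eq_derive _ _ _ _ (fun b => x * F b + y * G b)); last first.
    by apply: nearA Aa _ => b Ab; exact: IH.
  have [Dl dl] := lin _ _ _ DF DG.
  by rewrite deriveE// dl !deriveE.
move=> a Aa; have l := lin _ _ _ (sf vs _ Aa) (sg vs _ Aa).
suff [//] : is_diff a (D (fun a => x * f a + y * g a))
  (x *: ('d (D f) a : V -> R) + y *: ('d (D g) a : V -> R)).
by apply: is_diff_near_eq l; apply: nearA Aa _ => b Ab; rewrite -Ef.
Qed.

Lemma mvt_line f u b (x : R) : 0 < x ->
  (forall y, 0 <= y <= x -> differentiable f (y *: u + b)) ->
  exists2 y, 0 <= y <= x & f (x *: u + b) - f b = x * 'D_u f (y *: u + b).
Proof.
move=> x0 Df.
have D y : 0 <= y <= x -> is_derive y 1 (fun y : R => f (y *: u + b)) ('D_u f (y *: u + b)).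
  by move=> yx; apply: derive_line; exact/diff_derivable/Df.
have [y|y|y yx] := @MVT_segment _ (fun y : R => f (y *: u + b))
    (fun y => 'D_u f (y *: u + b)) 0 x (ltW x0).
- by rewrite in_itv/= => /andP[y0 yx]; apply: D; rewrite !ltW.
- apply: derivable_within_continuous => y'; rewrite in_itv/= => /D[]//.
- by rewrite scale0r add0r subr0 mulrC => ->; exists y => //; rewrite in_itv in yx.
Qed.

(** The mean value theorem is applied twice: along u to the increment [g] of f in the direction v,
    then along v to the derivative of f along u. *)
Lemma second_difference A f u v a (t : R) : 0 < t ->
  (forall x y, 0 <= x <= t -> 0 <= y <= t -> A (x *: u + (y *: v + a))) ->
  smooth_on A f ->
  exists x y, [/\ 0 <= x <= t, 0 <= y <= t &
    f (t *: u + (t *: v + a)) - f (t *: u + a) - (f (t *: v + a) - f a) =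
    t * (t * 'D_v ('D_u f) (x *: u + (y *: v + a)))].
Proof.
move=> t0 At sf; have t00 : 0 <= t <= t by rewrite lexx andbT ltW.
have z0 : 0 <= (0 : R) <= t by rewrite lexx ltW.
pose g b := f (t *: v + b) - f b.
have At0 x : 0 <= x <= t -> A (x *: u + a).
  by move=> xt; have := At x 0 xt z0; rewrite scale0r add0r.
have At1 x y : 0 <= x <= t -> 0 <= y <= t -> A (y *: v + (x *: u + a)).
  by move=> xt yt; rewrite addrCA; exact: At.
have shiftd y : 0 <= y <= t ->
    is_diff (y *: u + a) (fun b : V => f (t *: v + b)) ('d f (t *: v + (y *: u + a))).
  move=> yt; have Df : differentiable f (t *: v + (y *: u + a)) by apply: (sf [::]); exact: At1.
  have D1 : is_diff (y *: u + a) (fun b : V => t *: v + b) id.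
    by apply: is_diff_eq; rewrite add0r.
  exact: (@is_diff_comp _ _ _ _ _ _ _ _ _ D1 (differentiableP Df)).
have Dg y : 0 <= y <= t -> is_diff (y *: u + a) g
    (('d f (t *: v + (y *: u + a)) : V -> R) - ('d f (y *: u + a) : V -> R)).
  move=> yt; apply: is_diffB; first exact: shiftd.
  by apply: differentiableP; apply: (sf [::]); exact: At0.
have [|x xt gx] := @mvt_line g u a t t0; first by move=> y /Dg[].
have [|y yt fy] := @mvt_line ('D_u f) v (x *: u + a) t t0.
  by move=> y yt; apply: (sf [:: u]); exact: At1.
exists x, y; split => //.
rewrite [_ + (t *: v + a)]addrCA.
transitivity (g (t *: u + a) - g a) => //.
rewrite gx; congr (_ * _); rewrite [x *: u + (y *: v + a)]addrCA -fy.
have [Dgx dgx] := Dg _ xt; rewrite deriveE// dgx !deriveE//.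
- by apply: (sf [::]); exact: At0.
- by apply: (sf [::]); exact: At1.
Qed.

Lemma nbhs_norm (P : set V) a : nbhs a P ->
  exists2 d : R, 0 < d & forall b, `|b| < d -> P (b + a).
Proof.
move=> /nbhs_ballP[d /= d0 dP]; exists d => // b bd; apply: dP.
by rewrite -ball_normE /= opprD addrCA subrr addr0 normrN.
Qed.

Lemma continuous_norm f a (e : R) : {for a, continuous f} -> 0 < e ->
  exists2 d : R, 0 < d & forall b, `|b| < d -> `|f a - f (b + a)| < e.
Proof. by move=> /cvgrPdist_lt cf /cf /nbhs_norm. Qed.

Lemma subr_swap (x y c d : R) : x - y - (c - d) = x - c - (y - d).
Proof. ring. Qed.

Lemma dist_half (x y c e : R) : `|x - c| < e / 2 -> `|y - c| < e / 2 -> `|x - y| <= e.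
Proof.
by move=> h1 h2; rewrite (le_trans (ler_distD c _ _))// [leRHS]splitr lerD ?ltW// distrC.
Qed.

(** The second difference is symmetric in u and v. Hence the two mixed derivatives take equal values
    at two points as close to a as desired, and both are continuous at a. *)
Lemma schwarz A f u v a : open A -> smooth_on A f -> A a ->
  'D_u ('D_v f) a = 'D_v ('D_u f) a.
Proof.
move=> oA sf Aa; apply/eqP; rewrite -subr_eq0 -normr_le0; apply/ler_addgt0Pr => e e0.
rewrite add0r.
have c1 : {for a, continuous ('D_u ('D_v f))}.
  by apply: differentiable_continuous; exact: (sf [:: u; v]).
have c2 : {for a, continuous ('D_v ('D_u f))}.
  by apply: differentiable_continuous; exact: (sf [:: v; u]).
have e2 : 0 < e / 2 by rewrite divr_gt0.
have [d1 d10 d1P] := nbhs_norm (open_nbhs_nbhs (conj oA Aa)).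
have [d2 d20 d2P] := continuous_norm c1 e2.
have [d3 d30 d3P] := continuous_norm c2 e2.
pose d := Order.min d1 (Order.min d2 d3).
have d0 : 0 < d by rewrite !lt_min d10 d20.
have dP b : `|b| < d -> [/\ A (b + a),
    `|'D_u ('D_v f) a - 'D_u ('D_v f) (b + a)| < e / 2 &
    `|'D_v ('D_u f) a - 'D_v ('D_u f) (b + a)| < e / 2].
  rewrite !lt_min => /and3P[h1 h2 h3].
  by split; [exact: d1P|exact: d2P|exact: d3P].
have [t [t0 tP]] : exists t : R, 0 < t /\ forall x y, 0 <= x <= t -> 0 <= y <= t ->
    `|x *: u + y *: v| < d.
  (* The summand 1 allows u = v = 0, and the factor 2 makes the resulting bound d / 2 strictly
     smaller than d. *)
  exists (d / (2 * (`|u| + `|v| + 1))).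
  have k0 : 0 < `|u| + `|v| + 1 by rewrite ltr_pwDr// addr_ge0.
  split; first by rewrite divr_gt0// mulr_gt0.
  set t := _ / _ => x y /andP[x0 xt] /andP[y0 yt].
  have t0 : 0 < t by rewrite divr_gt0// mulr_gt0.
  apply: (le_lt_trans (ler_normD _ _)); rewrite !normrZ !ger0_norm//.
  apply: (@le_lt_trans _ _ (t * (`|u| + `|v| + 1))).
    by rewrite !mulrDr mulr1 ler_wpDr ?(ltW t0)// lerD// ler_wpM2r.
  by rewrite /t invfM mulrA divfK ?gt_eqF// ltr_pdivrMr// ltr_pMr// ltr1n.
have AP x y : 0 <= x <= t -> 0 <= y <= t -> A (x *: u + (y *: v + a)).
  by move=> xt yt; rewrite addrA; have [] := dP _ (tP _ _ xt yt).
have AP' x y : 0 <= x <= t -> 0 <= y <= t -> A (x *: v + (y *: u + a)).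
  by move=> xt yt; rewrite addrCA; exact: AP.
have [x [y [xt yt xyE]]] := second_difference t0 AP sf.
have [x' [y' [x't y't xyE']]] := second_difference t0 AP' sf.
have : t * (t * 'D_v ('D_u f) (x *: u + (y *: v + a))) =
       t * (t * 'D_u ('D_v f) (x' *: v + (y' *: u + a))).
  by apply: etrans (esym xyE) (etrans _ xyE'); rewrite [t *: u + (t *: v + a)]addrCA; exact: subr_swap.
move=> /(mulfI (lt0r_neq0 t0)) /(mulfI (lt0r_neq0 t0)).
rewrite [x' *: v + _]addrCA !addrA => E.
have [_ _ h2] := dP _ (tP _ _ xt yt); have [_ h1 _] := dP _ (tP _ _ y't x't).
rewrite -E in h1.
exact: dist_half h1 h2.
Qed.

End SmoothFunctions.

Section WirtingerTaylor.
Variable R : realType.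
Local Notation C := R[i].
Implicit Types (F G : C -> C) (w : C).

Lemma disc_open (e : R) : open (disc e).
Proof.
rewrite openE => a ae; apply: filterS (_ : forall b, disc e (ofC (toC b)) -> disc e b) _.
  by case.
rewrite -(toCK a); apply/(wnearP (toC a) (fun w => disc e (ofC w))).
exists (e - cmod (toC a)) => [|w we]; first by rewrite subr_gt0.
suff : cmod w < e by case: w {we}.
by rewrite -(subrK (toC a) w) (le_lt_trans (cmodD _ _))// -ltrBrDr.
Qed.

Definition csmooth (e : R) F : Prop := csmooth_on (disc e) (plane F).

Definition dir (v : R * R) F : C -> C := fun w => cderive v (plane F) (ofC w).

Lemma csmooth_lin e (x y : C) F G : csmooth e F -> csmooth e G ->
  csmooth e (fun w => x * F w + y * G w).
Proof.
move=> [F1 F2] [G1 G2]; have oD := @disc_open e.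
split.
  have := smooth_on_lin 1 1 oD
   (smooth_on_lin (complex.Re x) (- complex.Im x) oD F1 F2)
   (smooth_on_lin (complex.Re y) (- complex.Im y) oD G1 G2).
  by congr smooth_on; apply/funext => a; rewrite /plane !ReImE; ring.
have := smooth_on_lin 1 1 oD
   (smooth_on_lin (complex.Re x) (complex.Im x) oD F2 F1)
   (smooth_on_lin (complex.Re y) (complex.Im y) oD G2 G1).
by congr smooth_on; apply/funext => a; rewrite /plane !ReImE; ring.
Qed.

Lemma wdiff_ext F G w al be ga de : F =1 G -> wdiff F w al be ->
  al = ga -> be = de -> wdiff G w ga de.
Proof. by move=> /funext <- dF <- <-. Qed.

Lemma csmooth_dir e v F : csmooth e F -> csmooth e (dir v F).
Proof.
by move=> [/(smooth_on_derive v) F1 /(smooth_on_derive v) F2]; split;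
  [move: F1|move: F2]; congr smooth_on; apply/funext => -[].
Qed.

Lemma dwE F : dw F = fun w => 2^-1 * dir (1, 0) F w + (- 'i / 2) * dir (0, 1) F w.
Proof. by apply/funext => w; rewrite /dw /dir -/(ofC w); ring. Qed.

Lemma dwbarE F : dwbar F = fun w => 2^-1 * dir (1, 0) F w + ('i / 2) * dir (0, 1) F w.
Proof. by apply/funext => w; rewrite /dwbar /dir -/(ofC w); ring. Qed.

Lemma csmooth_dw e F : csmooth e F -> csmooth e (dw F).
Proof. by move=> sF; rewrite dwE; apply: csmooth_lin; exact: csmooth_dir. Qed.

Lemma csmooth_dwbar e F : csmooth e F -> csmooth e (dwbar F).
Proof. by move=> sF; rewrite dwbarE; apply: csmooth_lin; exact: csmooth_dir. Qed.

Lemma wdiff_val F w al be : wdiff F w al be -> dw F w = al /\ dwbar F w = be.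
Proof.
move=> dF; have [[F1 _] [F2 _]] := dF.
by have [] := wdiff_unique (wdiff_dw F1 F2) dF.
Qed.

Lemma dir_comm e F w u v : csmooth e F -> cmod w < e -> dir u (dir v F) w = dir v (dir u F) w.
Proof.
move=> [F1 F2] we; have wD : disc e (ofC w) by case: w we.
have E (f : R * R -> R) u' v' : (fun b => 'D_u' f (ofC (b.1 +i* b.2))) = 'D_u' f.
  by apply/funext => -[].
rewrite /dir /cderive /plane /=; apply: complexP => /=.
  have := schwarz u v (@disc_open e) F1 wD.
  by congr (_ = _); congr ('D__ _ _); apply/funext => -[].
have := schwarz u v (@disc_open e) F2 wD.
by congr (_ = _); congr ('D__ _ _); apply/funext => -[].
Qed.

Lemma wdiff_lin (x y : C) F G w al be ga de : wdiff F w al be -> wdiff G w ga de ->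
  wdiff (fun w => x * F w + y * G w) w (x * al + y * ga) (x * be + y * de).
Proof.
move=> dF dG.
apply: wdiff_eq (wdiffD (wdiffM (wdiff_cst x w) dF) (wdiffM (wdiff_cst y w) dG)) _ _; ring.
Qed.

Lemma dw_dwbar e F w : csmooth e F -> cmod w < e -> dwbar (dw F) w = dw (dwbar F) w.
Proof.
move=> sF we; have sd v := csmooth_dir v sF.
have dd v := csmooth_wdiff (sd v) we.
have [_ ] := wdiff_val (wdiff_lin 2^-1 (- 'i / 2) (dd (1, 0)) (dd (0, 1))).
have [+ _] := wdiff_val (wdiff_lin 2^-1 ('i / 2) (dd (1, 0)) (dd (0, 1))).
rewrite -dwbarE -dwE => -> ->.
rewrite !{1}dwE !{1}dwbarE (dir_comm (0, 1) (1, 0) sF we).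
move: (dir _ _ w) (dir _ _ w) (dir _ _ w) => x y t; ring.
Qed.

Lemma dw_near_eq e F G w : (forall w, cmod w < e -> F w = G w) -> cmod w < e ->
  dw F w = dw G w /\ dwbar F w = dwbar G w.
Proof.
move=> FG we.
have wD : disc e (ofC w) by case: w we.
have FG' : \forall a \near ofC w, plane F a = plane G a.
  by apply: filterS (open_nbhs_nbhs (conj (@disc_open e) wD)) => a; exact: FG.
have Ed v : dir v F w = dir v G w.
  by rewrite /dir /cderive; congr (_ +i* _); apply: near_eq_derive; apply: filterS FG' => a ->.
by rewrite !dwE !dwbarE !Ed.
Qed.

Lemma csmooth_iter e F k l : csmooth e F -> csmooth e (iter k (@dw R) (iter l (@dwbar R) F)).
Proof.
move=> sF; elim: k => [|k IH]; last exact: csmooth_dw.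
by elim: l => [//|l IH]; exact: csmooth_dwbar.
Qed.

Lemma iter_near_eq e F G w k l : (forall w, cmod w < e -> F w = G w) -> cmod w < e ->
  iter k (@dw R) (iter l (@dwbar R) F) w = iter k (@dw R) (iter l (@dwbar R) G) w.
Proof.
move=> FG; elim: k w => [|k IH] w we /=; last by have [] := dw_near_eq IH we.
by elim: l w we => [|l IH] w we /=; [exact: FG|have [] := dw_near_eq IH we].
Qed.

(** Jets are read with [dw] applied after [dwbar]. Moving one [dw] next to F shows that the jet of
    [dw F] is a shift of the jet of F. *)
Lemma iter_dw_comm e F w l : csmooth e F -> cmod w < e ->
  iter l (@dwbar R) (dw F) w = dw (iter l (@dwbar R) F) w.
Proof.
move=> sF; elim: l w => [//|l IH] w we /=.
have [_ ->] := dw_near_eq IH we.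
by apply: dw_dwbar we; exact: (@csmooth_iter e F 0 l).
Qed.

Lemma wdiff_exp n w : wdiff (fun w => w ^+ n.+1) w (n.+1%:R * w ^+ n) 0.
Proof.
elim: n => [|n IH].
  by apply: wdiff_eq (wdiff_id w) _ erefl; rewrite mulr1.
apply: wdiff_ext (wdiffM (wdiff_id w) IH) _ _ => [x||]; first by rewrite -exprS.
  by rewrite mul1r mulrCA -exprS -[n.+2%:R]natr1 mulrDl mul1r addrC.
by rewrite mul0r mulr0 addr0.
Qed.

Lemma wdiff_poly (a : nat -> C) M w : wdiff (fun w => \sum_(k < M.+1) a k * w ^+ k) w
  (\sum_(k < M) k.+1%:R * a k.+1 * w ^+ k) 0.
Proof.
elim: M => [|M IH].
  by apply: wdiff_ext (wdiff_cst (a 0) w) _ _ => [x||//];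
    rewrite ?big_ord0// big_ord1 expr0 mulr1.
apply: wdiff_ext (wdiff_lin 1 (a M.+1) IH (wdiff_exp M w)) _ _ => [x||].
- by rewrite [RHS]big_ord_recr mul1r.
- by rewrite [RHS]big_ord_recr mul1r; congr (_ + _); rewrite mulrCA mulrA.
- by rewrite !mulr0 addr0.
Qed.

(** The mean value theorem on the segment from 0 to w is applied separately to the real and
    imaginary parts; hence the factor 2. *)
Lemma wdiff_mvt (G : C -> C) (al be : C -> C) (d B : R) : 
  (forall w, cmod w < d -> wdiff G w (al w) (be w)) ->
  forall w, cmod w < d ->
  (forall t : R, 0 <= t <= 1 -> cmod (al (t%:C * w)) + cmod (be (t%:C * w)) <= B) ->
  cmod (G w - G 0) <= 2 * (B * cmod w).
Proof.
move=> dG w wd bB.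
have tw (t : R) : 0 <= t <= 1 -> cmod (t%:C * w) < d.
  move=> /andP[t0 t1]; rewrite cmodM cmod_real ger0_norm//.
  by rewrite (le_lt_trans _ wd)// ler_piMl// cmod_ge0.
have du (t : R) : 0 <= t <= 1 -> tdiff (fun s => G (s%:C * w)) t
    (al (t%:C * w) * w + be (t%:C * w) * w^*%C).
  move=> t01; apply: (@wdiff_comp_tdiff _ G (fun s => s%:C * w)); first exact/dG/tw.
  by split; [have := is_diff_scalel t (complex.Re w)|have := is_diff_scalel t (complex.Im w)];
    congr is_diff_def; apply/funext => s; rewrite ReImE /= !(mul0r, subr0, addr0).
have bd (t : R) : 0 <= t <= 1 -> cmod (al (t%:C * w) * w + be (t%:C * w) * w^*%C) <= B * cmod w.
  move=> /bB tB; rewrite (le_trans (cmodD _ _))// !cmodM cmod_conj -mulrDl.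
  by rewrite ler_wpM2r// cmod_ge0.
have mvt (p : C -> R) : (forall x, `|p x| <= cmod x) ->
    (forall t : R, 0 <= t <= 1 -> is_derive t 1 (fun s => p (G (s%:C * w)))
       (p (al (t%:C * w) * w + be (t%:C * w) * w^*%C))) ->
    `|p (G w) - p (G 0)| <= B * cmod w.
  move=> ple dp.
  have [t|t|t] := @MVT_segment _ (fun s => p (G (s%:C * w))) 
    (fun t => p (al (t%:C * w) * w + be (t%:C * w) * w^*%C)) 0 1 ler01.
  - by rewrite in_itv/= => /andP[t0 t1]; apply: dp; rewrite !ltW.
  - by apply: derivable_within_continuous => y; rewrite in_itv/= => /dp[].
  - rewrite in_itv/= mul1r mul0r subr0 mulr1 => t01 ->.
    exact: le_trans (ple _) (bd _ t01).
rewrite (le_trans (cmod_le_ReIm _))// !ReImE mulrDl mul1r lerD//.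
  by apply: mvt => [x|t /du/tdiff_derive[]//]; exact: cmod_ge_Re.
by apply: mvt => [x|t /du/tdiff_derive[]//]; exact: cmod_ge_Im.
Qed.

(** Induction on M, for all F at once. The Wirtinger derivatives of the remainder are the remainders
    of order M of [dw F], with coefficients (k + 1) a_(k+1), and of [dwbar F], whose jet is zero.
    The remainder vanishes at 0, so bounding its increment from there gains one power of |w|. *)
Lemma taylor M e F (a : nat -> C) : 0 < e -> csmooth e F ->
  (forall k l, iter k (@dw R) (iter l (@dwbar R) F) 0 =
     if l == 0%N then (k`!)%:R * a k else 0) ->
  exists K d : R, [/\ 0 <= K, 0 < d & forall w, cmod w < d ->
    cmod (F w - \sum_(k < M) a k * w ^+ k) <= K * cmod w ^+ M].
Proof.
move=> e0; have c0 : cmod (0 : C) < e by rewrite cmod0.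
elim: M F a => [|M IH] F a sF Fa.
  have [d d0 dP] := wdiff_near_cmod (csmooth_wdiff sF c0) ltr01.
  exists (cmod (F 0) + 1), d; split => //; first by rewrite addr_ge0 ?cmod_ge0.
  move=> w wd; rewrite big_ord0 subr0 expr0 mulr1.
  rewrite -(subrK (F 0) (F w)) (le_trans (cmodD _ _))// addrC lerD2l ltW// dP//.
  by rewrite subr0.
have [k l|K1 [d1 [K10 d10 h1]]] := IH (dw F) (fun k => k.+1%:R * a k.+1) (csmooth_dw sF).
  have /= -> := @iter_near_eq e _ _ 0 k 0 (fun w => iter_dw_comm l sF) c0.
  rewrite -iterSr Fa; case: eqP => // _.
  by rewrite factS natrM; ring.
have [k l|K2 [d2 [K20 d20 h2]]] := IH (dwbar F) (fun=> 0) (csmooth_dwbar sF).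
  by rewrite -iterSr Fa mulr0 if_same.
pose T w := \sum_(k < M.+1) a k * w ^+ k.
pose T' w := \sum_(k < M) k.+1%:R * a k.+1 * w ^+ k.
have dG w : cmod w < e -> wdiff (fun w => F w - T w) w (dw F w - T' w) (dwbar F w).
  move=> we.
  apply: wdiff_ext (wdiff_lin 1 (-1) (csmooth_wdiff sF we) (wdiff_poly a M w)) _ _ => [x||].
  - by rewrite mul1r mulN1r.
  - by rewrite mul1r mulN1r.
  - by rewrite mulr0 addr0 mul1r.
exists (2 * (K1 + K2)), (Order.min e (Order.min d1 d2)).
split; [by rewrite mulr_ge0// addr_ge0|by rewrite !lt_min e0 d10|].
move=> w; rewrite !lt_min => /and3P[we w1 w2].
have G0 : F 0 - T 0 = 0.
  rewrite /T big_ord_recl expr0 mulr1 big1 ?addr0 => [|i _]; last by rewrite expr0n mulr0.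
  by have := Fa 0 0; rewrite /= fact0 mul1r => ->; rewrite subrr.
have := wdiff_mvt (B := (K1 + K2) * cmod w ^+ M) dG we.
rewrite G0 subr0 => /(_ _)/le_trans; apply; last by rewrite -mulrA -exprSr mulrA.
move=> t /andP[t0 t1].
have tw : cmod (t%:C * w) <= cmod w.
  by rewrite cmodM cmod_real ger0_norm// ler_piMl// cmod_ge0.
have twM : cmod (t%:C * w) ^+ M <= cmod w ^+ M by rewrite lerXn2r// nnegrE cmod_ge0.
rewrite mulrDl lerD//.
  apply: le_trans (h1 _ (le_lt_trans tw w1)) _; exact: ler_wpM2l.
have := h2 _ (le_lt_trans tw w2); rewrite big1 ?subr0 => [|i _]; last by rewrite mul0r.
by move=> /le_trans; apply; exact: ler_wpM2l.
Qed.

End WirtingerTaylor.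

(** * Piecewise smooth paths inside U *)

Section Pieces.
Variable R : realType.
Local Notation C := R[i].
Implicit Types (T : seq R) (t : R).

(** If every vertex were strictly above t, all terms of the vanishing sum of k_i (T_i - t) would be
    non-negative, hence zero, and so would all the weights, against their sum 1. The same argument
    gives a vertex above t. *)
Lemma hullP T t : hull T t <-> exists a b, [/\ a \in T, b \in T & a <= t <= b].
Proof.
split=> [[k [k0 k1 tE]]|[a [b [aT bT /andP[at_ tb]]]]].
  have zero : \sum_i k i * (T`_i - t) = 0.
    under eq_bigr do rewrite mulrBr.
    by rewrite sumrB -mulr_suml k1 mul1r -[X in X - _]tE subrr.
  have pick_vertex (P : pred R) : (forall i : 'I_(size T), ~~ P T`_i -> k i = 0) -> exists2 a, a \in T & P a.
    move=> Pk; have [/existsP[i Pi]|/existsPn nP] := boolP [exists i : 'I_(size T), P T`_i].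
      by exists T`_i => //; exact: mem_nth.
    by move: k1; rewrite big1 => [/esym/eqP|i _]; [rewrite oner_eq0|exact/Pk/nP].
  have [a aT at_] : exists2 a, a \in T & a <= t.
    have [/hasP[a aT at_]|/hasPn nT] := boolP (has (<= t) T); first by exists a.
    apply: pick_vertex => i _; have Ti (j : 'I_(size T)) : t < T`_j by rewrite ltNge; apply: nT; exact: mem_nth.
    have ge0 (j : 'I_(size T)) : true -> 0 <= k j * (T`_j - t).
      by rewrite mulr_ge0// subr_ge0 ltW.
    have := psumr_eq0P ge0 zero isT (i := i).
    by move=> /eqP; rewrite mulf_eq0 subr_eq0 (gt_eqF (Ti i)) orbF => /eqP.
  have [b bT tb] : exists2 b, b \in T & t <= b.
    have [/hasP[b bT tb]|/hasPn nT] := boolP (has (>= t) T); first by exists b.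
    apply: pick_vertex => i _; have Ti (j : 'I_(size T)) : T`_j < t by rewrite ltNge; apply: nT; exact: mem_nth.
    have zero' : \sum_i k i * (t - T`_i) = 0.
      by apply/oppr_inj; rewrite oppr0 -sumrN -[RHS]zero; apply: eq_bigr => j _; rewrite -mulrN opprB.
    have ge0 (j : 'I_(size T)) : true -> 0 <= k j * (t - T`_j).
      by rewrite mulr_ge0// subr_ge0 ltW.
    have := psumr_eq0P ge0 zero' isT (i := i).
    by move=> /eqP; rewrite mulf_eq0 subr_eq0 (gt_eqF (Ti i)) orbF => /eqP.
  by exists a, b; split => //; rewrite at_.
have [l [l0 l1 tE]] : exists l, [/\ 0 <= l, l <= 1 & t = l * a + (1 - l) * b].
  have [ab|ab] := eqVneq a b.
    by exists 1; split => //; rewrite subrr mul0r mul1r addr0; apply/le_anti; rewrite at_ ab tb.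
  have ab' : 0 < b - a by rewrite subr_gt0 lt_neqAle ab (le_trans at_).
  exists ((b - t) / (b - a)); split.
  - by rewrite divr_ge0 ?subr_ge0// (le_trans at_).
  - by rewrite ler_pdivrMr// mul1r lerD2l lerN2.
  - by field; rewrite gt_eqF.
have aT' : (index a T < size T)%N by rewrite index_mem.
have bT' : (index b T < size T)%N by rewrite index_mem.
(* Adding two weighted indicators also covers the case where a and b are the same vertex. *)
exists (fun i => l * (i == Ordinal aT')%:R + (1 - l) * (i == Ordinal bT')%:R); split.
- by move=> i; rewrite addr_ge0// mulr_ge0// subr_ge0.
- rewrite big_split/= -!mulr_sumr.
  have one (j : 'I_(size T)) : \sum_i (i == j)%:R = 1 :> R.
    by rewrite (bigD1 j)//= eqxx big1 ?addr0// => i /negPf ->.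
  by rewrite !one; ring.
- rewrite tE; under eq_bigr do rewrite scalerDl.
  have one (j : 'I_(size T)) (x : R) : \sum_i (x * (i == j)%:R) *: T`_i = x * T`_j :> R.
    by rewrite (bigD1 j)//= eqxx mulr1 big1 ?addr0// => i /negPf ->; rewrite mulr0 scale0r.
  by rewrite big_split/= !one /= !nth_index.
Qed.

(** Away from the vertices, a condition imposed only along the piece, as in [smooth_map_at], holds
    on both sides of t, so that derivatives at t can be taken. *)
Lemma hull_interior T t : hull T t -> t \notin T -> \forall y \near t, hull T y.
Proof.
move=> /hullP[a [b [aT bT]]]; rewrite !le_eqVlt => /andP[/predU1P[ta|at_]].
  by rewrite -ta aT.
move=> /predU1P[->|tb _]; first by rewrite bT.
have : t \in `]a, b[ by rewrite in_itv/= at_.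
move=> /near_in_itvoo; apply: filterS => y; rewrite in_itv/= => /andP[ay yb].
by apply/hullP; exists a, b; rewrite aT bT (ltW ay) ltW.
Qed.

Lemma hull_exterior T t : ~ hull T t -> \forall y \near t, ~ hull T y.
Proof.
move=> nT.
have [/hasP[a aT at_]|/hasPn na] := boolP (has (<= t) T).
  have lt_t b : b \in T -> b < t.
    by move=> bT; rewrite ltNge; apply/negP => tb; apply: nT; apply/hullP; exists a, b; split => //; apply/andP.
  have : \forall y \near t, forall b, b \in T -> b < y.
    elim: T lt_t {nT aT} => [|b T IH] lt_t; first by apply: filterE.
    have bt : b < t by apply: lt_t; rewrite inE eqxx.
    have := IH (fun b bT => lt_t b (mem_behead (s := _ :: _) bT)).
    have : \forall y \near t, b < y by exact: lt_nbhsr.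
    by apply: filterS2 => y by_ yT b'; rewrite inE => /predU1P[->|/yT].
  by apply: filterS => y yT /hullP[? [b [_ /yT bt /andP[_]]]]; rewrite leNgt bt.
have : \forall y \near t, forall b, b \in T -> y < b.
  have {}na b : b \in T -> t < b by move=> /na; rewrite -ltNge.
  elim: T na {nT} => [|b T IH] lt_t; first by apply: filterE.
  have bt : t < b by apply: lt_t; rewrite inE eqxx.
  have := IH (fun b bT => lt_t b (mem_behead (s := _ :: _) bT)).
  have : \forall y \near t, y < b by exact: lt_nbhsl.
  by apply: filterS2 => y by_ yT b'; rewrite inE => /predU1P[->|/yT].
by apply: filterS => y yT /hullP[b [? [/yT bt _ /andP[+ _]]]]; rewrite leNgt bt.
Qed.

(** A piece that misses t misses a neighbourhood of t, so only the pieces through t have to be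
    tested. At a break-point they provide the one-sided statements. *)
Lemma near_pieces (Ts : seq (seq R)) (Q : R -> Prop) t :
  (forall T, T \in Ts -> hull T t -> \forall y \near t, hull T y -> Q y) ->
  \forall y \near t, (exists2 T, T \in Ts & hull T y) -> Q y.
Proof.
elim: Ts => [_|T Ts IH TQ]; first by apply: filterE => y [].
have : \forall y \near t, hull T y -> Q y.
  have [Tt|nT] := pselect (hull T t); first by apply: TQ Tt; rewrite inE eqxx.
  by apply: filterS (hull_exterior nT) => y.
have := IH (fun T' T'Ts => TQ T' (mem_behead (s := _ :: _) T'Ts)).
by apply: filterS2 => y yTs yT [T']; rewrite inE => /predU1P[->//|T'Ts T'y]; apply: yTs; exists T'.
Qed.

Lemma near_pieces_bounded (Ts : seq (seq R)) (Q : R -> R -> Prop) t :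
  (forall M N y, M <= N -> Q M y -> Q N y) ->
  (forall T, T \in Ts -> hull T t -> exists M, \forall y \near t, hull T y -> Q M y) ->
  exists M, \forall y \near t, (exists2 T, T \in Ts & hull T y) -> Q M y.
Proof.
move=> mono; elim: Ts => [_|T Ts IH TQ]; first by exists 0; apply: filterE => y [].
have [M1 M1P] : exists M, \forall y \near t, hull T y -> Q M y.
  have [Tt|nT] := pselect (hull T t); first by apply: TQ Tt; rewrite inE eqxx.
  by exists 0; apply: filterS (hull_exterior nT) => y.
have [M2 M2P] := IH (fun T' T'Ts => TQ T' (mem_behead (s := _ :: _) T'Ts)).
exists (Order.max M1 M2); apply: filterS2 M1P M2P => y y1 y2 [T'].
rewrite inE => /predU1P[->|T'Ts] T'y.
  by apply: mono (y1 T'y); rewrite le_max lexx.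
by apply: mono (y2 _); [rewrite le_max lexx orbT|exists T'].
Qed.

Definition ccont (F : R -> C) t : Prop :=
  (complex.Re (F y) @[y --> t] --> complex.Re (F t)) /\
  (complex.Im (F y) @[y --> t] --> complex.Im (F t)).

Lemma ccont_cst x t : ccont (fun=> x) t.
Proof. by split; exact: cvg_cst. Qed.

Lemma ccontD F1 F2 t : ccont F1 t -> ccont F2 t -> ccont (fun y => F1 y + F2 y) t.
Proof.
by move=> [h1 h2] [h3 h4]; split; rewrite ReImE; under eq_fun do rewrite ReImE; exact: cvgD.
Qed.

Lemma ccontM F1 F2 t : ccont F1 t -> ccont F2 t -> ccont (fun y => F1 y * F2 y) t.
Proof.
move=> [h1 h2] [h3 h4]; split; rewrite ReImE; under eq_fun do rewrite ReImE.
  by apply: cvgB; exact: cvgM.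
by apply: cvgD; exact: cvgM.
Qed.

Lemma ccont_conj F t : ccont F t -> ccont (fun y => (F y)^*%C) t.
Proof.
by move=> [h1 h2]; split; rewrite ReImE; under eq_fun do rewrite ReImE; [|exact: cvgN].
Qed.

Lemma ccont_sum (I : Type) (r : seq I) (F : I -> R -> C) t :
  (forall i, ccont (F i) t) -> ccont (fun y => \sum_(i <- r) F i y) t.
Proof.
move=> FP; elim: r => [|i r IH].
  by under eq_fun do rewrite big_nil; exact: ccont_cst.
by under eq_fun do rewrite big_cons; exact: ccontD.
Qed.

Lemma ccont_comp (F : C -> C) g t al be : wdiff F (g t) al be -> ccont g t ->
  ccont (F \o g) t.
Proof.
move=> /cdiff_continuous[F1 F2] [g1 g2].
have gp : {for t, continuous (fun y => ofC (g y))} by exact: (cvg_pair g1 g2).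
split.
  have := @continuous_comp _ _ _ (fun y => ofC (g y)) _ t gp F1.
  by congr (_ _ _); apply/funext => y; rewrite /= /plane; case: (g y).
have := @continuous_comp _ _ _ (fun y => ofC (g y)) _ t gp F2.
by congr (_ _ _); apply/funext => y; rewrite /= /plane; case: (g y).
Qed.

Lemma ccont_near_eq F1 F2 t : (\forall y \near t, F1 y = F2 y) -> ccont F1 t -> ccont F2 t.
Proof.
move=> E [h1 h2]; have Et := nbhs_singleton E.
by split; rewrite -Et;
  [apply: cvg_trans h1|apply: cvg_trans h2]; apply: near_eq_cvg; apply: filterS E => y ->.
Qed.

Lemma ccont_near_cmod F t (e : R) : ccont F t -> 0 < e ->
  \forall y \near t, cmod (F y - F t) < e.
Proof. by move=> [h1 h2]; exact: near_cmod. Qed.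

Lemma ccont_bounded F t : ccont F t -> \forall y \near t, cmod (F y) <= cmod (F t) + 1.
Proof.
move=> /ccont_near_cmod/(_ ltr01); apply: filterS => y h.
by rewrite -(subrK (F t) (F y)) (le_trans (cmodD _ _))// addrC lerD2l ltW.
Qed.

Lemma tdiff_ccont g t d : tdiff g t d -> ccont g t.
Proof. exact: cdiff_continuous. Qed.

End Pieces.

Section SmoothCurves.
Variable R : realType.
Local Notation C := R[i].
Local Notation velocity := (@cderive R R 1).

Lemma wdiff_sum (n : nat) (F : 'I_n -> C -> C) w (al be : 'I_n -> C) :
  (forall a, wdiff (F a) w (al a) (be a)) ->
  wdiff (fun w => \sum_a F a w) w (\sum_a al a) (\sum_a be a).
Proof.
move=> dF; apply: (cdiff_eq (cdiff_sum _ dF)) => h.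
by rewrite big_split/= !mulr_suml.
Qed.

Lemma tdiff_sum (n : nat) (F : 'I_n -> R -> C) t (d : 'I_n -> C) :
  (forall a, tdiff (F a) t (d a)) ->
  tdiff (fun y => \sum_a F a y) t (\sum_a d a).
Proof.
by move=> dF; apply: (cdiff_eq (cdiff_sum _ dF)) => h; rewrite mulr_sumr.
Qed.

Lemma tdiffM (F1 F2 : R -> C) t d1 d2 : tdiff F1 t d1 -> tdiff F2 t d2 ->
  tdiff (fun y => F1 y * F2 y) t (d1 * F2 t + F1 t * d2).
Proof. by move=> h1 h2; apply: (cdiff_eq (cdiffM h1 h2)) => h; ring. Qed.

Lemma csmooth_curve (A : set R) (g : R -> C) t : csmooth_on A g -> A t ->
  tdiff g t (velocity g t) /\ ccont (velocity g) t.
Proof.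
move=> [g1 g2] At; split.
  apply/tdiff_derive; split; apply: derivableP; apply: diff_derivable.
    exact: (g1 [::]).
  exact: (g2 [::]).
by split; [exact: (differentiable_continuous (g1 [:: 1] t At))|
  exact: (differentiable_continuous (g2 [:: 1] t At))].
Qed.

End SmoothCurves.

(** * Differentiating the pairing with a horizontal section *)

Section Pairing.
Variables (R : realType) (G : marked_curve R) (E : bundle R (amb G)).
Hypotheses (hz : has_coordinates G) (hE : is_bundle E).
Local Notation C := R[i].
Local Notation X := (pts G).
Local Notation U := (@open_part R G).
Local Notation z := (Defs.coord G).
Local Notation phi := (param G).
Local Notation pt := (Pn R (amb G)).

Lemma dotE n (x y : 'cV[C]_n) : \sum_a x a 0 * y a 0 = (x^T *m y) 0 0.
Proof. by rewrite mxE; apply: eq_bigr => a _; rewrite mxE. Qed.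

(** [pairing] picks some frame at q, possibly another one at neighbouring points. A change of frame
    acts on [v] by a transition matrix and on [y] by its inverse transpose, so one frame can be used
    throughout a disc. *)
Lemma pairing_frame (A : set pt) (v : sect E) (y : sect (dual E)) i q :
  glued A v -> A q -> glued U y -> U q -> opn E i q ->
  pairing v y q = \sum_a v i q a 0 * y i q a 0.
Proof.
move=> gv Aq gy Uq iq; have [_ _ _ [T1 TT] _] := hE.
rewrite /pairing; case: pickP => [j /asboolP jq|/(_ i)/asboolP//].
rewrite !dotE (gv j i q)// (gy j i q)//= trmx_mul mulmxA -[_ *m _ *m _^T]mulmxA.
by rewrite -trmx_mul TT// T1// trmx1 mulmx1.
Qed.

Lemma opn_near i q : opn E i q ->
  exists2 e : R, 0 < e & forall w, cmod w < e -> opn E i (phi q w) /\ U (phi q w).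
Proof.
move=> iq; have [/(_ i)[subU fin] _ _ _ _] := hE.
have [Xq _] := subU _ iq.
have [e e0 eP] := cofinite_near hz Xq iq fin.
by exists e => // w /eP iw; split => //; exact: subU.
Qed.

Lemma pairing_near (W : set (bpoint G)) (v : sect E) (y : sect (dual E)) i q :
  bopen W -> glued [set q | W (In q)] v -> W (In q) -> glued U y -> opn E i q ->
  exists2 e : R, 0 < e & forall w, cmod w < e ->
    pairing v y (phi q w) = \sum_a v i (phi q w) a 0 * y i (phi q w) a 0.
Proof.
move=> [_ bW] gv Wq gy iq; have [e1 e10 e1P] := opn_near iq.
have [e2 e20 e2P] := bW _ Wq.
exists (Order.min e1 e2) => [|w]; first by rewrite lt_min e10.
rewrite lt_min => /andP[/e1P[iw Uw] /e2P Ww]; exact: pairing_frame gv Ww gy Uw iw.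
Qed.

(** In a fixed frame the product rule gives (dv | s) + (v | ds). Horizontality turns dv into - A v,
    and the connection matrix of the dual is - A^T, so the first term is the one that completes ds
    to [nabla s]. As v is holomorphic, the antilinear part comes from s alone. *)
Lemma wdiff_pairing (W : set (bpoint G)) (v : sect E) (s : sect (dual E)) q :
  bopen W -> horizontal_mod W v -> W (In q) -> glued U s -> U q ->
  (forall i q, opn E i q -> forall a, smooth_at (fun y => s i y a 0) q) ->
  wdiff (fun w => pairing v s (phi q w)) 0
    (pairing v (nabla s) q) (pairing v (dbar s) q).
Proof.
move=> bW [gv hv _] Wq gs Uq ss; have [_ cov _ _ _] := hE.
have [Xq _] := Uq; have p0 := phi0 hz Xq.
rewrite [X in wdiff _ _ X]/pairing [X in wdiff _ _ _ X]/pairing.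
case: pickP => [i /asboolP iq|/= none]; last first.
  by have [i iq] := cov _ Uq; have /asboolP := none i.
have [e e0 eP] := pairing_near bW gv Wq gs iq.
have [hvi nv] := hv _ _ Wq iq.
have dv a : wdiff (fun w => v i (phi q w) a 0) 0 (del (fun y => v i y a 0) q) 0.
  by have [e' e'0 he'] := hvi a; apply: holo_disc_wdiff he' _; rewrite cmod0.
have ds a : wdiff (fun w => s i (phi q w) a 0) 0
    (del (fun y => s i y a 0) q) (delbar (fun y => s i y a 0) q).
  by have [e' e'0 he'] := ss _ _ iq a; apply: csmooth_wdiff he' _; rewrite cmod0.
have D := wdiff_sum (fun a => wdiffM (dv a) (ds a)).
apply: wdiff_near_eq (wdiff_eq D _ _).
- by exists e => // w; rewrite subr0 => /eP ->.
- rewrite p0 big_split /=.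
  pose dvm := entrywise (@del R G) (v i) q; pose dsm := entrywise (@del R G) (s i) q.
  transitivity (\sum_a dvm a 0 * s i q a 0 + \sum_a v i q a 0 * dsm a 0).
    by apply: f_equal2; apply: eq_bigr => a _; rewrite mxE.
  rewrite !dotE /nabla /= mulmxDr addrC [RHS]mxE; congr (_ + _).
  have -> : dvm = - (cmx E i q *m v i q) by apply/eqP; rewrite -addr_eq0; apply/eqP.
  by rewrite linearN /= trmx_mul !mulNmx mulmxN mulmxA.
- by apply: eq_bigr => a _; rewrite p0 mul0r add0r mxE.
Qed.

End Pairing.

Section Paths.
Variables (R : realType) (G : marked_curve R) (E : bundle R (amb G)).
Hypotheses (hz : has_coordinates G) (hE : is_bundle E).
Local Notation C := R[i].
Local Notation X := (pts G).
Local Notation U := (@open_part R G).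
Local Notation z := (Defs.coord G).
Local Notation phi := (param G).
Local Notation pt := (Pn R (amb G)).
Local Notation velocity := (@cderive R R 1).

Variable c : R -> bpoint G.

(* The condition is two-sided in t, and may fail at the break-points of c. *)
Definition chart_at (q : pt) (t : R) : Prop := exists (e : R) (g : R -> C),
  [/\ 0 < e, csmooth_on (ball t e) g, g t = 0 &
      \forall y \near t, c y = In (phi q (g y))].

Lemma interior_chart T t q : hull T t -> t \notin T -> smooth_map_at (hull T) c t ->
  c t = In q -> chart_at q t.
Proof.
move=> Tt tT + ct; rewrite /smooth_map_at ct => -[e [g [e0 sg g0 gP]]].
exists e, g; split => //; apply: filterS2 (hull_interior Tt tT) (nbhsx_ballx t e e0).
by move=> y Ty ye; exact: gP.
Qed.

(** [pullback] measures velocity through z_q along c. Since z_q inverts phi_q, this is the velocity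
    of the lift g of c to the chart at q, and the chain rule can be applied to g. *)
Lemma tdiff_path t q (f : pt -> C) al be : X q -> chart_at q t ->
  wdiff (fun w => f (phi q w)) 0 al be ->
  let g' := velocity (fun y => bcoord q (c y)) t in
  tdiff (fun y => if c y is In p then f p else 0) t (al * g' + be * g'^*%C).
Proof.
move=> Xq [e [g [e0 sg g0 gP]]] df.
have [dg _] := csmooth_curve sg (ballxx t e0).
have along (F : pt -> C) a b : wdiff (fun w => F (phi q w)) 0 a b ->
    tdiff (fun y => if c y is In p then F p else 0) t
      (a * velocity g t + b * (velocity g t)^*%C).
  move=> dF; rewrite -g0 in dF.
  apply: cdiff_near_eq (wdiff_comp_tdiff dF dg).
  by apply: filterS gP => y ->.
suff E' : velocity (fun y => bcoord q (c y)) t = velocity g t.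
  by move=> g'; rewrite /g' E'; exact: along df.
have dz : wdiff (fun w => z q (phi q w)) 0 1 0.
  apply: wdiff_near_eq (wdiff_id 0).
  have [e' e'0 e'P] := chart hz Xq; exists e' => // w; rewrite subr0 => /e'P[_ -> _] //.
by apply: cderiveE; apply: tdiff_eq (along (z q) _ _ dz) _; rewrite mul1r mul0r addr0.
Qed.

Variables (W : set (bpoint G)) (v : sect E) (s : sect (dual E)).
Hypotheses (bW : bopen W) (hv : horizontal_mod W v) (gs : glued U s)
  (ss : forall i q, opn E i q -> forall a, smooth_at (fun y => s i y a 0) q).

Lemma tdiff_pairing t q : c t = In q -> U q -> W (In q) -> chart_at q t ->
  tdiff (fun y => bpairing v s (c y)) t
    (pullback c (fun=> v) (nabla s, dbar s) t).
Proof.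
move=> ct Uq Wq ch; rewrite /pullback ct.
exact: (tdiff_path Uq.1 ch (wdiff_pairing hz hE bW hv Wq gs Uq ss)).
Qed.

Variable omega : sect (dual E).
Hypothesis homega : regular_form omega.

Lemma csmooth_sub (e e' : R) (F : C -> C) : e' <= e -> csmooth e F -> csmooth e' F.
Proof.
have sub : e' <= e -> disc e' `<=` disc e by move=> ee a ae; exact: lt_le_trans ee.
by move=> /sub ee [F1 F2]; split=> vs a /ee; [exact: F1|exact: F2].
Qed.

(** One radius on which everything is expressed in the frame [i] and the coordinate at [p]. There
    [h a] is the coefficient of omega on dz_p, and [d] is the factor for passing from the coordinate
    at [phi p w], used by [omega], to the coordinate at p. *)
Lemma good_disc p i : opn E i p -> W (In p) ->
  exists (e : R) (h : 'I_(rank E) -> pt -> C), [/\ 0 < e,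
    forall a, csmooth e (fun w => v i (phi p w) a 0),
    forall a, csmooth e (fun w => s i (phi p w) a 0) &
    forall w, cmod w < e -> [/\ U (phi p w), W (In (phi p w)), opn E i (phi p w) &
      z p (phi p w) = w /\ (exists d : C, wdiff (fun w' => z p (phi (phi p w) w')) 0 d 0) /\
      forall a, omega i (phi p w) a 0 = h a (phi p w) * del (z p) (phi p w) /\
       hol (fun w => h a (phi p w)) w]].
Proof.
move=> ip Wp; have [/(_ i)[/(_ _ ip)[Xp _] _] _ _ _ _] := hE.
have [_ /(_ _ _ Wp ip)[vh _] _] := hv.
have [e1 e10 e1P] : exists2 e : R, 0 < e & forall a, csmooth e (fun w => v i (phi p w) a 0).
  apply: (min_gt0 (P := fun a e => csmooth e _)) => [a x y|a]; first exact: csmooth_sub.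
  by have [e e0 []] := vh a; exists e.
have [e2 e20 e2P] : exists2 e : R, 0 < e & forall a, csmooth e (fun w => s i (phi p w) a 0).
  apply: (min_gt0 (P := fun a e => csmooth e _)) => [a x y|a]; first exact: csmooth_sub.
  by have [e e0 ?] := ss ip a; exists e.
have [_ reg] := homega.
have /choice[h hP] : forall a : 'I_(rank E), exists h, regular_at X h p /\
    znear X p (fun q => omega i q a 0 = h q * del (z p) q) by move=> a; exact: reg.
have [e3 e30 e3P] : exists2 e : R, 0 < e & forall a w, cmod w < e ->
    omega i (phi p w) a 0 = h a (phi p w) * del (z p) (phi p w) /\
    regular_at X (h a) (phi p w).
  apply: (min_gt0 (P := fun a e => forall w, cmod w < e -> _)) => [a x y yx xP w wy|a].
    by apply: xP; exact: lt_le_trans yx.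
  have [ra za] := hP a.
  have [d1 d10 d1P] := regular_near hz Xp ra; have [d2 d20 d2P] := znear_near hz Xp za.
  exists (Order.min d1 d2) => [|w]; first by rewrite lt_min d10.
  by rewrite lt_min => /andP[/d1P ? /d2P ?].
have [e4 e40 e4P] := chart hz Xp; have [e5 e50 e5P] := chart_change hz Xp.
have [e6 e60 e6P] := opn_near hz hE ip; have [e7 e70 e7P] := bW.2 _ Wp.
exists (Order.min e1 (Order.min e2 (Order.min e3 (Order.min e4 (Order.min e5 (Order.min e6 e7)))))), h.
split; [by rewrite !lt_min e10 e20 e30 e40 e50 e60|..].
- by move=> a; apply: csmooth_sub (e1P a); rewrite !ge_min lexx.
- by move=> a; apply: csmooth_sub (e2P a); rewrite !ge_min lexx orbT.
move=> w; rewrite !lt_min => /and5P[_ _ w3 w4 /and3P[w5 w6 w7]].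
have [Xw zw holw] := e4P _ w4; have [d _ dz] := e5P _ w5; have [iw Uw] := e6P _ w6.
split => //; first exact: e7P.
split => //; split; first by exists d.
by move=> a; have [E1 E2] := e3P a _ w3; split => //; exact: holw.
Qed.

Lemma csmooth_ccont (e : R) (F : C -> C) g t : csmooth e F -> cmod (g t) < e ->
  ccont g t -> ccont (fun y => F (g y)) t.
Proof. by move=> sF gt; exact: ccont_comp (csmooth_wdiff sF gt). Qed.

(* F1 and F2 are the pull-backs expressed in the chart at p, hence continuous
   across the ends of T.  F2 is the derivative of H, which identifies it with the
   pull-back of (nabla + dbar) s without a change of coordinates. *)
Lemma pullback_near T t p : W (In p) -> U p -> c t = In p -> hull T t ->
  (forall t, hull T t -> smooth_map_at (hull T) c t) ->
  exists F1 F2 H : R -> C, \forall y \near t, [/\ ccont F1 y, ccont F2 y, ccont H y &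
    hull T y -> bpairing v s (c y) = H y /\
     (y \notin T -> pullback c (fun=> v) (omega, fun _ _ => 0) y = F1 y /\
                    pullback c (fun=> v) (nabla s, dbar s) y = F2 y)].
Proof.
move=> Wp Up ct Tt sT; have [_ cov _ _ _] := hE; have [i ip] := cov _ Up.
have [e [h [e0 sv ss' eP]]] := good_disc ip Wp.
have := sT _ Tt; rewrite /smooth_map_at ct => -[e1 [g [e10 sg g0 gP]]].
pose V a w := v i (phi p w) a 0; pose S a w := s i (phi p w) a 0.
pose A y := ball t e1 y /\ cmod (g y) < e.
have dg y : A y -> tdiff g y (velocity g y) /\ ccont (velocity g) y.
  by move=> [ty _]; exact: csmooth_curve sg ty.
(* Continuity is claimed at every y close to t, not only at t, so the condition [A] has to persist
   around each of its points. *)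
have openA y : A y -> \forall y' \near y, A y'.
  move=> Ay; have [/tdiff_ccont cg _] := dg _ Ay; have [ty gy] := Ay.
  have slack : 0 < e - cmod (g y) by rewrite subr_gt0.
  have nball : nbhs y (ball t e1) by apply: open_nbhs_nbhs; split => //; exact: ball_open.
  have ncg := ccont_near_cmod cg slack.
  apply: filterS (filterI nball ncg) => y' [ty' /= gy']; split; first exact: ty'.
  by rewrite -(subrK (g y) (g y')) (le_lt_trans (cmodD _ _))// -ltrBrDr.
have At : A t by split; [exact: ballxx|rewrite g0 cmod0].
pose H y := \sum_a V a (g y) * S a (g y).
pose F1 y := (\sum_a V a (g y) * h a (phi p (g y))) * velocity g y.
pose dF (F : C -> C) y := dw F (g y) * velocity g y + dwbar F (g y) * (velocity g y)^*%C.
pose F2 y := \sum_a (dF (V a) y * S a (g y) + V a (g y) * dF (S a) y).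
have HE y : A y -> hull T y -> bpairing v s (c y) = H y.
  move=> [ty gy] Ty; rewrite (gP _ Ty ty) /=; have [Uy Wy iy _] := eP _ gy.
  by have [gv _ _] := hv; exact: (pairing_frame hE gv Wy gs Uy iy).
exists F1, F2, H; apply: filterS (openA _ At) => y Ay; have [dgy cvel] := dg _ Ay.
have cg := tdiff_ccont dgy; have [ty gy] := Ay.
have cdF (F : C -> C) : csmooth e F -> ccont (dF F) y.
  move=> sF; apply: ccontD; apply: ccontM => //; last exact: ccont_conj.
    exact: csmooth_ccont (csmooth_dw sF) gy cg.
  exact: csmooth_ccont (csmooth_dwbar sF) gy cg.
have cV a : ccont (fun y => V a (g y)) y by exact: csmooth_ccont (sv a) gy cg.
have cS a : ccont (fun y => S a (g y)) y by exact: csmooth_ccont (ss' a) gy cg.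
have [Uy Wy iy [zy [[d dz] hy]]] := eP _ gy.
split.
- apply: ccontM => //; apply: ccont_sum => a; apply: ccontM => //.
  have [_ [d' dh]] := hy a.
  exact: (@ccont_comp _ (fun w => h a (phi p w)) g y _ _ dh cg).
- by apply: ccont_sum => a; apply: ccontD; apply: ccontM => //;
    [exact: cdF (sv a)|exact: cdF (ss' a)].
- by apply: ccont_sum => a; apply: ccontM.
move=> Ty; split; first exact: HE.
move=> yT; have cy := gP _ Ty ty.
have ch := interior_chart Ty yT (sT _ Ty) cy; have [Xy _] := Uy.
have near_y : \forall y' \near y, A y' /\ hull T y'.
  by apply: filterS (filterI (openA _ Ay) (hull_interior Ty yT)) => y' [].
split.
  rewrite /pullback cy /=.
  set g' := velocity _ y.
  have -> : pairing v (fun _ _ => 0) (phi p (g y)) = 0.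
    rewrite /pairing; case: pickP => // j _; rewrite big1// => a _.
    by rewrite mxE mulr0.
  rewrite mul0r addr0.
  have [gv _ _] := hv; have [go _] := homega.
  rewrite (pairing_frame hE gv Wy go Uy iy) /F1.
  have dE : del (z p) (phi p (g y)) = d by have [] := wdiff_val dz.
  (* Both sides are the derivative of z_p along c at y, computed through the coordinate at c(y) and
     through g. *)
  have velE : del (z p) (phi p (g y)) * g' = velocity g y.
    have := tdiff_path Xy ch dz; cbv zeta; rewrite -/g' mul0r addr0 -dE => dzc.
    apply: tdiff_unique dgy; apply: cdiff_near_eq dzc.
    apply: filterS near_y => y' [[ty' gy'] Ty']; rewrite (gP _ Ty' ty').
    by have [_ _ _ [-> _]] := eP _ gy'.
  rewrite -velE mulrA; congr (_ * _); rewrite mulr_suml; apply: eq_bigr => a _.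
  by have [-> _] := hy a; rewrite mulrA.
have dH : tdiff H y (F2 y).
  apply: tdiff_sum => a; apply: tdiffM.
    exact: wdiff_comp_tdiff (csmooth_wdiff (sv a) gy) dgy.
  exact: wdiff_comp_tdiff (csmooth_wdiff (ss' a) gy) dgy.
apply: tdiff_unique (tdiff_pairing cy Uy Wy ch) _.
by apply: cdiff_near_eq dH; apply: filterS near_y => y' [Ay' Ty']; rewrite HE.
Qed.

End Paths.

(** * Behaviour at the boundary of the blow-up *)

Section Expansions.
Variable R : realType.
Local Notation C := R[i].

Lemma finite_bound (I : finType) (Q : I -> R -> R -> Prop) :
  (forall i e e' M M', e' <= e -> M <= M' -> Q i e M -> Q i e' M') ->
  (forall i, exists e M, 0 < e /\ Q i e M) ->
  exists e M, 0 < e /\ forall i, Q i e M.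
Proof.
move=> mono /choice[e /choice[M eMP]].
exists (\big[Order.min/1]_i e i), (\sum_i `|M i|); split=> [|i].
  by elim/big_ind: _ => // [x y x0 y0|i _]; [rewrite lt_min x0|case: (eMP i)].
apply: mono (eMP i).2; first exact: bigmin_le_cond.
by rewrite (bigD1 i)//= (le_trans (ler_norm _))// lerDl sumr_ge0.
Qed.

(** The N2 new terms of lowest degree vanish because their exponents lie below - N1. Expansions
    written with different pole orders thus become comparable. *)
Lemma shifted_sum (mu : int -> C) (w : C) (N1 N2 L : nat) :
  (forall k : int, k < - N1%:Z -> mu k = 0) ->
  w ^+ N2 * \sum_(k < L) mu (k%:Z - N1%:Z) * w ^+ k =
  \sum_(l < N2 + L) mu (l%:Z - (N2 + N1)%:Z) * w ^+ l.
Proof.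
move=> mu0; rewrite big_split_ord /= [X in X + _]big1 ?add0r => [|i _]; last first.
  rewrite mu0 ?mul0r//; have := ltn_ord i; lia.
rewrite big_distrr /=; apply: eq_bigr => k _.
rewrite mulrCA -exprD; congr (mu _ * _); lia.
Qed.

(* Both functions equal w^-(N1 + N2) times the same truncated series, up to
   errors of order |w|^M. *)
Lemma expansion_unique (mu : int -> C) (w x y : C) (N1 N2 M : nat) (K1 K2 : R) :
  w != 0 ->
  (forall k : int, k < - N1%:Z -> mu k = 0) ->
  (forall k : int, k < - N2%:Z -> mu k = 0) ->
  cmod (w ^+ N1 * x - \sum_(k < M + N1) mu (k%:Z - N1%:Z) * w ^+ k) <= K1 * cmod w ^+ (M + N1) ->
  cmod (w ^+ N2 * y - \sum_(k < M + N2) mu (k%:Z - N2%:Z) * w ^+ k) <= K2 * cmod w ^+ (M + N2) ->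
  cmod (x - y) <= (K1 + K2) * cmod w ^+ M.
Proof.
move=> w0 mu1 mu2; set P1 := \sum_(k < _) _; set P2 := \sum_(k < _) _ => h1 h2.
have PE : w ^+ N2 * P1 = w ^+ N1 * P2.
  (* The cut-offs M + N1 and M + N2 are such that both products truncate the same series after N1 +
     N2 + M terms. *)
  have E : (N2 + (M + N1) = N1 + (M + N2))%N by lia.
  by rewrite !shifted_sum// [(N1 + N2)%N]addnC E.
have wN : 0 < cmod w ^+ (N1 + N2) by rewrite exprn_gt0// cmod_gt0.
rewrite -(ler_pM2l wN) -cmodX -cmodM.
have -> : w ^+ (N1 + N2) * (x - y) =
    w ^+ N2 * (w ^+ N1 * x - P1) - w ^+ N1 * (w ^+ N2 * y - P2).
  by rewrite !mulrBr PE exprD; ring.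
rewrite (le_trans (cmodD _ _))// cmodN !cmodM !cmodX.
apply: (@le_trans _ _ (cmod w ^+ N2 * (K1 * cmod w ^+ (M + N1)) +
    cmod w ^+ N1 * (K2 * cmod w ^+ (M + N2)))).
  by rewrite lerD// ler_wpM2l// exprn_ge0// cmod_ge0.
by rewrite !exprD le_eqVlt; apply/orP; left; apply/eqP; ring.
Qed.

End Expansions.

Section Boundary.
Variables (R : realType) (G : marked_curve R) (E : bundle R (amb G)).
Hypotheses (hz : has_coordinates G) (hE : is_bundle E).
Local Notation C := R[i].
Local Notation X := (pts G).
Local Notation U := (@open_part R G).
Local Notation z := (Defs.coord G).
Local Notation phi := (param G).
Local Notation pt := (Pn R (amb G)).
Variables (x : pt) (u : C).
Hypothesis Dx : marked G x.
Hypothesis Xx : X x.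

Definition sector (e : R) (w : C) : Prop :=
  0 < cmod w < e /\ cmod (w / (cmod w)%:C - u) < e.

Lemma sector_sub e e' w : e' <= e -> sector e' w -> sector e w.
Proof.
by move=> ee [/andP[w0 we] h]; split; [rewrite w0 (lt_le_trans we)|exact: lt_le_trans ee].
Qed.

Lemma bnearUP (P : pt -> Prop) : bnearU (Bd x u) P <->
  exists2 e : R, 0 < e & forall w, sector e w -> P (phi x w).
Proof.
split=> [[e e0 [eP _]]|[e e0 eP]]; exists e => //; first by move=> w [we wu]; exact: eP.
by split=> // w we wu; exact: eP.
Qed.

Section Growth.
Variables (W : set (bpoint G)) (v : sect E).
Hypotheses (hv : horizontal_mod W v) (Wx : W (Bd x u)).

Lemma moderate_growth : exists (N : nat) (K e : R), [/\ 0 <= K, 0 < e &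
  forall w, sector e w -> forall i a, cmod (v i (phi x w) a 0) <= K * cmod w ^- N].
Proof.
have [_ _ /(_ _ _ Wx)vm] := hv.
have /choice[N NP] : forall i, exists N, exists K : R, bnearU (Bd x u)
    (fun q => forall a, cmod (v i q a 0) <= K * cmod (z x q) ^- N).
  by move=> i; exact: vm.
have [ec e0c ecP] := chart hz Xx.
(* [e <= ec] allows z_x(phi_x(w)) to be replaced by w, and [e <= 1] makes |w|^-N increase with N, so
   that the largest exponent serves all frames. *)
have [|i|e [K [e0 eK]]] := @finite_bound R (idx E) (fun i e K => e <= 1 /\ e <= ec /\
   forall w, sector e w -> forall a, cmod (v i (phi x w) a 0) <= K * cmod w ^- N i).
- move=> i e e' K K' ee KK [e1 [e2 eP]]; split; [exact: le_trans e1|split; [exact: le_trans e2|]].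
  move=> w /(sector_sub ee) we a; apply: le_trans (eP w we a) _.
  by rewrite ler_wpM2r// invr_ge0 exprn_ge0// cmod_ge0.
- have [K /bnearUP[e e0 eP]] := NP i.
  exists (Order.min e (Order.min ec 1)), K; split; first by rewrite !lt_min e0 e0c ltr01.
  split; first by rewrite !ge_min lexx !orbT.
  split; first by rewrite !ge_min lexx !orbT.
  move=> w we a; have := eP w (sector_sub _ we) a; rewrite ge_min lexx => /(_ isT).
  have [/andP[_]] := we; rewrite !lt_min => /and3P[_ wec _] _.
  by have [_ -> _] := ecP _ wec.
exists (\max_i N i)%N, `|K|, e; split => // w we i a; have [e1 [_ eP]] := eK i.
have [/andP[w0 wle] _] := we.
apply: le_trans (eP w we a) _.
have ge0 : 0 <= cmod w ^- N i by rewrite invr_ge0 exprn_ge0// ltW.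
apply: (@le_trans _ _ (`|K| * cmod w ^- N i)); first by rewrite ler_wpM2r// ler_norm.
rewrite ler_wpM2l// lef_pV2 ?posrE ?exprn_gt0//.
apply: ler_wiXn2l; rewrite ?(ltW w0)//; first by rewrite (le_trans (ltW wle)).
exact: leq_bigmax.
Qed.

End Growth.

(** After multiplication by a power of w, s has a smooth extension whose jet has no conjugate terms,
    so [taylor] yields an estimate of the same shape as the asymptotic expansion of [mt]. Each
    estimate is taken to an order raised by its own pole order. *)
Lemma germ_difference (s mt : sect (dual E)) (m : formal (dual E)) M :
  smooth_with_taylor s m -> germ_with_expansion x u mt (m x) ->
  exists K e : R, [/\ 0 <= K, 0 < e & forall w, sector e w -> forall i a,
    cmod (mt i (phi x w) a 0 - s i (phi x w) a 0) <= K * cmod w ^+ M].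
Proof.
move=> [_ _ sT] [_ mE]; have [ec e0c ecP] := chart hz Xx.
pose Q (ia : idx E * 'I_(rank E)) (e K : R) := forall w, sector e w ->
  cmod (mt ia.1 (phi x w) ia.2 0 - s ia.1 (phi x w) ia.2 0) <= K * cmod w ^+ M.
have [|[i a]|e [K [e0 eK]]] := @finite_bound R _ Q.
- move=> ia e e' K K' ee KK eP w /(sector_sub ee) we; apply: le_trans (eP w we) _.
  by rewrite ler_wpM2r// exprn_ge0// cmod_ge0.
- have [N1 [_ mu1 exp1]] := mE i a.
  have [N2 [e2 [F [e20 sF sE mu2 tayl]]]] := sT i x Dx a.
  have [K1 /bnearUP[e1 e10 h1]] := exp1 (M + N1)%N.
  have [K2 [e3 [_ e30 h2]]] := taylor (M + N2)%N e20 sF (a := fun k => m x i (k%:Z - N2%:Z) a 0) tayl.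
  exists (Order.min ec (Order.min e1 (Order.min e2 e3))), (K1 + K2).
  split; first by rewrite !lt_min e0c e10 e20.
  move=> w [/andP[w0 +] wu]; rewrite !lt_min => /and4P[wc w1 w2 w3].
  have [_ zw _] := ecP _ wc.
  apply: (@expansion_unique _ (fun k => m x i k a 0) _ _ _ N1 N2) => //.
  + by rewrite -cmod_gt0.
  + have := h1 w; rewrite zw; apply; split; first by rewrite w0.
    by apply: lt_le_trans wu _; rewrite !ge_min lexx !orbT.
  + by rewrite sE ?w0//; exact: h2.
exists `|K|, e; split => // w we i a; apply: le_trans (eK (i, a) w we) _.
by rewrite ler_wpM2r ?ler_norm// exprn_ge0// cmod_ge0.
Qed.

Section Pairings.
Variables (W : set (bpoint G)) (v : sect E).
Hypotheses (hv : horizontal_mod W v) (Wx : W (Bd x u)).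

Lemma cmod_pairing q (y : sect (dual E)) (B1 B2 : R) : 0 <= B1 ->
  (forall i a, cmod (v i q a 0) <= B1) -> (forall i a, cmod (y i q a 0) <= B2) ->
  cmod (pairing v y q) <= (rank E)%:R * (B1 * `|B2|).
Proof.
move=> B10 vB yB; rewrite /pairing; case: pickP => [i _|_]; last first.
  by rewrite cmod0 mulr_ge0// mulr_ge0.
rewrite (le_trans (cmod_sum _ _))// -[X in X%:R]card_ord -sum1_card natr_sum mulr_suml.
apply: ler_sum => a _; rewrite mul1r cmodM; apply: ler_pM; rewrite ?cmod_ge0//.
exact: le_trans (yB i a) (ler_norm _).
Qed.

Lemma pairing_difference (s mt : sect (dual E)) (m : formal (dual E)) :
  smooth_with_taylor s m -> germ_with_expansion x u mt (m x) ->
  exists K e : R, [/\ 0 <= K, 0 < e & forall w, sector e w ->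
    cmod (pairing v mt (phi x w) - pairing v s (phi x w)) <= K * cmod w].
Proof.
move=> sT mE; have [N [K1 [e1 [K10 e10 h1]]]] := moderate_growth hv Wx.
(* One order beyond the growth exponent [N] of v leaves a factor |w| in the pairing. *)
have [K2 [e2 [K20 e20 h2]]] := germ_difference N.+1 sT mE.
exists ((rank E)%:R * (K1 * K2)), (Order.min e1 e2); split.
- by rewrite mulr_ge0// mulr_ge0.
- by rewrite lt_min e10.
move=> w we.
have w1 : sector e1 w by apply: sector_sub we; rewrite ge_min lexx.
have w2 : sector e2 w by apply: sector_sub we; rewrite ge_min lexx orbT.
have w0 : 0 < cmod w by have [/andP[]] := w1.
have -> : pairing v mt (phi x w) - pairing v s (phi x w) =
    pairing v (fun i q => mt i q - s i q) (phi x w).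
  rewrite /pairing; case: pickP => [i _|_]; last by rewrite subrr.
  by rewrite -sumrB; apply: eq_bigr => a _; rewrite !mxE mulrBr.
apply: le_trans (cmod_pairing _ (h1 w w1) (B2 := K2 * cmod w ^+ N.+1) _) _.
- by rewrite mulr_ge0// invr_ge0 exprn_ge0// ltW.
- by move=> i a; rewrite !mxE; exact: h2.
rewrite ger0_norm; last by rewrite mulr_ge0// exprn_ge0// ltW.
rewrite le_eqVlt; apply/orP; left; apply/eqP; rewrite exprSr; field.
by rewrite expf_neq0// gt_eqF.
Qed.

End Pairings.
End Boundary.

(** * Paths reaching the boundary of the blow-up *)

Section PolarCurves.
Variable R : realType.
Local Notation C := R[i].

Lemma tdiff_polar (r th : R -> R) (t dr dth : R) :
  is_derive t (1 : R) r dr -> is_derive t (1 : R) th dth ->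
  tdiff (fun y => (r y)%:C * cis (th y)) t
    (dr%:C * cis (th t) + (r t)%:C * (dth%:C * ('i%C * cis (th t)))).
Proof.
move=> hr hth; apply: tdiffM; apply/tdiff_derive; split => //=.
  exact: is_derive_cst.
  have := @is_derive1_comp _ cos th t _ _ (is_derive_cos _) hth.
  by congr is_derive; rewrite ?ReImE /=; ring.
have := @is_derive1_comp _ sin th t _ _ (is_derive_sin _) hth.
by congr is_derive; rewrite ?ReImE /=; ring.
Qed.

Lemma smooth_on_near (e : R) (f : R -> R) (t : R) : 0 < e -> smooth_on (ball t e) f ->
  [/\ \forall y \near t, is_derive y (1 : R) f ('D_(1 : R) f y), {for t, continuous f} &
     {for t, continuous ('D_(1 : R) f)}].
Proof.
move=> e0 sf; have te := ballxx t e0; split.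
- apply: filterS (nbhsx_ballx t e e0) => y ye.
  by apply: derivableP; apply: diff_derivable; exact: (sf [::]).
- exact: (differentiable_continuous (sf [::] t te)).
- exact: (differentiable_continuous (sf [:: 1] t te)).
Qed.

Lemma continuous_near_bounded (f : R -> R) (t : R) : {for t, continuous f} ->
  \forall y \near t, `|f y| <= `|f t| + 1.
Proof.
move=> /cvgrPdist_lt/(_ 1 ltr01); apply: filterS => y h.
rewrite -(subrK (f t) (f y)) (le_trans (ler_normD _ _))// addrC lerD2l ltW//.
by rewrite distrC.
Qed.

(** The derivative of r cis(th) has modulus at most |r'| + |r| |th'|, and near t each of these
    factors exceeds its value at t by at most 1. *)
Lemma polar_velocity (e : R) (r th : R -> R) (t : R) : 0 < e ->
  smooth_on (ball t e) r -> smooth_on (ball t e) th ->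
  exists M, \forall y \near t, exists2 d,
    tdiff (fun y => (r y)%:C * cis (th y)) y d & cmod d <= M.
Proof.
move=> e0 /(smooth_on_near e0)[dr cr cdr] /(smooth_on_near e0)[dth cth cdth].
exists (`|'D_(1 : R) r t| + 1 + (`|r t| + 1) * (`|'D_(1 : R) th t| + 1)).
have b1 := continuous_near_bounded cdr; have b2 := continuous_near_bounded cr.
have b3 := continuous_near_bounded cdth.
apply: filterS (filterI (filterI dr dth) (filterI b1 (filterI b2 b3))).
move=> y [[ry thy] [h1 [h2 h3]]]; exists
  (('D_(1 : R) r y)%:C * cis (th y) + (r y)%:C * (('D_(1 : R) th y)%:C * ('i%C * cis (th y)))).
  exact: tdiff_polar.
have ci : cmod ('i%C : C) = 1 by rewrite /cmod /= expr0n expr1n add0r sqrtr1.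
rewrite (le_trans (cmodD _ _))// !cmodM !cmod_real cmod_cis ci !mulr1 lerD//.
by rewrite ler_pM.
Qed.

End PolarCurves.

Section BoundaryPaths.
Variables (R : realType) (G : marked_curve R) (E : bundle R (amb G)).
Hypotheses (hz : has_coordinates G) (hE : is_bundle E).
Local Notation C := R[i].
Local Notation X := (pts G).
Local Notation U := (@open_part R G).
Local Notation z := (Defs.coord G).
Local Notation phi := (param G).
Local Notation pt := (Pn R (amb G)).
Local Notation velocity := (@cderive R R 1).
Variables (x : pt) (u : C).
Hypothesis Dx : marked G x.
Hypothesis Xx : X x.
Variable c : R -> bpoint G.
Hypothesis hcU : forall t : R, 0 < t < 1 -> exists2 q, U q & c t = In q.

(** For parameters in (0, 1) the path lies in U, which forces r > 0. The modulus and direction of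
    [g] are then r and cis(th), which tend to 0 and u at t. *)
Lemma boundary_curve T t : c t = Bd x u -> smooth_map_at (hull T) c t ->
  exists (g : R -> C) (M : R), (\forall y \near t, exists2 d, tdiff g y d & cmod d <= M) /\
    forall e : R, 0 < e -> \forall y \near t, hull T y -> 0 < y < 1 ->
      c y = In (phi x (g y)) /\ sector u e (g y).
Proof.
move=> ct; rewrite /smooth_map_at ct => -[e [r [th [e0 sr sth [rt tht] cP]]]].
have [M MP] := polar_velocity e0 sr sth.
exists (fun y => (r y)%:C * cis (th y)), M; split => // e1 e10.
have [_ cr _] := smooth_on_near e0 sr; have [_ cth _] := smooth_on_near e0 sth.
have cc : ccont (fun y => cis (th y)) t.
  split.
    exact: (@continuous_comp _ _ _ th cos t cth (@continuous_cos R _)).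
  exact: (@continuous_comp _ _ _ th sin t cth (@continuous_sin R _)).
have n1 := ccont_near_cmod cc e10.
have n2 : \forall y \near t, `|r y| < e1.
  by move/cvgrPdist_lt : cr => /(_ _ e10); apply: filterS => y; rewrite rt sub0r normrN.
apply: filterS (filterI (nbhsx_ballx t e e0) (filterI n1 n2)) => y [ye [h1 h2]] Ty y01.
have [r0 cy] := cP _ Ty ye; have [q Uq cyq] := hcU y01.
have rn0 : r y != 0 by apply/negP => ry; rewrite ry cyq in cy.
rewrite (negPf rn0) in cy; split => //.
have rp : 0 < r y by rewrite lt_def rn0.
have cm : cmod ((r y)%:C * cis (th y)) = r y by rewrite cmodM cmod_real cmod_cis mulr1 ger0_norm.
rewrite /sector cm rp -(ger0_norm r0); split; first by rewrite /= h2.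
rewrite ger0_norm// mulrAC divff ?mul1r; last by rewrite -cmod_gt0 cmod_real normr_gt0.
by rewrite -tht.
Qed.

Variables (W : set (bpoint G)) (v : sect E) (eta : Defs.form (dual E)).
Hypotheses (bW : bopen W) (hv : horizontal_mod W v) (Wx : W (Bd x u)) (heta : rd_form eta).

Lemma rapid_bound (N : nat) : exists K e : R, [/\ 0 <= K, 0 < e &
  forall w, 0 < cmod w < e -> forall i a,
    cmod (coef10 x (fun y => eta.1 i y a 0) (phi x w)) <= K * cmod w ^+ N /\
    cmod (coef01 x (fun y => eta.2 i y a 0) (phi x w)) <= K * cmod w ^+ N].
Proof.
have [_ _ _ rap] := heta.
pose Q (ia : idx E * 'I_(rank E)) (e K : R) := forall w, 0 < cmod w < e ->
    cmod (coef10 x (fun y => eta.1 ia.1 y ia.2 0) (phi x w)) <= K * cmod w ^+ N /\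
    cmod (coef01 x (fun y => eta.2 ia.1 y ia.2 0) (phi x w)) <= K * cmod w ^+ N.
have mono (w : C) (a K K' : R) : K <= K' -> a <= K * cmod w ^+ N -> a <= K' * cmod w ^+ N.
  move=> KK /le_trans; apply; by rewrite ler_wpM2r// exprn_ge0// cmod_ge0.
have [|[i a]|e [K [e0 eK]]] := @finite_bound R _ Q.
- move=> ia e e' K K' ee KK eP w /andP[w0 we].
  have [|h1 h2] := eP w; first by rewrite w0 (lt_le_trans we).
  by split; [exact: mono h1|exact: mono h2].
- have [r1 r2] := rap i x Dx a.
  have [K1 [e1 [e10 h1]]] := r1 0%N 0%N N; have [K2 [e2 [e20 h2]]] := r2 0%N 0%N N.
  exists (Order.min e1 e2), (Order.max K1 K2); split; first by rewrite lt_min e10.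
  move=> w /andP[w0]; rewrite lt_min => /andP[w1 w2]; split.
    by apply: mono (h1 w _); rewrite ?w0// le_max lexx.
  by apply: mono (h2 w _); rewrite ?w0// le_max lexx orbT.
exists `|K|, e; split => // w we i a; have [h1 h2] := eK (i, a) w we.
by split; [apply: mono h1|apply: mono h2]; exact: ler_norm.
Qed.

(* The coefficients of eta are bounded in the coordinate at x, while the
   pull-back uses the coordinate at c y: del (z x) converts one into the other. *)
Lemma pullback_bounded T t : c t = Bd x u -> hull T t ->
  (forall t, hull T t -> smooth_map_at (hull T) c t) ->
  exists M, \forall y \near t, hull T y -> y \notin T -> 0 < y < 1 ->
    cmod (pullback c (fun=> v) eta y) <= M.
Proof.
move=> ct Tt sT; have [g [M [gM gP]]] := boundary_curve ct (sT _ Tt).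
have [N [K1 [e1 [K10 e10 h1]]]] := moderate_growth hz Xx hv Wx.
(* The order of decay is the growth exponent of v, so that the product is bounded. *)
have [K2 [e2 [K20 e20 h2]]] := rapid_bound N.
have [e3 e30 e3P] := chart hz Xx; have [e4 e40 e4P] := chart_change hz Xx.
pose e := Order.min e1 (Order.min e2 (Order.min e3 e4)).
have e0 : 0 < e by rewrite !lt_min e10 e20 e30.
exists ((rank E)%:R * (K1 * K2 * `|M| + K1 * K2 * `|M|)).
(* The description of c by g is needed around y as well, in order to differentiate at y. *)
have curve := near_join (gP _ e0).
apply: filterS (filterI gM (filterI (gP _ e0) curve)) => y [[d dg dM] [cy cnear]] Ty yT y01.
have {cy} [cy se] := cy Ty y01.
have small w : sector u e w -> [/\ sector u e1 w, 0 < cmod w < e2, cmod w < e3 & cmod w < e4].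
  move=> sw; have [/andP[w0 +] _] := sw; rewrite w0 !lt_min => /and4P[_ -> -> ->]; split => //.
  by apply: sector_sub sw; rewrite ge_min lexx.
have [s1 s2 s3 s4] := small _ se.
set q := phi x (g y) in cy *.
have [d' d'0 dz] := e4P _ s4.
have Uq : U q by have [q' Uq'] := hcU y01; rewrite cy => -[->].
have [Xq _] := Uq; have ch := interior_chart Ty yT (sT _ Ty) cy.
rewrite /pullback cy; set g' := velocity _ y.
have [dE _] := wdiff_val dz.
have y01near : \forall y' \near y, 0 < y' < 1.
  have : y \in `]0, 1[ by rewrite in_itv.
  by move=> /near_in_itvoo; apply: filterS => y'; rewrite in_itv.
have velE : d' * g' = d.
  have := tdiff_path hz Xq ch dz; cbv zeta; rewrite -/g' mul0r addr0 => dzc.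
  apply: tdiff_unique dg; apply: cdiff_near_eq dzc.
  apply: filterS (filterI cnear (filterI (hull_interior Ty yT) y01near)).
  move=> y' [h [Ty' y'01]]; have [-> /small[_ _ s3' _]] := h Ty' y'01.
  by have [_ -> _] := e3P _ s3'.
have g'M : cmod (d' * g') <= `|M| by rewrite velE (le_trans dM)// ler_norm.
have w0 : 0 < cmod (g y) by have [] := andP s2.
have V0 : 0 <= K1 * cmod (g y) ^- N by rewrite mulr_ge0// invr_ge0 exprn_ge0// ltW.
have cancel (K : R) : K1 * cmod (g y) ^- N * (K2 * cmod (g y) ^+ N * K) = K1 * K2 * K.
  by field; rewrite expf_neq0// gt_eqF.
have B0 : 0 <= K2 * cmod (g y) ^+ N by rewrite mulr_ge0// exprn_ge0// ltW.
have d'z : del (z x) q = d' by [].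
have pair (y' : sect (dual E)) (l : C) :
    (forall i a, cmod (y' i q a 0 * l) <= K2 * cmod (g y) ^+ N * `|M|) ->
    cmod (pairing v y' q * l) <= (rank E)%:R * (K1 * K2 * `|M|).
  move=> yl; have -> : pairing v y' q * l = pairing v (fun i q => l *: y' i q) q.
    rewrite /pairing; case: pickP => [i _|_]; last by rewrite mul0r.
    by rewrite mulr_suml; apply: eq_bigr => a _; rewrite mxE mulrAC mulrA.
  apply: le_trans (cmod_pairing V0 (h1 _ s1) (B2 := K2 * cmod (g y) ^+ N * `|M|) _) _.
    by move=> i a; rewrite mxE mulrC; exact: yl.
  by rewrite (ger0_norm (mulr_ge0 B0 (normr_ge0 M))) cancel.
rewrite (le_trans (cmodD _ _))// mulrDr lerD//; apply: pair => i a.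
  have -> : eta.1 i q a 0 * g' = coef10 x (fun y => eta.1 i y a 0) q * (d' * g').
    by rewrite /coef10 d'z; field.
  rewrite cmodM; apply: ler_pM; rewrite ?cmod_ge0//.
  by have [+ _] := h2 _ s2 i a.
have -> : eta.2 i q a 0 * g'^*%C = coef01 x (fun y => eta.2 i y a 0) q * (d' * g')^*%C.
  by rewrite /coef01 d'z rmorphM /=; field; rewrite fmorph_eq0.
rewrite cmodM cmod_conj; apply: ler_pM; rewrite ?cmod_ge0//.
by have [_ +] := h2 _ s2 i a.
Qed.

Lemma pairing_limit (s mt : sect (dual E)) (m : formal (dual E)) T t :
  c t = Bd x u -> smooth_map_at (hull T) c t ->
  smooth_with_taylor s m -> germ_with_expansion x u mt (m x) ->
  forall e : R, 0 < e -> \forall y \near t, hull T y -> 0 < y < 1 ->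
    cmod (bpairing v mt (c y) - bpairing v s (c y)) < e.
Proof.
move=> ct sT sm mE e e0; have [g [M [_ gP]]] := boundary_curve ct sT.
have [K [e1 [K0 e10 KP]]] := pairing_difference hz Dx Xx hv Wx sm mE.
have K1 : 0 < K + 1 by rewrite ltr_pwDr.
have e2 : 0 < Order.min e1 (e / (K + 1)) by rewrite lt_min e10 divr_gt0.
apply: filterS (gP _ e2) => y yP Ty y01; have [-> se] := yP Ty y01.
apply: le_lt_trans (KP _ (sector_sub _ se)) _; first by rewrite ge_min lexx.
have [/andP[w0 +] _] := se; rewrite lt_min ltr_pdivlMr// => /andP[_].
apply: le_lt_trans; rewrite mulrDr mulr1 mulrC lerDl; exact: ltW.
Qed.

End BoundaryPaths.

(** * The regularized integral along one path *)

Section ComplexLimits.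
Variable R : realType.
Local Notation C := R[i].

Lemma cvg_cmod (F : set_system R) (f : R -> C) (l : C) : Filter F ->
  (forall e : R, 0 < e -> \forall t \near F, cmod (f t - l) < e) ->
  (f t : R[i]^o) @[t --> F] --> (l : R[i]^o).
Proof.
move=> FF fl; apply/cvgrPdist_lt => e e0.
(* The norm on [R[i]^o] takes values in [R[i]]; a positive e there is real and is replaced by its
   real part. *)
have eR : (complex.Re e)%:C = e by rewrite RRe_real// gtr0_real.
have e0' : 0 < complex.Re e by rewrite -ltcR eR.
apply: filterS (fl _ e0') => t; rewrite -ltcR eR => /le_lt_trans; apply.
by rewrite -[_ - _]opprB normrN.
Qed.

Lemma near_cmod_ccont (F : R -> C) t :
  (forall e : R, 0 < e -> \forall y \near t, cmod (F y - F t) < e) -> ccont F t.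
Proof.
move=> cF; split; apply/cvgrPdist_lt => e /cF; apply: filterS => y; apply: le_lt_trans.
  by rewrite distrC; have := cmod_ge_Re (F y - F t); rewrite !ReImE.
by rewrite distrC; have := cmod_ge_Im (F y - F t); rewrite !ReImE.
Qed.

Lemma cint_exhaustion (B : seq R) (f : R -> C) :
  bounded_off B (fun t => complex.Re (f t)) 0 1 ->
  bounded_off B (fun t => complex.Im (f t)) 0 1 ->
  (forall t, 0 < t < 1 -> t \notin B -> ccont f t) ->
  forall e : R, 0 < e -> \forall d \near 0^'+, cmod (cint d (1 - d) f - cint 0 1 f) < e.
Proof.
move=> b1 b2 cf e e0; have e2 : 0 < e / 2 by rewrite divr_gt0.
have [c1 c2] : continuous_off B (fun t => complex.Re (f t)) 0 1 /\
    continuous_off B (fun t => complex.Im (f t)) 0 1.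
  by split=> t t01 tB; have [h1 h2] := cf t t01 tB.
have /cvgrPdist_lt/(_ _ e2) n1 := integral_exhaustion b1 c1.
have /cvgrPdist_lt/(_ _ e2) n2 := integral_exhaustion b2 c2.
apply: filterS (filterI n1 n2) => d [h1 h2].
rewrite (le_lt_trans (cmod_le_ReIm _))// !ReImE /= [ltRHS]splitr.
by rewrite ltrD// distrC.
Qed.

Lemma cint_derivative (B : seq R) (f H : R -> C) (a b : R) : a < b ->
  bounded_off B (fun t => complex.Re (f t)) a b ->
  bounded_off B (fun t => complex.Im (f t)) a b ->
  (forall t, a < t < b -> t \notin B -> ccont f t) ->
  (forall t, a <= t <= b -> ccont H t) ->
  (forall t, a < t < b -> t \notin B -> tdiff H t (f t)) ->
  cint a b f = H b - H a.
Proof.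
move=> ab b1 b2 cf cH dH; apply: complexP; rewrite !ReImE /=.
  apply: (integral_derivative_off (H := fun t => complex.Re (H t)) ab b1).
  - by move=> t tab tB; have [] := cf t tab tB.
  - apply: continuous_in_subspaceT => t; rewrite inE /= in_itv /=.
    by move=> /cH[].
  - by move=> t tab tB; have /tdiff_derive[] := dH t tab tB.
apply: (integral_derivative_off (H := fun t => complex.Im (H t)) ab b2).
- by move=> t tab tB; have [] := cf t tab tB.
- apply: continuous_in_subspaceT => t; rewrite inE /= in_itv /=.
  by move=> /cH[].
- by move=> t tab tB; have /tdiff_derive[] := dH t tab tB.
Qed.

Lemma cintD (B : seq R) (f g : R -> C) (a b : R) :
  bounded_off B (fun t => complex.Re (f t)) a b ->
  bounded_off B (fun t => complex.Im (f t)) a b ->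
  (forall t, a < t < b -> t \notin B -> ccont f t) ->
  bounded_off B (fun t => complex.Re (g t)) a b ->
  bounded_off B (fun t => complex.Im (g t)) a b ->
  (forall t, a < t < b -> t \notin B -> ccont g t) ->
  cint a b (fun t => f t + g t) = cint a b f + cint a b g.
Proof.
move=> bf1 bf2 cf bg1 bg2 cg; apply: complexP; rewrite !ReImE /=.
  rewrite -RintegralD//.
  - by apply: eq_Rintegral => t _; rewrite ReImE.
  - by apply: (integrable_off bf1) => t tab tB; have [] := cf t tab tB.
  - by apply: (integrable_off bg1) => t tab tB; have [] := cg t tab tB.
rewrite -RintegralD//.
- by apply: eq_Rintegral => t _; rewrite ReImE.
- by apply: (integrable_off bf2) => t tab tB; have [] := cf t tab tB.
- by apply: (integrable_off bg2) => t tab tB; have [] := cg t tab tB.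
Qed.

End ComplexLimits.

Section PathLimit.
Variables (R : realType) (G : marked_curve R) (E : bundle R (amb G)).
Hypotheses (hz : has_coordinates G) (hD : is_marking G) (hE : is_bundle E).
Local Notation C := R[i].
Local Notation X := (pts G).
Local Notation U := (@open_part R G).
Local Notation phi := (param G).
Local Notation pt := (Pn R (amb G)).
Variables (c : R -> bpoint G) (W : set (bpoint G)) (v : sect E).
Hypothesis hcU : forall t : R, 0 < t < 1 -> exists2 q, U q & c t = In q.
Hypothesis hbl : forall t, simplex1 t -> blowup (c t).
Hypothesis hpw : piecewise_smooth (@simplex1 R) c.
Hypotheses (bW : bopen W) (hW : forall t, 0 <= t <= 1 -> W (c t)) (hv : horizontal_mod W v).
Variables (omega s : sect (dual E)) (m : formal (dual E)).
Hypotheses (homega : regular_form omega) (hs : smooth_with_taylor s m).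
Hypothesis (heta : rd_form (eta_infty omega s)).

Let fo := pullback c (fun=> v) (omega, fun _ _ => 0).
Let fs := pullback c (fun=> v) (nabla s, dbar s).
Let fe := pullback c (fun=> v) (eta_infty omega s).
Let H t := bpairing v s (c t).

Lemma pullback_eta t : fe t = fo t - fs t.
Proof.
rewrite /fe /fo /fs /pullback; case: (c t) => [q|? ?]; last by rewrite subrr.
set g' := cderive _ _ _ => /=; clearbody g'.
have p1 : pairing v (fun i q => omega i q - nabla s i q) q =
    pairing v omega q - pairing v (nabla s) q.
  rewrite /pairing; case: pickP => [i _|_]; last by rewrite subrr.
  by rewrite -sumrB; apply: eq_bigr => a _; rewrite !mxE mulrBr.
have p2 : pairing v (fun i q => - dbar s i q) q = - pairing v (dbar s) q.
  rewrite /pairing; case: pickP => [i _|_]; last by rewrite oppr0.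
  by rewrite -sumrN; apply: eq_bigr => a _; rewrite !mxE mulrN.
have p3 : pairing v (fun _ _ => 0) q = 0.
  by rewrite /pairing; case: pickP => // i _; rewrite big1// => a _; rewrite mxE mulr0.
by rewrite p1 p2 p3; ring.
Qed.

Lemma path_limit (mt : bool -> sect (dual E)) :
  (forall o : bool, match c o%:R with
     | Bd x u => germ_with_expansion x u (mt o) (m x)
     | In _ => mt o = fun _ _ => 0 end) ->
  (cint e (1 - e) fo + bpairing v (mt false) (c e) - bpairing v (mt true) (c (1 - e)) : R[i]^o)
     @[e --> 0^'+] --> (cint 0 1 fe + H 1 - H 0 : R[i]^o).
Proof.
have [gs ss sT] := hs; have [Ts [KE sTs]] := hpw.
pose B := flatten Ts.
have BT y T : T \in Ts -> y \notin B -> y \notin T.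
  by move=> TTs; apply: contra => yT; apply/flattenP; exists T.
have hullK T y : T \in Ts -> hull T y -> 0 <= y <= 1.
  move=> TTs Ty; have : [set t | exists2 T, T \in Ts & hull T t] y by exists T.
  by rewrite -KE /simplex1 /= in_itv.
have Khull (y : R) : 0 <= y <= 1 -> exists2 T, T \in Ts & hull T y.
  move=> y01; have : simplex1 y by rewrite /simplex1 /= in_itv.
  by rewrite KE.
(* A parameter off [B] lies strictly between two vertices of a piece, and all vertices lie in
   [0, 1]; in particular 0 and 1 belong to [B]. *)
have BK (y : R) : 0 <= y <= 1 -> y \notin B -> 0 < y < 1.
  move=> /Khull[T TTs Ty] /(BT _ _ TTs) yT; have /hullP[a [b [aT bT /andP[ay yb]]]] := Ty.
  have /andP[a0 _] : 0 <= a <= 1.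
    by apply: (hullK T) => //; apply/hullP; exists a, a; rewrite lexx.
  have /andP[_ b1] : 0 <= b <= 1.
    by apply: (hullK T) => //; apply/hullP; exists b, b; rewrite lexx.
  apply/andP; split.
    rewrite (le_lt_trans a0)// lt_neqAle ay andbT; by apply: contra yT => /eqP <-.
  rewrite (lt_le_trans _ b1)// lt_neqAle yb andbT; by apply: contra yT => /eqP ->.
have inU (t : R) p : 0 <= t <= 1 -> c t = In p -> W (In p) /\ U p.
  move=> t01 ct; split; first by rewrite -ct; exact: hW.
  by have := hbl (t := t); rewrite ct; apply; rewrite /simplex1 /= in_itv.
have inD (t : R) x u : 0 <= t <= 1 -> c t = Bd x u -> [/\ marked G x, X x & W (Bd x u)].
  move=> t01 ct; have [Dx _] : marked G x /\ cmod u = 1.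
    by have := hbl (t := t); rewrite ct; apply; rewrite /simplex1 /= in_itv.
  by have [DX _ _] := hD; split => //; [exact: DX|rewrite -ct; exact: hW].
have local (t : R) p (T : seq R) : 0 <= t <= 1 -> c t = In p -> T \in Ts -> hull T t ->
  exists F1 F2 H' : R -> C, \forall y \near t, [/\ ccont F1 y, ccont F2 y, ccont H' y &
    hull T y -> H y = H' y /\ (y \notin T -> fo y = F1 y /\ fs y = F2 y)].
  move=> t01 ct TTs Tt; have [Wp Up] := inU _ _ t01 ct.
  exact: (pullback_near hz hE bW hv gs ss homega Wp Up ct Tt (sTs _ TTs)).
pose bnd (f : R -> C) (t : R) := exists M, \forall y \near t, 0 <= y <= 1 -> y \notin B ->
  cmod (f y) <= M.
have bndP (f : R -> C) (t : R) : (forall T, T \in Ts -> hull T t -> exists M, \forall y \near t,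
    hull T y -> y \notin B -> cmod (f y) <= M) -> bnd f t.
  move=> h; have [|M MP] := @near_pieces_bounded _ Ts (fun M y => y \notin B -> cmod (f y) <= M) t _ h.
    by move=> M N y MN yM yB; exact: le_trans (yM yB) MN.
  by exists M; apply: filterS MP => y yP /Khull; exact: yP.
have bo (t : R) p : 0 <= t <= 1 -> c t = In p -> bnd fo t /\ bnd fs t.
  move=> t01 ct; split; apply: bndP => T TTs Tt;
    have [F1 [F2 [H' loc]]] := local _ _ _ t01 ct TTs Tt;
    have [c1 c2 _ _] := nbhs_singleton loc.
    exists (cmod (F1 t) + 1); apply: filterS (filterI loc (ccont_bounded c1)).
    by move=> y [[_ _ _ yP] b1] /yP[_ h] /(BT _ _ TTs)/h[-> _].
  exists (cmod (F2 t) + 1); apply: filterS (filterI loc (ccont_bounded c2)).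
  by move=> y [[_ _ _ yP] b1] /yP[_ h] /(BT _ _ TTs)/h[_ ->].
(* At a point of U both parts of [fe] are bounded; at a boundary end the bound is on [fe] as a
   whole, by the decay of eta. *)
have be (t : R) : 0 <= t <= 1 -> bnd fe t.
  move=> t01; case ct : (c t) => [p|x u].
    have [[M1 M1P] [M2 M2P]] := bo _ _ t01 ct; exists (M1 + M2).
    apply: filterS (filterI M1P M2P) => y [h1 h2] y01 yB; rewrite pullback_eta.
    by rewrite (le_trans (cmodD _ _))// cmodN lerD// ?h1 ?h2.
  have [Dx Xx Wx] := inD _ _ _ t01 ct; apply: bndP => T TTs Tt.
  have [M MP] := pullback_bounded hz Dx Xx hcU hv Wx heta ct Tt (sTs _ TTs).
  exists M; apply: filterS MP => y h Ty yB.
  by apply: h (BT _ _ TTs yB) (BK _ (hullK _ _ TTs Ty) yB).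
have reg (t : R) : 0 < t < 1 -> t \notin B -> [/\ ccont fo t, ccont fs t & tdiff H t (fs t)].
  move=> /[dup] t01 /andP[t0 t1] tB.
  have t01' : 0 <= t <= 1 by rewrite !ltW.
  have [T TTs Tt] := Khull _ t01'; have [q Uq ct] := hcU t01.
  have [F1 [F2 [H' loc]]] := local _ _ _ t01' ct TTs Tt.
  have [c1 c2 _ _] := nbhs_singleton loc.
  have tT := BT _ _ TTs tB.
  (* [fo] and [fs] agree with their chart expressions only off the vertices. These are finitely
     many, so a neighbourhood of t avoids them. *)
  have nT : \forall y \near t, y \notin T.
    have clT : closed [set` T].
      by apply: (accessible_finite_set_closed.1 (hausdorff_accessible (@Rhausdorff R))); exact: finite_seq.
    have : open (~` [set` T]) by exact: closed_openC.
    have nt : (~` [set` T]) t by move/negP : tT.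
    move=> oT; have nn : nbhs t (~` [set` T]) by apply: open_nbhs_nbhs; split.
    by apply: filterS nn => y /negP.
  have near2 : \forall y \near t, hull T y /\ y \notin T.
    exact: filterI (hull_interior Tt tT) nT.
  split.
  - apply: ccont_near_eq c1; apply: filterS (filterI loc near2) => y [[_ _ _ h] [Ty yT]].
    by have [_ /(_ yT)[->]] := h Ty.
  - apply: ccont_near_eq c2; apply: filterS (filterI loc near2) => y [[_ _ _ h] [Ty yT]].
    by have [_ /(_ yT)[_ ->]] := h Ty.
  - have [Wq _] := inU _ _ t01' ct.
    exact: (tdiff_pairing hz hE bW hv gs ss ct Uq Wq (interior_chart Tt tT (sTs _ TTs _ Tt) ct)).
(* At a break-point the derivative of H may jump, but H stays continuous: every piece through t has
   a continuous local formula with the same value H t. *)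
have cH (t : R) p : 0 <= t <= 1 -> c t = In p -> forall e : R, 0 < e ->
    \forall y \near t, 0 <= y <= 1 -> cmod (H y - H t) < e.
  move=> t01 ct e e0.
  have : forall T, T \in Ts -> hull T t -> \forall y \near t, hull T y -> cmod (H y - H t) < e.
    move=> T TTs Tt; have [F1 [F2 [H' loc]]] := local _ _ _ t01 ct TTs Tt.
    have [_ _ c3 /(_ Tt)[Ht _]] := nbhs_singleton loc.
    apply: filterS (filterI loc (ccont_near_cmod c3 e0)) => y [[_ _ _ h] cy] Ty.
    by have [-> _] := h Ty; rewrite Ht.
  by move=> /near_pieces; apply: filterS => y yP /Khull.
(* One formula serves both kinds of ends. In U the germ is zero and H tends to H t; on the boundary
   H t = 0 by the convention in [bpairing], and the pairings with the germ and with s approach each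
   other. *)
have ends (t : R) (y : sect (dual E)) : 0 <= t <= 1 ->
    match c t with Bd x u => germ_with_expansion x u y (m x) | In _ => y = fun _ _ => 0 end ->
    forall e : R, 0 < e -> \forall y' \near t, 0 < y' < 1 ->
      cmod (bpairing v y (c y') - H y' + H t) < e.
  move=> t01; case ct : (c t) => [p|x u] ty e e0.
    apply: filterS (cH _ _ t01 ct _ e0) => y' h /andP[y0 y1].
    have -> : bpairing v y (c y') = 0.
      rewrite ty /bpairing; case: (c y') => // q.
      by rewrite /pairing; case: pickP => // i _; rewrite big1// => a _; rewrite mxE mulr0.
    by rewrite sub0r addrC -cmodN opprB h// !ltW.
  have [Dx Xx Wx] := inD _ _ _ t01 ct.
  have Ht : H t = 0 by rewrite /H ct.
  have : forall T, T \in Ts -> hull T t -> \forall y' \near t, hull T y' -> 0 < y' < 1 ->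
      cmod (bpairing v y (c y') - H y') < e.
    move=> T TTs Tt.
    exact: (pairing_limit hz Dx Xx hcU hv Wx ct (sTs _ TTs _ Tt) hs ty e0).
  move=> /near_pieces; apply: filterS => y' h y'01; rewrite Ht addr0.
  have /andP[y0 y1] := y'01.
  by apply: (h _ y'01); apply: Khull; rewrite !ltW.
move=> hmt; apply: cvg_cmod => e e0.
have e3 : 0 < e / 3 by rewrite divr_gt0.
have bd (f : R -> C) a b : 0 <= a -> b <= 1 -> (forall t, a <= t <= b -> bnd f t) ->
    bounded_off B (fun t => complex.Re (f t)) a b /\
    bounded_off B (fun t => complex.Im (f t)) a b.
  move=> a0 b1 bf; split=> t /bf[M MP]; exists M; apply: filterS MP => y h /andP[ay yb] yB;
    (have {}h : cmod (f y) <= M by apply: h => //; rewrite (le_trans a0)// (le_trans yb)).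
    exact: le_trans (cmod_ge_Re _) h.
  exact: le_trans (cmod_ge_Im _) h.
have [be1 be2] := bd fe 0 1 (lexx _) (lexx _) be.
have ce t : 0 < t < 1 -> t \notin B -> ccont fe t.
  move=> t01 tB; have [c1 c2 _] := reg _ t01 tB.
  apply: ccont_near_eq (ccontD c1 (ccontM (ccont_cst (-1) t) c2)).
  by apply: filterE => y; rewrite pullback_eta mulN1r.
have n1 := cint_exhaustion be1 be2 ce e3.
have n2 := ends 0 (mt false) _ (hmt false) _ e3; rewrite lexx ler01 in n2.
have {n2} n2 := n2 isT.
have n3 := ends 1 (mt true) _ (hmt true) _ e3; rewrite lexx ler01 in n3.
have {n3} n3 := n3 isT.
have n3' : \forall d \near 0^'+, 0 < 1 - d < 1 ->
    cmod (bpairing v (mt true) (c (1 - d)) - H (1 - d) + H 1) < e / 3.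
  have := n3 => /nbhs_ballP[d /= d0 dP]; exists d => // y /= yd y0.
  apply: dP; rewrite /ball /= opprB addrC subrK.
  by move: yd; rewrite sub0r normrN.
have n2' : \forall d \near 0^'+, 0 < d < 1 ->
    cmod (bpairing v (mt false) (c d) - H d + H 0) < e / 3.
  have := n2 => /nbhs_ballP[d /= d0 dP]; exists d => // y /= yd y0.
  exact: dP.
have small : \forall d \near (0 : R)^'+, 0 < d < 2^-1.
  have h1 : \forall d \near (0 : R)^'+, 0 < d by exact: nbhs_right_gt.
  have h2 : \forall d \near (0 : R)^'+, d < 2^-1 by apply: nbhs_right_lt; rewrite invr_gt0.
  by apply: filterS (filterI h1 h2) => d [-> ->].
apply: filterS (filterI small (filterI n1 (filterI n2' n3'))) => d [d01 [h1 [h2 h3]]].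
have {}h2 : cmod (bpairing v (mt false) (c d) - H d + H 0) < e / 3 by apply: h2; lra.
have {}h3 : cmod (bpairing v (mt true) (c (1 - d)) - H (1 - d) + H 1) < e / 3 by apply: h3; lra.
have dd : d < 1 - d by lra.
have inner t : d <= t <= 1 - d -> 0 < t < 1 by lra.
have inner' t : d < t < 1 - d -> 0 < t < 1 by lra.
have bi t : d <= t <= 1 - d -> bnd fe t /\ bnd fs t.
  move=> /inner t01; have [q _ ct] := hcU t01; have /andP[t0 t1] := t01.
  have t01' : 0 <= t <= 1 by rewrite !ltW.
  by split; [exact: be|exact: (bo _ _ t01' ct).2].
have d0 : 0 <= d by lra.
have d1 : 1 - d <= 1 by lra.
have [e1 e2] := bd fe d (1 - d) d0 d1 (fun t td => (bi t td).1).
have [s1 s2] := bd fs d (1 - d) d0 d1 (fun t td => (bi t td).2).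
(* On [d, 1 - d] the path stays in U, so [fs] is bounded there and H is its primitive. *)
have intE : cint d (1 - d) fo = cint d (1 - d) fe + (H (1 - d) - H d).
  have -> : fo = (fun t => fe t + fs t) by apply/funext => t; rewrite pullback_eta subrK.
  rewrite (cintD e1 e2 _ s1 s2); first congr (_ + _).
  - apply: (cint_derivative dd s1 s2).
    + by move=> t /inner' t01 tB; have [_ ? _] := reg _ t01 tB.
    + move=> t /inner /[dup] t01 /andP[t0 t1]; have [q _ ct] := hcU t01.
      have t01' : 0 <= t <= 1 by rewrite !ltW.
      apply: near_cmod_ccont => e' e'0.
      have : t \in `]0, 1[ by rewrite in_itv.
      move=> /near_in_itvoo/(filterI (cH _ _ t01' ct _ e'0)); apply: filterS => y [h].
      by rewrite in_itv/= => /andP[y0 y1]; apply: h; rewrite !ltW.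
    + by move=> t /inner' t01 tB; have [_ _ ?] := reg _ t01 tB.
  - by move=> t /inner' t01 tB; exact: ce.
  - by move=> t /inner' t01 tB; have [_ ? _] := reg _ t01 tB.
rewrite intE.
have -> : cint d (1 - d) fe + (H (1 - d) - H d) + bpairing v (mt false) (c d) -
   bpairing v (mt true) (c (1 - d)) - (cint 0 1 fe + H 1 - H 0) =
   (cint d (1 - d) fe - cint 0 1 fe) + (bpairing v (mt false) (c d) - H d + H 0)
   - (bpairing v (mt true) (c (1 - d)) - H (1 - d) + H 1) by ring.
rewrite (le_lt_trans (cmodD _ _))// cmodN.
have := cmodD (cint d (1 - d) fe - cint 0 1 fe) (bpairing v (mt false) (c d) - H d + H 0).
lra.
Qed.

End PathLimit.

(** * Summing over a cycle *)

Section CycleSum.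
Variables (R : realType) (G : marked_curve R) (E : bundle R (amb G)).
Hypotheses (hz : has_coordinates G).
Local Notation C := R[i].
Local Notation U := (@open_part R G).
Local Notation pt := (Pn R (amb G)).

Definition inner_point (xi : bpoint G) : option pt := if xi is In p then Some p else None.

(** Written as a sum over a fixed finite list of points, the pairing allows the sum over paths and
    the sum over end-points to be exchanged. *)
Lemma bpairing_split (v : sect E) (s : sect (dual E)) (S : seq pt) xi :
  uniq S -> (forall p, xi = In p -> p \in S) ->
  bpairing v s xi = \sum_(p <- S) if `[< xi = In p >] then pairing v s p else 0.
Proof.
move=> uS; case: xi => [q|x u] xiS; last first.
  by rewrite big1// => p _; case: asboolP.
rewrite (bigD1_seq q) ?xiS//= [X in _ + X]big1 ?addr0 => [|p pq]; first by case: asboolP.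
by case: asboolP => // -[qp]; rewrite qp eqxx in pq.
Qed.

(** Both sides are sorted by the point of U where a path ends or starts. At each such point the
    cycle condition equates the two sums of sections, and the pairing with s is linear in the
    section once the frame is fixed. *)
Lemma sum_boundary (N : nat) (c0 c1 : 'I_N -> bpoint G) (v : 'I_N -> sect E)
    (s : sect (dual E)) :
  (forall l p, c0 l = In p -> U p) -> (forall l p, c1 l = In p -> U p) ->
  (forall p i, U p -> opn E i p ->
    \sum_(l | `[< c1 l = In p >]) v l i p - \sum_(l | `[< c0 l = In p >]) v l i p = 0) ->
  \sum_l bpairing (v l) s (c1 l) = \sum_l bpairing (v l) s (c0 l).
Proof.
move=> U0 U1 cyc.
pose ends := [seq inner_point (c0 l) | l <- enum 'I_N] ++ [seq inner_point (c1 l) | l <- enum 'I_N].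
pose S := undup (pmap id ends).
have inS0 l p : c0 l = In p -> p \in S.
  move=> cl; rewrite mem_undup mem_pmap map_id mem_cat; apply/orP; left.
  by apply/mapP; exists l; rewrite ?mem_enum//= cl.
have inS1 l p : c1 l = In p -> p \in S.
  move=> cl; rewrite mem_undup mem_pmap map_id mem_cat; apply/orP; right.
  by apply/mapP; exists l; rewrite ?mem_enum//= cl.
rewrite (eq_bigr _ (fun l _ => bpairing_split (v l) s (undup_uniq _) (inS1 l))).
rewrite [RHS](eq_bigr _ (fun l _ => bpairing_split (v l) s (undup_uniq _) (inS0 l))).
rewrite exchange_big [RHS]exchange_big /=; apply: eq_bigr => p _.
rewrite -!big_mkcond /=.
have [Up|nU] := pselect (U p); last first.
  by rewrite !big_pred0// => l; apply: asboolF; [move/U0|move/U1].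
rewrite /pairing; case: pickP => [i /asboolP ip|_]; last by rewrite !big1.
have /eqP := cyc p i Up ip; rewrite subr_eq0 => /eqP e.
rewrite exchange_big [RHS]exchange_big /=; apply: eq_bigr => a _.
rewrite -!mulr_suml; congr (_ * _).
by have := congr1 (fun A : 'cV[C]_(rank E) => A a 0) e; rewrite !summxE.
Qed.

End CycleSum.

Theorem proposition3p18 (R : realType) (G : marked_curve R)
  (E : bundle R (amb G))
  (hX : smooth_projective_curve G) (hD : is_marking G)
  (hz : has_coordinates G) (hE : is_bundle E)
  (P : H1mod E -> H1rd (dual E) -> R[i]) (hP : is_period_pairing P)
  (Phi : H1c (dual E) -> H1rd (dual E)) (hPhi : is_comparison Phi)
  (sigma : H1mod E) (N : nat)
  (c : 'I_N -> R -> bpoint G) (W : 'I_N -> set (bpoint G))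
  (v : 'I_N -> sect E)
  (hcU : forall l t, 0 < t < 1 -> exists2 q, open_part q & c l t = In q)
  (hW : forall l, bopen (W l) /\ forall t, 0 <= t <= 1 -> W l (c l t))
  (hv : forall l, horizontal_mod (W l) (v l))
  (hsigma : sval sigma [seq (c l, fun=> v l) | l <- enum 'I_N])
  (kappa : H1c (dual E)) (m : formal (dual E)) (omega : sect (dual E))
  (hkappa : sval kappa (m, omega))
  (mt : 'I_N -> bool -> sect (dual E))
  (hmt : forall l (o : bool),
     match c l (o%:R) with
     | Bd x u => germ_with_expansion x u (mt l o) (m x)
     | In _ => mt l o = fun _ _ => 0
     end) :
  exists L : 'I_N -> R[i],
    (forall l,
      (cint e (1 - e) (pullback (c l) (fun=> v l) (omega, fun _ _ => 0))
       + bpairing (v l) (mt l false) (c l e)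
       - bpairing (v l) (mt l true) (c l (1 - e)) : R[i]^o)
      @[e --> 0^'+] --> (L l : R[i]^o)) /\
    P sigma (Phi kappa) = \sum_(l < N) L l.
Proof.
have [s [sT etaP]] := hPhi _ _ _ hkappa.
have PE := hP _ _ _ _ hsigma etaP; rewrite big_map big_enum /= in PE.
(* A class is a set of cycles or cocycles, so a representative inherits the corresponding conditions
   by membership; the same is used for eta and omega. *)
have [chainZ cycZ] : is_cycle [seq (c l, fun=> v l) | l <- enum 'I_N].
  by case: sigma hsigma {PE} => sg [Z _ sgE] /=; rewrite sgE => -[].
have heta : rd_form (eta_infty omega s).
  by case: (Phi kappa) etaP {PE} => sg [Z _ sgE] /=; rewrite sgE => -[[]].
have homega : regular_form omega.
  by case: kappa hkappa {PE etaP} => sg [Z _ sgE] /=; rewrite sgE => -[[_ ? _] _].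
have [hbl hpw] : (forall l t, simplex1 t -> blowup (c l t)) /\
    (forall l, piecewise_smooth (@simplex1 R) (c l)).
  suff h l : (forall t, simplex1 t -> blowup (c l t)) /\ piecewise_smooth (@simplex1 R) (c l).
    by split=> l; have [] := h l.
  have : l \in enum 'I_N by rewrite mem_enum.
  move: chainZ; rewrite /is_chain; elim: (enum _) => // l' ls IH /= F.
  rewrite inE; inversion F as [|? ? [h1 h2 _] F']; subst.
  by move=> /predU1P[->|/(IH F')//].
exists (fun l => cint 0 1 (pullback (c l) (fun=> v l) (eta_infty omega s)) +
  bpairing (v l) s (c l 1) - bpairing (v l) s (c l 0)); split=> [l|].
  have [bW WW] := hW l.
  exact: (path_limit hz hD hE (hcU l) (hbl l) (hpw l) bW WW (hv l) homega sT heta (hmt l)).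
rewrite PE -[LHS]addr0 sumrB big_split /= -addrA; congr (_ + _).
have in01 (b : bool) : simplex1 (b%:R : R).
  by rewrite /simplex1 /= in_itv /=; case: b; rewrite ?lexx ?ler01.
have inU (b : bool) l p : c l b%:R = In p -> open_part p.
  by move=> cl; have := hbl l _ (in01 b); rewrite cl.
apply/esym/eqP; rewrite subr_eq0; apply/eqP.
apply: (@sum_boundary R G E _ (fun l => c l 0) (fun l => c l 1)).
- exact: inU false.
- exact: inU true.
(* The cycle condition is an equality of germs at p; evaluated at the centre w = 0 of the chart it
   gives the equality of values at p. *)
move=> p i Up ip; have [e e0 eP] := cycZ _ Up.
have [Xp _] := Up; have := eP 0; rewrite cmod0 => /(_ e0); rewrite (phi0 hz Xp) => /(_ _ ip).
by rewrite !big_map -!enumT !big_enum_cond.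
Qed.
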